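(* Let $n,p$ be integers with $p>n\ge 3$. Let $X\sim N_p(\theta,\Sigma)$ with unknown mean $\theta\in\mathbb{R}^p$ and unknown positive definite covariance matrix $\Sigma$, and let $S\sim \mathrm{Wishart}_p(n,\Sigma)$ be independent of $X$. Then for every nondecreasing differentiable function $r:\mathbb{R}\to\mathbb{R}$ satisfying $$0\le r\le \frac{2(n-2)}{p-n+3},$$ the estimator $$\delta_r(X,S)=\left(I-\frac{r(X'S^+X)\,SS^+}{X'S^+X}\right)X$$ dominates $\delta^0(X,S)=X$ under the invariant quadratic loss $L(\theta,\delta)=(\delta-\theta)'\Sigma^{-1}(\delta-\theta)$.
   Context: $M'$ denotes the transpose and $M^+$ the Moore--Penrose pseudo-inverse of a matrix $M$; $I$ is the $p\times p$ identity matrix. $S\sim\mathrm{Wishart}_p(n,\Sigma)$ means that $S=Y'Y$ for an $n\times p$ random matrix $Y\sim N_{n\times p}(0,I_n\otimes\Sigma)$, i.e. the rows of $Y$ are i.i.d. $N_p(0,\Sigma)$; for $p>n$ the matrix $S$ is almost surely singular. The estimator $\delta_r$ is defined almost surely (where $X'S^+X\neq 0$). The risk of an estimator $\delta(X,S)$ at $(\theta,\Sigma)$ is $E_{\theta}[(\delta(X,S)-\theta)'\Sigma^{-1}(\delta(X,S)-\theta)]$, the expectation being over $(X,S)$. ''$\delta_r$ dominates $\delta^0$'' means that the risk of $\delta_r$ is less than or equal to the risk of $\delta^0$ for every $\theta$ (and every positive definite $\Sigma$). *)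

(* Defs.v *)
From HB Require Import structures.
From mathcomp Require Import all_boot all_order all_algebra.
From mathcomp Require Import all_classical all_reals all_analysis.

Set Implicit Arguments.
Unset Strict Implicit.
Unset Printing Implicit Defensive.

Import Order.TTheory GRing.Theory Num.Theory.
Import numFieldNormedType.Exports.

Local Open Scope classical_set_scope.
Local Open Scope ring_scope.

(* Real matrices, hence column vectors, carry the Borel sigma-algebra. *)
Section borel_matrix.
Variables (R : realType) (m n : nat).

HB.instance Definition _ := @isMeasurable.Build
  (sigma_display (@open 'M[R]_(m, n))) 'M[R]_(m, n)
  <<s @open 'M[R]_(m, n) >> (@sigma_algebra0 _ setT _) (@sigma_algebraC _ _)
  (@sigma_algebra_bigcup _ setT _).

End borel_matrix.

Section pseudo_inverse.
Variable R : realType.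

Definition is_mp_inverse (m n : nat) (M : 'M[R]_(m, n)) (G : 'M[R]_(n, m)) :=
  [/\ M *m G *m M = M, G *m M *m G = G,
      (M *m G)^T = M *m G & (G *m M)^T = G *m M].

(* The default value 0 is never used: see mp_inverseP and
   is_mp_inverse_uniq. *)
Definition mp_inverse (m n : nat) (M : 'M[R]_(m, n)) : 'M[R]_(n, m) :=
  xget 0 [set G | is_mp_inverse M G].

Lemma is_mp_inverse_uniq (m n : nat) (M : 'M[R]_(m, n)) G H :
  is_mp_inverse M G -> is_mp_inverse M H -> G = H.
Proof.
move=> [MGM GMG MGt GMt] [MHM HMH MHt HMt].
have eMG : M *m G = M *m H.
  rewrite -MGt -[in LHS]MHM -mulmxA trmx_mul MGt MHt.
  by rewrite mulmxA MGM.
have eGM : G *m M = H *m M.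
  rewrite -GMt -[in LHS]MHM -mulmxA mulmxA trmx_mul HMt GMt.
  by rewrite -!mulmxA [M *m (G *m M)]mulmxA MGM.
by rewrite -GMG -mulmxA eMG mulmxA eGM.
Qed.

Lemma row_free_mul_tr (m n : nat) (A : 'M[R]_(m, n)) :
  row_free A -> A *m A^T \in unitmx.
Proof.
move=> Af; rewrite -row_free_unit -kermx_eq0; apply/eqP/row_matrixP => i.
rewrite row0; set u := row i _.
have u0 : u *m (A *m A^T) = 0 by rewrite /u -row_mul mulmx_ker row0.
have : (u *m A) *m (u *m A)^T = 0.
  by rewrite trmx_mul mulmxA -[X in X *m _]mulmxA u0 mul0mx.
move=> /matrixP/(_ 0 0); rewrite !mxE => /eqP.
under eq_bigr do rewrite [X in _ * X]mxE -expr2.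
rewrite psumr_eq0 => [/allP uA0|j _]; last exact: sqr_ge0.
apply: (row_free_inj Af); rewrite mul0mx; apply/rowP => j; rewrite [RHS]mxE.
by apply/eqP; rewrite -sqrf_eq0; exact: (uA0 j (mem_index_enum j)).
Qed.

Lemma is_mp_inverse_mul (m n k : nat) (C : 'M[R]_(m, k)) (F : 'M[R]_(k, n)) :
  row_free C^T -> row_free F ->
  is_mp_inverse (C *m F)
    (F^T *m invmx (F *m F^T) *m invmx (C^T *m C) *m C^T).
Proof.
move=> /row_free_mul_tr; rewrite trmxK => CCu /row_free_mul_tr FFu.
have sFF : (invmx (F *m F^T))^T = invmx (F *m F^T).
  by rewrite trmx_inv trmx_mul trmxK.
have sCC : (invmx (C^T *m C))^T = invmx (C^T *m C).
  by rewrite trmx_inv trmx_mul trmxK.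
set G := _ *m C^T.
have MG : C *m F *m G = C *m invmx (C^T *m C) *m C^T.
  by rewrite /G !mulmxA -[C *m F *m F^T]mulmxA mulmxK.
have GM : G *m (C *m F) = F^T *m invmx (F *m F^T) *m F.
  by rewrite /G !mulmxA -[_ *m C^T *m C]mulmxA mulmxKV.
split.
- by rewrite MG !mulmxA -[_ *m C^T *m C]mulmxA mulmxKV.
- by rewrite GM /G !mulmxA -[_ *m F *m F^T]mulmxA mulmxKV.
- by rewrite MG !trmx_mul trmxK sCC mulmxA.
- by rewrite GM !trmx_mul trmxK sFF mulmxA.
Qed.

Lemma mp_inverseP (m n : nat) (M : 'M[R]_(m, n)) :
  is_mp_inverse M (mp_inverse M).
Proof.
have Cf : row_free (col_base M)^T.
  by rewrite /row_free mxrank_tr; exact: col_base_full.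
have := is_mp_inverse_mul Cf (row_base_free M).
by rewrite mulmx_base => /(@xgetI _ 0 [set G | is_mp_inverse M G]).
Qed.

End pseudo_inverse.

Section probability_notions.
Context {R : realType} {d : measure_display} {T : measurableType d}.
Variable P : probability T R.

Definition indep_RV (d1 d2 : measure_display) (T1 : measurableType d1)
    (T2 : measurableType d2) (X : {RV P >-> T1}) (Y : {RV P >-> T2}) : Prop :=
  forall (A : set T1) (B : set T2), measurable A -> measurable B ->
    P (X @^-1` A `&` Y @^-1` B) = (P (X @^-1` A) * P (Y @^-1` B))%E.

Definition mutual_indep_RV (I : finType) (d' : measure_display)
    (T' : measurableType d') (Z : I -> {RV P >-> T'}) : Prop :=
  forall (J : {set I}) (A : I -> set T'), (forall i, measurable (A i)) ->
    P (\bigcap_(i in [set` J]) (Z i @^-1` A i))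
    = (\prod_(i in J) P (Z i @^-1` A i))%E.

Definition std_normal_sample (p : nat) (Z : 'I_p -> {RV P >-> R}) : Prop :=
  mutual_indep_RV Z /\
  forall i (A : set R), measurable A ->
    distribution P (Z i) A = normal_prob 0 1 A.

(* N_p(theta, Sigma) as the law of affine images theta + A Z, A A' = Sigma, of
   standard normal vectors. Taking A square and Z on the same probability space
   loses no generality when Sigma is positive definite, since then A is
   invertible and Z = A^-1 (X - theta). *)
Definition multivariate_normal (p : nat) (theta : 'cV[R]_p) (Sigma : 'M[R]_p)
    (X : {RV P >-> 'cV[R]_p}) : Prop :=
  exists (A : 'M[R]_p) (Z : 'I_p -> {RV P >-> R}),
    [/\ A *m A^T = Sigma, std_normal_sample Z &
        forall w, X w = theta + A *m (\col_i Z i w)].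

(* The matrix whose i-th row is (Y_i)'. *)
Definition rows_mx (n p : nat) (Y : 'I_n -> {RV P >-> 'cV[R]_p}) (w : T) :
  'M[R]_(n, p) := \matrix_(i, j) Y i w j 0.

End probability_notions.

(* S ~ Wishart_p(n, Sigma): S has the law of Y'Y, where the rows of Y are
   i.i.d. N_p(0, Sigma). Y may live on another probability space, so that
   this is a property of the law of S only. *)
Definition wishart (R : realType) (d : measure_display) (T : measurableType d)
    (P : probability T R) (p n : nat) (Sigma : 'M[R]_p)
    (S : {RV P >-> 'M[R]_p}) : Prop :=
  exists (d' : measure_display) (T' : measurableType d')
         (Q : probability T' R) (Y : 'I_n -> {RV Q >-> 'cV[R]_p}),
    [/\ mutual_indep_RV Y,
        forall i, multivariate_normal 0 Sigma (Y i) &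
        forall A : set 'M[R]_p, measurable A ->
          distribution P S A
          = Q [set w | A ((rows_mx Y w)^T *m rows_mx Y w)]].

Section estimation.
Variables (R : realType) (p : nat).

Definition posdefmx (Sigma : 'M[R]_p) : Prop :=
  Sigma^T = Sigma /\
  forall u : 'cV[R]_p, u != 0 -> 0 < (u^T *m Sigma *m u) 0 0.

Definition estimator := 'cV[R]_p -> 'M[R]_p -> 'cV[R]_p.

Definition loss (Sigma : 'M[R]_p) (theta a : 'cV[R]_p) : R :=
  ((a - theta)^T *m invmx Sigma *m (a - theta)) 0 0.

Definition risk (d : measure_display) (T : measurableType d)
    (P : probability T R) (theta : 'cV[R]_p) (Sigma : 'M[R]_p)
    (X : T -> 'cV[R]_p) (S : T -> 'M[R]_p) (delta : estimator) : \bar R :=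
  'E_P[fun w => loss Sigma theta (delta (X w) (S w))].

Definition dominates (n : nat) (delta delta' : estimator) : Prop :=
  forall (theta : 'cV[R]_p) (Sigma : 'M[R]_p), posdefmx Sigma ->
  forall (d : measure_display) (T : measurableType d) (P : probability T R)
         (X : {RV P >-> 'cV[R]_p}) (S : {RV P >-> 'M[R]_p}),
    multivariate_normal theta Sigma X -> wishart n Sigma S -> indep_RV X S ->
    (risk P theta Sigma X S delta <= risk P theta Sigma X S delta')%E.

Definition delta0 : estimator := fun x _ => x.

(* When x' S^+ x = 0 the convention a / 0 = 0 makes the value x. *)
Definition delta_r (r : R -> R) : estimator := fun x S =>
  let Sp := mp_inverse S in
  let F := (x^T *m Sp *m x) 0 0 in
  (1%:M - (r F / F) *: (S *m Sp)) *m x.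

End estimation.

(* Main.v *)
Require Import Defs.
From HB Require Import structures.
From mathcomp Require Import all_boot all_order all_algebra.
From mathcomp Require Import all_classical all_reals all_analysis.
From mathcomp Require Import measurable_realfun ring lra.
Import Order.TTheory GRing.Theory Num.Theory.
Import numFieldNormedType.Exports.
Set Implicit Arguments.
Unset Strict Implicit.
Unset Printing Implicit Defensive.
Local Open Scope classical_set_scope.
Local Open Scope ring_scope.

(** Write [X = theta + A Z] with [A A' = Sigma], and [S = M' M], where the rows of
the [n * p] matrix [M] are independent [N(0, Sigma)] vectors. Almost surely [M]
has rank [n]; then, with [w = (M M')^-1 M X], one has [X' S^+ X = |w|^2] and
[S S^+ X = M' w], so that [delta_r] is [X - kappa(F) M' w] with [F = |w|^2] and
[kappa(s) = r(s) / s]. The loss difference with [X] is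

  [kappa^2 (M'w)' Sigma^-1 (M'w) - 2 kappa (X - theta)' Sigma^-1 (M'w)].

Both terms are linear in Gaussian vectors, and Stein's identity
[E (Z_l f) = E (d_l f)] turns each of them into the expectation of a divergence.
The second term is linear in [X - theta] and contributes
[- 2 (n kappa + 2 kappa' F)]. The first one equals
[sum_i y_i' Sigma^-1 (kappa^2 w_i M'w)], where the [y_i] are the rows of [M], and
integrating it by parts in one row at a time gives
[(p - n - 1) kappa^2 F - 4 kappa kappa' F^2]; the Wishart density never
appears. With [rho(s) = s kappa(s)] the sum of the divergences is

  [kappa (- 2 (n - 2) + (p - n + 3) rho) - 4 rho' (1 + rho)],

which is nonpositive as soon as [0 <= rho <= 2 (n - 2) / (p - n + 3)] and
[rho] is nondecreasing.

Three things prevent a direct application of Stein's identity: [(M M')^-1] is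
unbounded, [kappa] is singular at [0], and [r'] may be unbounded. The inverse is
therefore replaced with the ridge inverse [N = (M M' + eps)^-1]. The fields are
then bounded with bounded derivatives, their divergences can still be computed
exactly ([X_divergence], [row_divergence]), and the additional terms are at most
a constant times [eps tr N] ([ridge_risk_le]). This quantity is bounded by [n] and
tends to [0] wherever [M] has full rank, which is almost everywhere
([rows_mx_full_rank]). The function [r] is replaced with its mean over
[[s, s + delta]] and [1 / s] with [1 / (s + delta)], which preserves the sign of
the divergences ([profile_main_le0]). Since losses are nonnegative and
the risk of [X] is constant along the approximations, Fatou's lemma ([fatou_cvg])
removes [eps] in [smooth_risk_le] and [delta] in [canonical_risk_le].

All this takes place on the product of the probability space of [X] with the one
that carries [M]; independence and the law of [S] bring the risk of [delta_r] to
that space ([ge0_integral_independent]). *)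

(** * Borel measurability of matrix operations *)

Section borel_matrix_entries.
Context {R : realType} {m n : nat}.

(** Rational centre and radius, so that there are only countably many boxes. *)
Definition rat_box (ck : 'M[rat]_(m, n) * nat) : set 'M[R]_(m, n) :=
  [set M | forall i j, `|M i j - ratr (ck.1 i j)| < ck.2.+1%:R^-1].

(** Together with countability of the boxes, this expresses every Borel set of
matrices through conditions on single entries. *)
Lemma open_mx_bigcup_box (U : set 'M[R]_(m, n)) : open U ->
  U = \bigcup_(ck in [set ck | rat_box ck `<=` U]) rat_box ck.
Proof.
move=> oU; apply/seteqP; split; last by move=> x [ck sub]; exact: sub.
move=> x Ux; have := oU; rewrite openE => /(_ x Ux).
move=> /nbhs_ballP[e /= e0 sub].
have [k] : exists k : nat, k.+1%:R^-1 < e / 2.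
  have e20 : 0 < e / 2 by rewrite divr_gt0.
  exists (Num.truncn (e / 2)^-1); rewrite invf_plt ?posrE//.
  by rewrite truncnS_gt.
move=> ke.
have k0 : 0 < k.+1%:R^-1 :> R by rewrite invr_gt0.
have H i j : exists c : rat, `|x i j - ratr c| < k.+1%:R^-1.
  have [|c] := @rat_in_itvoo R (x i j - k.+1%:R^-1) (x i j + k.+1%:R^-1).
    by rewrite ltrBlDr -addrA ltrDl addr_gt0.
  by rewrite in_itv/= => /andP[c1 c2]; exists c; rewrite distrC ltr_distl c1.
pose c := \matrix_(i, j) sval (cid (H i j)).
exists (c, k); last first.
  by move=> i j; rewrite /c /= mxE; exact: (svalP (cid (H i j))).
move=> y /= yc; apply: sub; split => // i j.
have yc' := yc i j; rewrite mxE in yc'.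
have := svalP (cid (H i j)); move: yc'; set q := sval _ => yc' xc.
rewrite /ball/= (le_lt_trans (ler_distD (ratr q) _ _))//.
by rewrite [ltRHS]splitr ltrD// (lt_trans _ ke)// distrC.
Qed.

End borel_matrix_entries.

(** The Borel structure of matrices is the product structure of the entries, so
every matrix operation below is measurable because its entries are. *)
Lemma measurable_fun_mxP {R : realType} {m n : nat} (d : measure_display)
    (T : measurableType d) (Phi : T -> 'M[R]_(m, n)) :
  measurable_fun setT Phi <->
  forall i j, measurable_fun setT (fun t => Phi t i j).
Proof.
split=> [mPhi i j|mPhi].
- apply: (@measurableT_comp _ _ _ _ _ _ (fun M : 'M[R]_(m, n) => M i j)) => //.
  apply: (measurability _ (RGenOInfty.measurableE R)) => // _ [_ [a ->] <-].
  rewrite setTI; apply: sub_sigma_algebra.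
  by apply: open_comp; [move=> M _; exact: coord_continuous|exact: interval_open].
- apply: (@measurability _ _ _ _ _ _ (@open 'M[R]_(m, n))) => // _ [U oU <-].
  rewrite (open_mx_bigcup_box oU) setTI preimage_bigcup.
  rewrite bigcup_mkcond; apply: countable_bigcupT_measurable => // ck.
  case: ifPn => // _.
  have -> : Phi @^-1` rat_box ck = \bigcap_(ij in [set: 'I_m * 'I_n])
      [set t | `|Phi t ij.1 ij.2 - ratr (ck.1 ij.1 ij.2)| < ck.2.+1%:R^-1].
    by apply/seteqP; split=> [t h [i j] _|t h i j]; [exact: h|exact: (h (i, j))].
  apply: fin_bigcap_measurable => // -[i j] _ /=.
  rewrite -[X in measurable X]setTI.
  apply: (measurable_fun_ltr _ _ measurableT (Y := [set true])) => //.
  apply: measurableT_comp => //; exact: measurable_funB.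
Qed.

Section measurable_matrix_operations.
Context {R : realType} {d : measure_display} {T : measurableType d}.

(** The inverse is not continuous at [0], where its value is [0] by convention;
elsewhere [1 / x = x exp (- ln (x^2))]. *)
Lemma measurable_funV (f : T -> R) :
  measurable_fun setT f -> measurable_fun setT (fun t => (f t)^-1).
Proof.
move=> mf; have -> : (fun t => (f t)^-1) =
    (fun t => if f t == 0 then 0 else f t * expR (- ln (f t ^+ 2))).
  apply/funext => t; case: eqVneq => [->|ft0]; first by rewrite invr0.
  rewrite expRN lnK ?posrE ?exprn_even_gt0//.
  by rewrite expr2 invfM mulrA divff ?mul1r.
apply: measurable_fun_ifT => //; first exact: measurable_fun_eqr.
apply: measurable_funM => //; apply: measurableT_comp => //.
apply: measurableT_comp => //; apply: measurableT_comp => //.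
exact: measurable_funX.
Qed.

Lemma measurable_fun_entry m n (A : T -> 'M[R]_(m, n)) i j :
  measurable_fun setT A -> measurable_fun setT (fun t => A t i j).
Proof. by move=> /measurable_fun_mxP. Qed.

Lemma measurable_mulmx m n k (A : T -> 'M[R]_(m, n)) (B : T -> 'M[R]_(n, k)) :
  measurable_fun setT A -> measurable_fun setT B ->
  measurable_fun setT (fun t => A t *m B t).
Proof.
move=> mA mB; apply/measurable_fun_mxP => i j.
under eq_fun do rewrite mxE; apply: measurable_sum => l.
by apply: measurable_funM; exact: measurable_fun_entry.
Qed.

Lemma measurable_addmx m n (A B : T -> 'M[R]_(m, n)) :
  measurable_fun setT A -> measurable_fun setT B ->
  measurable_fun setT (fun t => A t + B t).
Proof.
move=> mA mB; apply/measurable_fun_mxP => i j.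
under eq_fun do rewrite mxE.
by apply: measurable_funD; exact: measurable_fun_entry.
Qed.

Lemma measurable_oppmx m n (A : T -> 'M[R]_(m, n)) :
  measurable_fun setT A -> measurable_fun setT (fun t => - A t).
Proof.
move=> mA; apply/measurable_fun_mxP => i j.
under eq_fun do rewrite mxE.
by apply: measurableT_comp => //; exact: measurable_fun_entry.
Qed.

Lemma measurable_scalemx m n (c : T -> R) (A : T -> 'M[R]_(m, n)) :
  measurable_fun setT c -> measurable_fun setT A ->
  measurable_fun setT (fun t => c t *: A t).
Proof.
move=> mc mA; apply/measurable_fun_mxP => i j.
under eq_fun do rewrite mxE.
by apply: measurable_funM => //; exact: measurable_fun_entry.
Qed.

Lemma measurable_trmx m n (A : T -> 'M[R]_(m, n)) :
  measurable_fun setT A -> measurable_fun setT (fun t => (A t)^T).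
Proof.
move=> mA; apply/measurable_fun_mxP => i j.
by under eq_fun do rewrite mxE; exact: measurable_fun_entry.
Qed.

Lemma measurable_mxtrace n (A : T -> 'M[R]_n) :
  measurable_fun setT A -> measurable_fun setT (fun t => \tr (A t)).
Proof. by move=> mA; apply: measurable_sum => i; exact: measurable_fun_entry. Qed.

Lemma measurable_det n (A : T -> 'M[R]_n) :
  measurable_fun setT A -> measurable_fun setT (fun t => \det (A t)).
Proof.
move=> mA; rewrite /determinant; apply: measurable_sum => s.
apply: measurable_funM => //; apply: measurable_prod => i _.
exact: measurable_fun_entry.
Qed.

Lemma measurable_invmx n (A : T -> 'M[R]_n) :
  measurable_fun setT A -> measurable_fun setT (fun t => invmx (A t)).
Proof.
move=> mA; apply/measurable_fun_mxP => i j.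
have -> : (fun t => invmx (A t) i j) = (fun t => if \det (A t) == 0 then A t i j
    else (\det (A t))^-1 * ((-1) ^+ (j + i) * \det (row' j (col' i (A t))))).
  apply/funext => t; rewrite /invmx unitmxE unitfE.
  by case: eqVneq => //= _; rewrite !mxE.
apply: measurable_fun_ifT => //.
- by apply: measurable_fun_eqr => //; exact: measurable_det.
- exact: measurable_fun_entry.
apply: measurable_funM; first by apply: measurable_funV; exact: measurable_det.
apply: measurable_funM => //; apply: measurable_det.
apply/measurable_fun_mxP => k l; under eq_fun do rewrite !mxE.
exact: measurable_fun_entry.
Qed.

End measurable_matrix_operations.

(** * Redrawing one member of an independent family *)

Section resampling.
Context {R : realType} {d d' : measure_display} {T : measurableType d}
  {T' : measurableType d'} (P : probability T R) (n : nat)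
  (Z : 'I_n -> {RV P >-> T'}).

Definition sample_tuple (w : T) : n.-tuple T' := [tuple Z j w | j < n].

Definition tuple_update (i : 'I_n) (t : n.-tuple T') (v : T') : n.-tuple T' :=
  [tuple if j == i then v else tnth t j | j < n].

Definition resample (i : 'I_n) (ww : T * T) : n.-tuple T' :=
  tuple_update i (sample_tuple ww.1) (Z i ww.2).

Lemma measurable_sample_tuple : measurable_fun setT sample_tuple.
Proof.
apply/measurable_fun_tnthP => i; rewrite [X in measurable_fun _ X](_ : _ = Z i :> (_ -> _))//.
by apply/funext => w /=; rewrite tnth_mktuple.
Qed.

Lemma measurable_resample i : measurable_fun setT (resample i).
Proof.
apply/measurable_fun_tnthP => j.
rewrite [X in measurable_fun _ X](_ : _ = (fun ww =>
    if j == i then Z i ww.2 else Z j ww.1)).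
  by case: eqVneq => _; exact: measurableT_comp.
by apply/funext => w /=; rewrite !tnth_mktuple.
Qed.

Definition tuple_box (A : 'I_n -> set T') : set (n.-tuple T') :=
  [set t | forall j, A j (tnth t j)].

Lemma measurable_tuple_box :
  @measurable _ (n.-tuple T') =
  <<s [set B | exists2 A, (forall j, measurable (A j)) & B = tuple_box A] >>.
Proof.
apply/seteqP; split.
- apply: smallest_sub; first exact: smallest_sigma_algebra.
  rewrite -bigcup_seq/= => B [i /= _ [C mC <-]]; rewrite setTI.
  apply: sub_sigma_algebra; exists (fun j => if j == i then C else setT).
    by move=> j; case: ifP.
  apply/seteqP; split => [t /= Ct j|t /= /(_ i)]; last by rewrite eqxx.
  by case: eqVneq => [->|].
- apply: smallest_sub; first exact: sigma_algebra_measurable.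
  move=> _ [A mA ->].
  have -> : tuple_box A = \bigcap_(j in [set: 'I_n]) ((fun t => tnth t j) @^-1` A j).
    by apply/seteqP; split=> [t h j _|t h j]; exact: h.
  apply: fin_bigcap_measurable => // j _.
  by rewrite -[X in measurable X]setTI; exact: measurable_tnth.
Qed.

HB.instance Definition _ :=
  isMeasurableFun.Build _ _ _ _ sample_tuple measurable_sample_tuple.

HB.instance Definition _ i :=
  isMeasurableFun.Build _ _ _ _ (resample i) (measurable_resample i).

Hypothesis indepZ : mutual_indep_RV Z.

(** Both laws give to a box the product of the probabilities of its sides, and
boxes form a generating pi-system. *)
Lemma resample_law i (B : set (n.-tuple T')) : measurable B ->
  pushforward P sample_tuple B = pushforward (P \x P)%E (resample i) B.
Proof.
move=> mB.
apply: (measure_unique _ (fun=> setT) measurable_tuple_box) => //.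
- move=> _ _ [A1 mA1 ->] [A2 mA2 ->].
  exists (fun j => A1 j `&` A2 j); first by move=> j; exact: measurableI.
  apply/seteqP; split=> [t [t1 t2] j|t h]; first by split; [exact: t1|exact: t2].
  by split=> j; have [] := h j.
- by move=> _; exists (fun=> setT) => //; apply/seteqP; split.
- by apply/seteqP; split=> // t _; exists 0%N.
- move=> _ [A mA ->].
  change (P (sample_tuple @^-1` tuple_box A) =
          (P \x P)%E (resample i @^-1` tuple_box A)).
  have -> : sample_tuple @^-1` tuple_box A =
      \bigcap_(j in [set` [set: 'I_n]%SET]) (Z j @^-1` A j).
    apply/seteqP; split=> [w h j _|w h j] /=.
      by have := h j; rewrite tnth_mktuple.
    by rewrite tnth_mktuple; apply: h => /=; rewrite inE.
  have -> : resample i @^-1` tuple_box A =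
      (\bigcap_(j in [set` [set~ i]%SET]) (Z j @^-1` A j)) `*` (Z i @^-1` A i).
    apply/seteqP; split=> [[w1 w2] h|[w1 w2] [h1 h2] j] /=.
      split=> [j|] /=.
        by rewrite !inE => ji; have := h j; rewrite !tnth_mktuple (negbTE ji).
      by have := h i; rewrite !tnth_mktuple eqxx.
    rewrite !tnth_mktuple; case: eqVneq => [->//|ji].
    by apply: h1; rewrite /= !inE.
  have mZ j : measurable (Z j @^-1` A j).
    by rewrite -[X in measurable X]setTI; exact: measurable_funP.
  rewrite product_measure1E//; last exact: fin_bigcap_measurable.
  transitivity ((\prod_(j in [set~ i]%SET) P (Z j @^-1` A j)) *
      P (Z i @^-1` A i))%E; last by congr (_ * _)%E; exact/esym/indepZ.
  rewrite indepZ// (bigD1 i) ?inE//= muleC; congr (_ * _)%E.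
  by apply: eq_bigl => j; rewrite !inE.
- move=> _; change (P (sample_tuple @^-1` setT) < +oo)%E.
  by rewrite preimage_setT probability_setT ltry.
Qed.

Lemma ge0_integral_resample i (f : n.-tuple T' -> \bar R) :
  measurable_fun setT f -> (forall t, 0 <= f t)%E ->
  (\int[P]_w f (sample_tuple w) = \int[P]_w \int[P]_v f (resample i (w, v)))%E.
Proof.
move=> mf f0.
transitivity (\int[pushforward P sample_tuple]_t f t)%E.
  by rewrite ge0_integral_pushforward.
transitivity (\int[pushforward (P \x P)%E (resample i)]_t f t)%E.
  by apply: eq_measure_integral => B mB _; exact: resample_law.
rewrite ge0_integral_pushforward// fubini_tonelli1//.
- exact: measurableT_comp.
- by move=> ww /=.
Qed.

Lemma integrable_resample i (f : n.-tuple T' -> \bar R) :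
  measurable_fun setT f -> P.-integrable setT (f \o sample_tuple) ->
  (P \x P)%E.-integrable setT (f \o resample i).
Proof.
move=> mf /integrableP[_ foo]; apply/integrableP; split.
  exact: measurableT_comp.
rewrite fubini_tonelli1//; last first.
  by apply: measurableT_comp => //; exact: measurableT_comp.
move: foo; rewrite (ge0_integral_resample i (f := fun t => `|f t|%E))//.
exact: measurableT_comp.
Qed.

Lemma integral_resample i (f : n.-tuple T' -> \bar R) :
  measurable_fun setT f -> P.-integrable setT (f \o sample_tuple) ->
  (\int[P]_w f (sample_tuple w) = \int[P]_w \int[P]_v f (resample i (w, v)))%E.
Proof.
move=> mf fi; have fri := integrable_resample i mf fi.
transitivity (\int[pushforward P sample_tuple]_t f t)%E.
  by rewrite integral_pushforward.
transitivity (\int[pushforward (P \x P)%E (resample i)]_t f t)%E.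
  by apply: eq_measure_integral => B mB _; exact: resample_law.
by rewrite integral_pushforward//= -integral12_prod_meas1.
Qed.

End resampling.

(** * Stein's identity for the standard normal law *)

(** Difference quotients along [1 / n] form a sequence, to which measurability of
limits and dominated convergence apply. *)
Lemma is_derive_harmonic {R : realType} (f : R -> R) (x df : R) :
  is_derive x 1 f df ->
  (fun n : nat => (f (x + n.+1%:R^-1) - f x) / n.+1%:R^-1) @ \oo --> df.
Proof.
move=> [dfx <-].
have h : (fun n : nat => n.+1%:R^-1 : R) @ \oo --> 0^'.
  move=> A A0; have : \forall n \near \oo, n.+1%:R^-1 != 0 :> R -> A n.+1%:R^-1.
    exact: (@cvg_harmonic R _ A0).
  apply: (@filterS _ \oo) => n /= h.
  by apply: h; rewrite invr_eq0 pnatr_eq0.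
have -> : (fun n : nat => (f (x + n.+1%:R^-1) - f x) / n.+1%:R^-1) =
   (fun h => h^-1 *: ((f \o shift x) (h *: 1) - f x)) \o (fun n : nat => n.+1%:R^-1).
  apply/funext => n /=; rewrite mulrC; congr (_ * (f _ - _)).
  by rewrite addrC; congr (_ + _); rewrite -[LHS]mulr1.
exact: cvg_comp h dfx.
Qed.

Lemma MVT_bound {R : realType} (g dg : R -> R) (K : R) (x t : R) : 0 < t ->
  (forall s : R, is_derive s 1 g (dg s)) ->
  (forall s, x <= s <= x + t -> `|dg s| <= K) ->
  `|g (x + t) - g x| <= K * t.
Proof.
move=> t0 dgE gK.
have xt : x < x + t by rewrite ltrDl.
have [|c] := @MVT R g dg x (x + t) xt (fun s _ => dgE s).
  apply: derivable_within_continuous => s _; exact: ex_derive.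
rewrite in_itv/= => /andP[xc cx] ->.
by rewrite addrAC subrr add0r normrM (gtr0_norm t0) ler_wpM2r ?(ltW t0)// gK// !ltW.
Qed.

Section normal_density.
Context {R : realType}.
Local Notation mu := (@lebesgue_measure R).
Local Notation phi := (normal_pdf (0 : R) 1).

(** The density is only known to be the Radon-Nikodym derivative almost
everywhere, which is enough under the integral. *)
Lemma ge0_integral_normal_prob (m s : R) (f : R -> \bar R) :
  measurable_fun setT f -> (forall x, 0 <= f x)%E ->
  (\int[normal_prob m s]_x f x = \int[mu]_x (f x * (normal_pdf m s x)%:E))%E.
Proof.
move=> mf f0; pose nu : {finite_measure set _ -> \bar R} := normal_prob m s.
have numu : nu `<< mu by exact: normal_prob_dominates.
have mpdf : measurable_fun setT (fun x => (normal_pdf m s x)%:E).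
  by apply/measurable_EFinP; exact: measurable_normal_pdf.
have mRN := measurable_int _ (Radon_Nikodym_SigmaFinite.f_integrable numu).
rewrite -[LHS](Radon_Nikodym_SigmaFinite.change_of_variables numu)//.
apply: ge0_ae_eq_integral => //.
- exact: emeasurable_funM.
- exact: emeasurable_funM.
- by move=> x _; rewrite mule_ge0// Radon_Nikodym_SigmaFinite.f_ge0.
- by move=> x _; rewrite mule_ge0// lee_fin normal_pdf_ge0.
suff : ae_eq mu setT (Radon_Nikodym_SigmaFinite.f nu mu)
    (fun x => (normal_pdf m s x)%:E).
  by apply: filterS => x h xT; rewrite h.
apply: integral_ae_eq => //.
  exact: Radon_Nikodym_SigmaFinite.f_integrable.
move=> A _ mA.
by rewrite -(Radon_Nikodym_SigmaFinite.f_integral numu).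
Qed.

Lemma integral_normal_prob (m s : R) (f : R -> R) : measurable_fun setT f ->
  (\int[normal_prob m s]_x (f x)%:E = \int[mu]_x (f x * normal_pdf m s x)%:E)%E.
Proof.
move=> mf; rewrite integralE [RHS]integralE.
have mfE : measurable_fun setT (EFin \o f) by exact/measurable_EFinP.
congr (_ - _)%E; (rewrite ge0_integral_normal_prob//;
  last by [exact: measurable_funepos|exact: measurable_funeneg]);
apply: eq_integral => x _ /=.
  rewrite !funeposE -!EFin_max -EFinM; congr EFin.
  by rewrite maxr_pMl ?normal_pdf_ge0// mul0r.
rewrite !funenegE -!EFinN -!EFin_max -EFinM; congr EFin.
by rewrite maxr_pMl ?normal_pdf_ge0// mul0r mulNr.
Qed.

Let c : R := normal_peak 1.

Lemma std_normal_pdfE (x : R) : phi x = c * expR (- (x ^+ 2 / 2)).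
Proof.
rewrite normal_pdfE ?oner_neq0// /normal_fun subr0 expr1n mulNr.
by rewrite -[1 *+ 2]/(2%:R).
Qed.

Lemma is_derive_std_normal_pdf (x : R) : is_derive x 1 phi (- x * phi x).
Proof.
rewrite [X in is_derive _ _ X](_ : _ = fun x => c * expR (- (x ^+ 2 / 2))).
  apply: is_derive_eq.
  rewrite !std_normal_pdfE.
  by rewrite /GRing.scale/=; field.
by apply/funext => y; exact: std_normal_pdfE.
Qed.

(** The value that makes [std_normal_pdf_shift_bound] hold:
[|y| phi(y) <= c exp (y^2 / 4 - y^2 / 2)] with [c] the value of [phi] at [0],
while [|x - y| <= 1] gives [- y^2 / 4 <= 1 / 4 - x^2 / 8]. *)
Definition tail_constant : R := c * expR 4^-1 / normal_peak 2.

(** A bound on the derivative of the density, uniform over a unit neighbourhood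
of [x]: it dominates the difference quotients of the density around [x]. *)
Lemma std_normal_pdf_shift_bound (x y : R) : `|x - y| <= 1 ->
  `|y| * phi y <= tail_constant * normal_pdf 0 2 x.
Proof.
move=> xy; rewrite std_normal_pdfE normal_pdfE ?pnatr_eq0// /tail_constant.
have k2 : normal_peak 2 != 0 :> R by rewrite gt_eqF// normal_peak_gt0// pnatr_eq0.
rewrite [leRHS]mulrA divfK// -[leRHS]mulrA mulrCA.
rewrite ler_wpM2l ?normal_peak_ge0//.
have y4 : `|y| <= expR (y ^+ 2 / 4).
  apply: le_trans (expR_ge1Dx _).
  have := sqr_ge0 (`|y| / 2 - 1); rewrite -(real_normK (num_real y)); lra.
apply: (le_trans (ler_wpM2r (expR_ge0 _) y4)).
rewrite -!expRD ler_expR subr0.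
have : (x - y) ^+ 2 <= 1.
  by rewrite -(real_normK (num_real (x - y))) expr_le1.
rewrite -[2 ^+ 2 *+ 2]mulr_natr.
have := sqr_ge0 (x - y *+ 2); rewrite -mulr_natr; nra.
Qed.

End normal_density.

Lemma cvg_real_ereal {R : realType} (u : R^nat) (l : R) :
  u @ \oo --> l -> (fun n => (u n)%:E) @ \oo --> l%:E.
Proof. by move=> ul; apply/fine_cvgP; split=> //; apply: nearW. Qed.

Section stein.
Context {R : realType}.
Local Notation mu := (@lebesgue_measure R).
Local Notation phi := (normal_pdf (0 : R) 1).

Lemma std_normal_pdf_even (x : R) : phi (- x) = phi x.
Proof. by rewrite !std_normal_pdfE sqrrN. Qed.

Lemma continuous_std_normal_pdf : continuous phi.
Proof. by apply: continuous_normal_pdf; exact: oner_neq0. Qed.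

(** A derivative is the pointwise limit of difference quotients. *)
Lemma measurable_is_derive (f df : R -> R) :
  (forall s : R, is_derive s 1 f (df s)) -> measurable_fun setT df.
Proof.
move=> fE; have mf : measurable_fun setT f.
  apply: continuous_measurable_fun => x.
  by apply: differentiable_continuous; apply/derivable1_diffP/ex_derive.
apply: (@measurable_fun_cvg _ _ R setT
  (fun (n : nat) (x : R) => (f (x + n.+1%:R^-1) - f x) / n.+1%:R^-1)).
  move=> n; apply: measurable_funM => //; apply: measurable_funB => //.
  by apply: measurableT_comp => //; exact: measurable_funD.
by move=> x _; exact: is_derive_harmonic.
Qed.

Lemma integral_shift (h : R -> R) (t : R) : continuous h -> (forall x, 0 <= h x) ->
  (\int[mu]_x (h x * phi (x - t))%:E = \int[mu]_x (h (x + t) * phi x)%:E)%E.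
Proof.
move=> ch h0.
have dE (x : R) : is_derive x 1 (fun y : R => y + t) 1.
  by apply: is_derive_eq; rewrite addr0.
have dE' : (fun y : R => y + t)^`()%classic = cst 1.
  by apply/funext => x; rewrite derive1E derive_val.
rewrite (@increasing_ge0_integration_by_substitutionT R (fun x => x + t)).
- apply: eq_integral => x _; rewrite dE'/=; congr EFin.
  by rewrite fctE /= addrK mulr1.
- by move=> x y xy; rewrite ltrD2r.
- by rewrite dE' => x; exact: cvg_cst.
- by rewrite dE'; exact: is_cvg_cst.
- by rewrite dE'; exact: is_cvg_cst.
- by move=> x; exact: ex_derive.
- exact: cvg_addrr_Ny.
- exact: cvg_addrr.
- move=> x; apply: cvgM; first exact: ch.
  apply: (@continuous_comp _ _ _ (fun x => x - t) phi).
    by apply: cvgB; [exact: cvg_id|exact: cvg_cst].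
  exact: continuous_std_normal_pdf.
- by move=> x; rewrite mulr_ge0// normal_pdf_ge0.
Qed.

Lemma integrable_bounded_pdf (m s C : R) (f : R -> R) : measurable_fun setT f ->
  (forall x, `|f x| <= C * normal_pdf m s x) ->
  mu.-integrable setT (fun x => (f x)%:E).
Proof.
move=> mf fC; have C0 : mu.-integrable setT (fun x => (C * normal_pdf m s x)%:E).
  rewrite (_ : (fun x => _) = fun x => C%:E * (normal_pdf m s x)%:E)%E//.
  by apply: integrableZl => //; exact: integrable_normal_pdf.
apply: (le_integrable measurableT _ _ C0); first exact/measurable_EFinP.
by move=> x _ /=; rewrite lee_fin (le_trans (fC x))// ler_norm.
Qed.

(** The identity is the derivative at [t = 0] of the translation invariance
[int h(x) phi(x - t) dx = int h(x + t) phi(x) dx]. *)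
Lemma stein_ge0 (h dh : R -> R) (C K : R) :
  (forall s : R, is_derive s 1 h (dh s)) -> (forall s, 0 <= h s <= C) ->
  (forall s, `|dh s| <= K) ->
  (\int[mu]_x (x * h x * phi x)%:E = \int[mu]_x (dh x * phi x)%:E)%E.
Proof.
move=> hE h0C dhK.
pose t (n : nat) : R := n.+1%:R^-1.
have t0 n : 0 < t n by rewrite invr_gt0.
have t1 n : t n <= 1 by rewrite invf_le1// ler1n.
have C0 : 0 <= C by have /andP[] := h0C 0; exact: le_trans.
have K0 : 0 <= K by exact: le_trans (dhK 0).
have ch : continuous h.
  by move=> x; apply: differentiable_continuous; apply/derivable1_diffP/ex_derive.
have mh := continuous_measurable_fun ch.
have mphi : measurable_fun setT phi by exact: measurable_normal_pdf.
have mdh := measurable_is_derive hE.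
(* The two difference quotients have the same integral by translation
   invariance; they converge to the two sides of the identity. *)
pose A n (x : R) := h x * ((phi (x - t n) - phi x) / t n).
pose B n (x : R) := (h (x + t n) - h x) / t n * phi x.
have mA n : measurable_fun setT (A n).
  apply: measurable_funM => //; apply: measurable_funM => //.
  apply: measurable_funB => //; apply: measurableT_comp => //.
  exact: measurable_funB.
have mB n : measurable_fun setT (B n).
  apply: measurable_funM => //; apply: measurable_funM => //.
  apply: measurable_funB => //; apply: measurableT_comp => //.
  exact: measurable_funD.
have h0 x : 0 <= h x by have /andP[] := h0C x.
have hC x : `|h x| <= C by have /andP[? ?] := h0C x; rewrite ger0_norm.
have phi0 x : 0 <= phi x by exact: normal_pdf_ge0.
have AB n : (\int[mu]_x (A n x)%:E = \int[mu]_x (B n x)%:E)%E.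
  have i0 : mu.-integrable setT (fun x => (h x * phi x)%:E).
    apply: (@integrable_bounded_pdf 0 1 C); first exact: measurable_funM.
    by move=> x; rewrite normrM (ger0_norm (phi0 x)) ler_wpM2r.
  have i1 : mu.-integrable setT (fun x => (h (x + t n) * phi x)%:E).
    apply: (@integrable_bounded_pdf 0 1 C).
      apply: measurable_funM => //; apply: measurableT_comp => //.
      exact: measurable_funD.
    by move=> x; rewrite normrM (ger0_norm (phi0 x)) ler_wpM2r.
  have i2 : mu.-integrable setT (fun x => (h x * phi (x - t n))%:E).
    apply/integrableP; split.
      apply/measurable_EFinP/measurable_funM => //; apply: measurableT_comp => //.
      exact: measurable_funB.
    under eq_integral => x _ do rewrite /= ger0_norm ?mulr_ge0 ?h0 ?phi0//.
    rewrite integral_shift//; case/integrableP : i1 => _.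
    by under eq_integral => x _ do rewrite /= ger0_norm ?mulr_ge0 ?h0 ?phi0//.
  transitivity ((t n)^-1%:E * (\int[mu]_x (h x * phi (x - t n))%:E
      - \int[mu]_x (h x * phi x)%:E))%E.
    rewrite -integralB_EFin// -integralZl//; last exact: integrableB.
    by apply: eq_integral => x _ /=; rewrite -EFinB -EFinM; congr EFin;
      rewrite /A; ring.
  rewrite integral_shift//.
  rewrite -integralB_EFin// -integralZl//; last exact: integrableB.
  by apply: eq_integral => x _ /=; rewrite -EFinB -EFinM; congr EFin;
    rewrite /B; ring.
have cA : (fun n => \int[mu]_x (A n x)%:E)%E @ \oo -->
    (\int[mu]_x (x * h x * phi x)%:E)%E.
  have [] // := @dominated_convergence _ _ R mu setT measurableT
    (fun n x => (A n x)%:E) (fun x => (x * h x * phi x)%:E)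
    (fun x => (C * tail_constant * normal_pdf 0 2 x)%:E).
  - by move=> n; apply/measurable_EFinP; first [exact: mA|exact: mB].
  - by apply/measurable_EFinP; do 2!apply: measurable_funM => //.
  - apply: aeW => x _; apply: cvg_real_ereal.
    rewrite /A (_ : x * h x * phi x = h x * (- - x * phi (- x))); last first.
      by rewrite opprK std_normal_pdf_even; ring.
    apply: cvgM; first exact: cvg_cst.
    have := is_derive_harmonic (is_derive_std_normal_pdf (- x)).
    apply: cvg_trans; apply: near_eq_cvg; apply: nearW => n.
    by rewrite std_normal_pdf_even -std_normal_pdf_even opprD opprK.
  - rewrite (_ : (fun x => _) = fun x => (C * tail_constant)%:E * (normal_pdf 0 2 x)%:E)%E//.
    by apply: integrableZl => //; exact: integrable_normal_pdf.
  - apply: aeW => x n _ /=; rewrite lee_fin /A normrM -mulrA ler_pM//.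
    rewrite normrM [X in _ * X]gtr0_norm ?invr_gt0// ler_pdivrMr//.
    rewrite -std_normal_pdf_even -[phi x]std_normal_pdf_even opprD opprK.
    apply: (MVT_bound (t0 n) is_derive_std_normal_pdf) => s /andP[s1 s2].
    rewrite normrM normrN (ger0_norm (phi0 s)).
    have sx : `|x - - s| <= 1 by rewrite opprK ler_norml; have := t1 n; lra.
    by have := std_normal_pdf_shift_bound sx; rewrite normrN std_normal_pdf_even.
have cB : (fun n => \int[mu]_x (B n x)%:E)%E @ \oo -->
    (\int[mu]_x (dh x * phi x)%:E)%E.
  have [] // := @dominated_convergence _ _ R mu setT measurableT
    (fun n x => (B n x)%:E) (fun x => (dh x * phi x)%:E)
    (fun x => (K * phi x)%:E).
  - by move=> n; apply/measurable_EFinP; first [exact: mA|exact: mB].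
  - by apply/measurable_EFinP; apply: measurable_funM.
  - apply: aeW => x _; apply: cvg_real_ereal.
    by apply: cvgM; [exact: is_derive_harmonic|exact: cvg_cst].
  - rewrite (_ : (fun x => _) = fun x => K%:E * (phi x)%:E)%E//.
    by apply: integrableZl => //; exact: integrable_normal_pdf.
  - apply: aeW => x n _ /=; rewrite lee_fin /B normrM (ger0_norm (phi0 x)).
    rewrite ler_wpM2r// normrM [X in _ * X]gtr0_norm ?invr_gt0// ler_pdivrMr//.
    exact: (MVT_bound (t0 n) hE).
apply: cvg_unique cA _ => //.
by rewrite (_ : (fun n => _) = (fun n => \int[mu]_x (B n x)%:E)%E)//; apply/funext.
Qed.

(** A bounded function differs from a nonnegative one by a constant, for which
the identity says that the normal law is centred. *)
Lemma stein_normal_prob (g dg : R -> R) (C K : R) :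
  (forall s : R, is_derive s 1 g (dg s)) -> (forall s, `|g s| <= C) ->
  (forall s, `|dg s| <= K) ->
  (\int[normal_prob 0 1]_x (x * g x)%:E = \int[normal_prob 0 1]_x (dg x)%:E)%E.
Proof.
move=> gE gC dgK.
have mg : measurable_fun setT g.
  apply: continuous_measurable_fun => x.
  by apply: differentiable_continuous; apply/derivable1_diffP/ex_derive.
have mdg := measurable_is_derive gE.
rewrite !integral_normal_prob//; last exact: measurable_funM.
have C0 : 0 <= C by exact: le_trans (gC 0).
have gpE (s : R) : is_derive s 1 (fun x => g x + C) (dg s).
  by apply: is_derive_eq; rewrite addr0.
have e1 := @stein_ge0 _ _ (C + C) K gpE.
(* The identity for the constant [C], to be subtracted. *)
have e2 := @stein_ge0 (cst C) (cst 0) C 0 (fun s => is_derive_cst C s 1).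
rewrite -e1//; last by move=> s; have := gC s; rewrite ler_norml; lra.
have phi0 x : 0 <= phi x by exact: normal_pdf_ge0.
have mphi : measurable_fun setT phi by exact: measurable_normal_pdf.
have ib (f : R -> R) M : measurable_fun setT f -> (forall s, `|f s| <= M) ->
    mu.-integrable setT (fun x => (x * f x * phi x)%:E).
  move=> mf fM; apply: (@integrable_bounded_pdf 0 2 (M * tail_constant)).
    by apply: measurable_funM => //; exact: measurable_funM.
  move=> x; rewrite !normrM (ger0_norm (phi0 x)) mulrAC mulrC -mulrA ler_pM//.
    by rewrite mulr_ge0.
  by apply: std_normal_pdf_shift_bound; rewrite subrr normr0.
have -> : (\int[mu]_x (x * (g x + C) * phi x)%:E =
   \int[mu]_x (x * g x * phi x)%:E + \int[mu]_x (x * C * phi x)%:E)%E.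
  rewrite -integralD//; last 2 first.
  - exact: (ib g C).
  - by apply: (ib (cst C) C) => // s; rewrite ger0_norm.
  by apply: eq_integral => x _; rewrite -EFinD; congr EFin; ring.
have /= -> := e2; last by move=> s; rewrite normr0.
  by under [X in (_ + X)%E]eq_integral do rewrite mul0r; rewrite integral0 adde0.
by move=> s; rewrite C0 lexx.
Qed.

Lemma integrable_normal_prob_id :
  (normal_prob (0 : R) 1).-integrable setT (fun x => x%:E).
Proof.
apply/integrableP; split; first exact/measurable_EFinP.
rewrite ge0_integral_normal_prob//; last first.
  by apply: measurableT_comp => //; exact/measurable_EFinP.
have : mu.-integrable setT (fun x => (`|x| * phi x)%:E).
  apply: (@integrable_bounded_pdf 0 2 tail_constant).
    by apply: measurable_funM => //; exact: measurable_normal_pdf.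
  move=> x; rewrite normrM normr_id ger0_norm ?normal_pdf_ge0//.
  by apply: std_normal_pdf_shift_bound; rewrite subrr normr0.
case/integrableP => _; under eq_integral => x _.
  rewrite /= ger0_norm ?mulr_ge0 ?normal_pdf_ge0// EFinM.
  over.
by [].
Qed.

End stein.

(** * Stein's identity for normal vectors and for Gaussian rows *)

Lemma is_derive_translate {R : realType} (g : R -> R) (s dg : R) :
  is_derive (0 : R) 1 (fun u : R => g (s + u)) dg -> is_derive s 1 g dg.
Proof.
move=> [gd <-]; rewrite /derivable /derive in gd *.
have e : (fun h : R => h^-1 *: (((fun u : R => g (s + u)) \o shift 0) (h *: 1) -
    g (s + 0))) = (fun h : R => h^-1 *: ((g \o shift s) (h *: 1) - g s)).
  by apply/funext => h; rewrite /= !addr0 [s + _]addrC.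
by rewrite e in gd *; split.
Qed.

Lemma measurable_is_derive_mx {R : realType} m k (D : 'M[R]_(m, k))
    (f df : 'M[R]_(m, k) -> R) :
  measurable_fun setT f ->
  (forall M, is_derive (0 : R) 1 (fun s : R => f (M + s *: D)) (df M)) ->
  measurable_fun setT df.
Proof.
move=> mf fE.
apply: (@measurable_fun_cvg _ _ R setT (fun (n : nat) (M : 'M[R]_(m, k)) =>
    (f (M + n.+1%:R^-1 *: D) - f M) / n.+1%:R^-1)).
  move=> l; apply: measurable_funM => //; apply: measurable_funB => //.
  by apply: measurableT_comp => //; exact: measurable_addmx.
move=> M _; have := is_derive_harmonic (fE M).
by rewrite scale0r addr0; under eq_fun do rewrite add0r.
Qed.

Section stein_sample.
Context {R : realType} {d : measure_display} {T : measurableType d}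
  (P : probability T R) (p : nat) (Z : 'I_p -> {RV P >-> R}).
Hypothesis stdZ : std_normal_sample Z.

Definition col_of_tuple (t : p.-tuple R) : 'cV[R]_p := \col_j tnth t j.

Lemma measurable_col_of_tuple : measurable_fun setT col_of_tuple.
Proof.
apply/measurable_fun_mxP => i j; under eq_fun do rewrite mxE.
exact: measurable_tnth.
Qed.

Lemma col_of_sample_tuple w : col_of_tuple (sample_tuple Z w) = \col_j Z j w.
Proof. by apply/colP => j; rewrite !mxE tnth_mktuple. Qed.

Lemma col_of_resample l w v : col_of_tuple (resample Z l (w, v)) =
  \col_j Z j w + (Z l v - Z l w) *: delta_mx l 0.
Proof.
apply/colP => j; rewrite !mxE !tnth_mktuple /= andbT.
case: eqVneq => [->|_]; last by rewrite mulr0 addr0.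
by rewrite mulr1 addrC subrK.
Qed.

Lemma measurable_sample_col : measurable_fun setT (fun w => \col_j Z j w : 'cV[R]_p).
Proof.
apply/measurable_fun_mxP => i j; under eq_fun do rewrite mxE.
exact: measurable_funP.
Qed.

Lemma integral_std_normal l (f : R -> \bar R) : measurable_fun setT f ->
  (normal_prob 0 1).-integrable setT f ->
  P.-integrable setT (fun w => f (Z l w)) /\
  (\int[P]_w f (Z l w) = \int[normal_prob 0 1]_x f x)%E.
Proof.
have [_ Zn] := stdZ; move=> mf fi.
have mZ : measurable_fun setT (Z l : T -> measurableTypeR R).
  by move=> mT Y mY; exact: (@measurable_funP _ _ _ _ setT (Z l) mT Y mY).
pose Zl : {RV P >-> measurableTypeR R} :=
  HB.pack (Z l : T -> measurableTypeR R) (isMeasurableFun.Build _ _ _ _ _ mZ).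
have e (g : R -> \bar R) : (\int[distribution P Zl]_x g x =
    \int[normal_prob 0 1]_x g x)%E.
  by apply: eq_measure_integral => A mA _; exact: Zn.
have fZ : P.-integrable setT (fun w => f (Z l w)).
  case/integrableP : fi => _ foo.
  apply/integrableP; split; first exact: measurableT_comp.
  rewrite -[X in (X < _)%E](ge0_integral_distribution Zl (f := fun x => `|f x|%E))//.
    by rewrite e.
  exact: measurableT_comp.
by split=> //; rewrite -e integral_distribution.
Qed.

Lemma integrable_std_normal l : P.-integrable setT (fun w => (Z l w)%:E).
Proof.
apply: (integral_std_normal l (f := fun x => x%:E) _ _).1 => //.
  exact/measurable_EFinP.
exact: integrable_normal_prob_id.
Qed.

(** Redrawing coordinate [l] leaves the law of the sample unchanged, and
conditionally on the other coordinates it is a standard normal variable. *)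
Lemma stein_sample (l : 'I_p) (f df : 'cV[R]_p -> R) (C K : R) :
  measurable_fun setT f ->
  (forall z, is_derive (0 : R) 1 (fun s : R => f (z + s *: delta_mx l 0)) (df z)) ->
  (forall z, `|f z| <= C) -> (forall z, `|df z| <= K) ->
  (\int[P]_w (Z l w * f (\col_j Z j w))%:E = \int[P]_w (df (\col_j Z j w))%:E)%E.
Proof.
move=> mf fE fC dfK; have [indepZ Zn] := stdZ.
have mdf := measurable_is_derive_mx mf fE.
pose F (t : p.-tuple R) : \bar R := (tnth t l * f (col_of_tuple t))%:E.
pose D (t : p.-tuple R) : \bar R := (df (col_of_tuple t))%:E.
have mF : measurable_fun setT F.
  apply/measurable_EFinP; apply: measurable_funM; first exact: measurable_tnth.
  by apply: measurableT_comp => //; exact: measurable_col_of_tuple.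
have mD : measurable_fun setT D.
  apply/measurable_EFinP; apply: measurableT_comp => //.
  exact: measurable_col_of_tuple.
have FE w : F (sample_tuple Z w) = (Z l w * f (\col_j Z j w))%:E.
  by rewrite /F col_of_sample_tuple tnth_mktuple.
have DE w : D (sample_tuple Z w) = (df (\col_j Z j w))%:E.
  by rewrite /D col_of_sample_tuple.
have iF : P.-integrable setT (F \o sample_tuple Z).
  have CZ := integrableZl measurableT C (integrable_std_normal l).
  apply: (le_integrable measurableT _ _ CZ).
    by apply: measurableT_comp => //; exact: measurable_sample_tuple.
  move=> w _; rewrite /comp FE /= lee_fin !normrM mulrC ler_wpM2r//.
  by rewrite (le_trans (fC _))// ler_norm.
have iD : P.-integrable setT (D \o sample_tuple Z).
  have iK : P.-integrable setT (cst K%:E).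
    by apply: finite_measure_integrable_cst.
  apply: (le_integrable measurableT _ _ iK).
    by apply: measurableT_comp => //; exact: measurable_sample_tuple.
  move=> w _; rewrite /comp DE /= lee_fin.
  by rewrite (le_trans (dfK _))// ler_norm.
under eq_integral do rewrite -FE.
under [RHS]eq_integral do rewrite -DE.
rewrite (integral_resample indepZ l)// (integral_resample indepZ l (f := D))//.
apply: eq_integral => w _.
pose g (s : R) := f (\col_j Z j w + (s - Z l w) *: delta_mx l 0).
pose dg (s : R) := df (\col_j Z j w + (s - Z l w) *: delta_mx l 0).
have gE (s : R) : is_derive s 1 g (dg s).
  apply: is_derive_translate.
  have := fE (\col_j Z j w + (s - Z l w) *: delta_mx l 0).
  congr is_derive; apply/funext => u.
  by rewrite /g -addrA -scalerDl; congr (f (_ + _ *: _)); ring.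
have mg : measurable_fun setT g.
  apply: measurableT_comp => //; apply: measurable_addmx => //.
  by apply: measurable_scalemx => //; exact: measurable_funB.
have mdg := measurable_is_derive gE.
transitivity (\int[normal_prob 0 1]_s (s * g s)%:E)%E.
  rewrite -(integral_std_normal l (f := fun s => (s * g s)%:E) _ _).2//.
  - apply: eq_integral => v _; rewrite /F col_of_resample.
    by rewrite tnth_mktuple eqxx.
  - by apply/measurable_EFinP; exact: measurable_funM.
  have CZ := integrableZl measurableT C (@integrable_normal_prob_id R).
  apply: (le_integrable measurableT _ _ CZ).
    by apply/measurable_EFinP; exact: measurable_funM.
  move=> s _; rewrite /= lee_fin !normrM mulrC ler_wpM2r//.
  by rewrite (le_trans (fC _))// ler_norm.
rewrite (@stein_normal_prob R g dg C K)//.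
  rewrite -(integral_std_normal l (f := fun s => (dg s)%:E) _ _).2//.
  - by apply: eq_integral => v _; rewrite /D col_of_resample.
  - by apply/measurable_EFinP.
  have iK : (normal_prob (0 : R) 1).-integrable setT (cst K%:E).
    by apply: finite_measure_integrable_cst.
  apply: (le_integrable measurableT _ _ iK); first exact/measurable_EFinP.
  by move=> s _; rewrite /= lee_fin (le_trans (dfK _))// ler_norm.
- by move=> s; exact: fC.
- by move=> s; exact: dfK.
Qed.

End stein_sample.

Section stein_row.
Context {R : realType} {d : measure_display} {T : measurableType d}
  (Q : probability T R) (n p : nat) (Y : 'I_n -> {RV Q >-> 'cV[R]_p}).
Hypothesis indepY : mutual_indep_RV Y.

Definition rows_of_tuple (t : n.-tuple 'cV[R]_p) : 'M[R]_(n, p) :=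
  \matrix_(i, j) tnth t i j 0.

Lemma measurable_rows_of_tuple : measurable_fun setT rows_of_tuple.
Proof.
apply/measurable_fun_mxP => i j; under eq_fun do rewrite mxE.
by apply: measurable_fun_entry; exact: measurable_tnth.
Qed.

Lemma rows_of_sample_tuple w : rows_of_tuple (sample_tuple Y w) = rows_mx Y w.
Proof. by apply/matrixP => i j; rewrite !mxE tnth_mktuple. Qed.

Lemma measurable_rows_mx : measurable_fun setT (rows_mx Y).
Proof.
apply/measurable_fun_mxP => i j; under eq_fun do rewrite mxE.
by apply: measurable_fun_entry; exact: measurable_funP.
Qed.

Definition set_row (i : 'I_n) (M : 'M[R]_(n, p)) (y : 'cV[R]_p) : 'M[R]_(n, p) :=
  \matrix_(k, j) if k == i then y j 0 else M k j.

Lemma rows_of_resample i w v :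
  rows_of_tuple (resample Y i (w, v)) = set_row i (rows_mx Y w) (Y i v).
Proof.
by apply/matrixP => k j; rewrite !mxE !tnth_mktuple; case: eqVneq.
Qed.

Lemma measurable_set_row i M : measurable_fun setT (set_row i M).
Proof.
apply/measurable_fun_mxP => k j; under eq_fun do rewrite mxE.
by case: eqVneq => // _; exact: measurable_fun_entry.
Qed.

Lemma set_rowD i M (y u : 'cV[R]_p) (s : R) :
  set_row i M (y + s *: u) = set_row i M y + s *: (delta_mx i 0 *m u^T).
Proof.
apply/matrixP => k j; rewrite !mxE big_ord1 !mxE eqxx andbT.
by case: eqVneq => _; rewrite ?mul1r// mul0r mulr0 addr0.
Qed.

Context (i : 'I_n) (A : 'M[R]_p) (Z : 'I_p -> {RV Q >-> R}).
Hypotheses (Au : A \in unitmx) (stdZ : std_normal_sample Z).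
Hypothesis YiE : forall w, Y i w = A *m \col_l Z l w.

Lemma whitened_rowE w l : (invmx A *m Y i w) l 0 = Z l w.
Proof. by rewrite YiE mulKmx// mxE. Qed.

(** Row [i] is redrawn alone; increasing its whitened coordinate [Z l] by [s] adds
[s e_i (A e_l)'] to the matrix. *)
Lemma stein_row (l : 'I_p) (f df : 'M[R]_(n, p) -> R) (C K : R) :
  measurable_fun setT f ->
  (forall M, is_derive (0 : R) 1
    (fun s : R => f (M + s *: (delta_mx i 0 *m (A *m (delta_mx l 0 : 'cV[R]_p))^T))) (df M)) ->
  (forall M, `|f M| <= C) -> (forall M, `|df M| <= K) ->
  [/\ Q.-integrable setT (fun w => (Z l w * f (rows_mx Y w))%:E),
      Q.-integrable setT (fun w => (df (rows_mx Y w))%:E) &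
      (\int[Q]_w (Z l w * f (rows_mx Y w))%:E =
       \int[Q]_w (df (rows_mx Y w))%:E)%E].
Proof.
move=> mf fE fC dfK.
have mdf := measurable_is_derive_mx mf fE.
pose F (t : n.-tuple 'cV[R]_p) : \bar R :=
  ((invmx A *m tnth t i) l 0 * f (rows_of_tuple t))%:E.
pose D (t : n.-tuple 'cV[R]_p) : \bar R := (df (rows_of_tuple t))%:E.
have mF : measurable_fun setT F.
  apply/measurable_EFinP; apply: measurable_funM.
    apply: measurable_fun_entry; apply: measurable_mulmx => //.
    exact: measurable_tnth.
  by apply: measurableT_comp => //; exact: measurable_rows_of_tuple.
have mD : measurable_fun setT D.
  apply/measurable_EFinP; apply: measurableT_comp => //.
  exact: measurable_rows_of_tuple.
have FE w : F (sample_tuple Y w) = (Z l w * f (rows_mx Y w))%:E.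
  by rewrite /F rows_of_sample_tuple tnth_mktuple whitened_rowE.
have DE w : D (sample_tuple Y w) = (df (rows_mx Y w))%:E.
  by rewrite /D rows_of_sample_tuple.
have iF : Q.-integrable setT (F \o sample_tuple Y).
  have CZ := integrableZl measurableT C (integrable_std_normal stdZ l).
  apply: (le_integrable measurableT _ _ CZ).
    by apply: measurableT_comp => //; exact: measurable_sample_tuple.
  move=> w _; rewrite /comp FE /= lee_fin !normrM mulrC ler_wpM2r//.
  by rewrite (le_trans (fC _))// ler_norm.
have iD : Q.-integrable setT (D \o sample_tuple Y).
  have iK : Q.-integrable setT (cst K%:E).
    by apply: finite_measure_integrable_cst.
  apply: (le_integrable measurableT _ _ iK).
    by apply: measurableT_comp => //; exact: measurable_sample_tuple.
  move=> w _; rewrite /comp DE /= lee_fin.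
  by rewrite (le_trans (dfK _))// ler_norm.
split.
- by move: iF; congr integrable; apply/funext => w; rewrite /comp FE.
- by move: iD; congr integrable; apply/funext => w; rewrite /comp DE.
under eq_integral do rewrite -FE.
under [RHS]eq_integral do rewrite -DE.
rewrite (integral_resample indepY i)// (integral_resample indepY i (f := D))//.
apply: eq_integral => w _.
pose g (z : 'cV[R]_p) := f (set_row i (rows_mx Y w) (A *m z)).
pose dg (z : 'cV[R]_p) := df (set_row i (rows_mx Y w) (A *m z)).
transitivity (\int[Q]_v (Z l v * g (\col_j Z j v))%:E)%E.
  apply: eq_integral => v _; rewrite /F rows_of_resample /g -YiE tnth_mktuple eqxx.
  by rewrite whitened_rowE.
have mg : measurable_fun setT g.
  apply: measurableT_comp => //.
  apply: measurableT_comp; first exact: measurable_set_row.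
  exact: measurable_mulmx.
have gE z : is_derive (0 : R) 1 (fun s : R => g (z + s *: delta_mx l 0)) (dg z).
  have := fE (set_row i (rows_mx Y w) (A *m z)).
  congr is_derive; apply/funext => s.
  by rewrite /g mulmxDr -scalemxAr set_rowD.
rewrite (stein_sample stdZ mg gE (fun z => fC _) (fun z => dfK _)).
by apply: eq_integral => v _; rewrite /D rows_of_resample /dg -YiE.
Qed.

End stein_row.

(** * Frobenius norm and ridge inverses *)

Section frobenius.
Context {R : realType}.

Definition frob2 m n (A : 'M[R]_(m, n)) : R := \sum_i \sum_j A i j ^+ 2.

Lemma frob2_ge0 m n (A : 'M[R]_(m, n)) : 0 <= frob2 A.
Proof. by apply: sumr_ge0 => i _; apply: sumr_ge0 => j _; exact: sqr_ge0. Qed.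

Lemma frob2E m n (A : 'M[R]_(m, n)) : frob2 A = \tr (A^T *m A).
Proof.
rewrite /frob2 exchange_big; apply: eq_bigr => j _; rewrite mxE.
by apply: eq_bigr => i _; rewrite mxE expr2.
Qed.

Lemma frob2_tr m n (A : 'M[R]_(m, n)) : frob2 A^T = frob2 A.
Proof.
rewrite /frob2 exchange_big; apply: eq_bigr => j _; apply: eq_bigr => i _.
by rewrite mxE.
Qed.

Lemma frob2_col n (u : 'cV[R]_n) : frob2 u = (u^T *m u) 0 0.
Proof. by rewrite frob2E /mxtrace big_ord1. Qed.

Lemma frob2_eq0 m n (A : 'M[R]_(m, n)) : frob2 A = 0 -> A = 0.
Proof.
move=> /eqP; rewrite psumr_eq0; last by move=> i _; apply: sumr_ge0 => j _; exact: sqr_ge0.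
move=> /allP h; apply/matrixP => i j; rewrite mxE; apply/eqP.
have := h i (mem_index_enum _); rewrite /= psumr_eq0; last by move=> k _; exact: sqr_ge0.
by move=> /allP/(_ j (mem_index_enum _)); rewrite /= sqrf_eq0.
Qed.

Lemma frob2Z m n (c : R) (A : 'M[R]_(m, n)) : frob2 (c *: A) = c ^+ 2 * frob2 A.
Proof.
rewrite /frob2 mulr_sumr; apply: eq_bigr => i _; rewrite mulr_sumr.
by apply: eq_bigr => j _; rewrite mxE exprMn.
Qed.

Lemma frob2D m n (A B : 'M[R]_(m, n)) : frob2 (A + B) <= 2 * (frob2 A + frob2 B).
Proof.
rewrite /frob2 -big_split/= mulr_sumr; apply: ler_sum => i _.
rewrite -big_split/= mulr_sumr; apply: ler_sum => j _; rewrite mxE.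
by have := sqr_ge0 (A i j - B i j); nra.
Qed.

Lemma frob2_entry m n (A : 'M[R]_(m, n)) i j : A i j ^+ 2 <= frob2 A.
Proof.
rewrite /frob2 (bigD1 i)//= (bigD1 j)//= -addrA lerDl addr_ge0//.
  by apply: sumr_ge0 => k _; exact: sqr_ge0.
by apply: sumr_ge0 => k _; apply: sumr_ge0 => l _; exact: sqr_ge0.
Qed.

Lemma frob2_entry_norm m n (A : 'M[R]_(m, n)) i j : `|A i j| <= 1 + frob2 A.
Proof.
apply: (le_trans _ (lerD (lexx 1) (frob2_entry A i j))).
have := sqr_ge0 (`|A i j| - 1); rewrite -(real_normK (num_real (A i j))).
by have := normr_ge0 (A i j); nra.
Qed.

(** The nonnegative trinomial [t |-> |a - t b|^2] is taken at its minimum. *)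
Lemma cauchy_schwarz (I : finType) (a b : I -> R) :
  (\sum_i a i * b i) ^+ 2 <= (\sum_i a i ^+ 2) * (\sum_i b i ^+ 2).
Proof.
set A := \sum_i a i ^+ 2; set B := \sum_i b i ^+ 2; set S := \sum_i a i * b i.
have A0 : 0 <= A by apply: sumr_ge0 => i _; exact: sqr_ge0.
have B0 : 0 <= B by apply: sumr_ge0 => i _; exact: sqr_ge0.
have h (t : R) : 0 <= A - t * S *+ 2 + t ^+ 2 * B.
  have -> : A - t * S *+ 2 + t ^+ 2 * B = \sum_i (a i - t * b i) ^+ 2.
    rewrite /A /S /B !mulr_sumr -sumrMnl -sumrN -!big_split/=.
    by apply: eq_bigr => i _; ring.
  by apply: sumr_ge0 => i _; exact: sqr_ge0.
have [B00|Bn0] := eqVneq B 0.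
  have [->|Sn0] := eqVneq S 0; first by rewrite expr0n mulr_ge0.
  (* If [B] vanishes the trinomial is affine: a point where it would be negative. *)
  have := h ((A + 1) / S); rewrite B00 mulr0 addr0 divfK//.
  by rewrite -mulr_natr; lra.
have Bp : 0 < B by rewrite lt0r Bn0.
have := h (S / B).
have -> : A - S / B * S *+ 2 + (S / B) ^+ 2 * B = A - S ^+ 2 / B by field.
by rewrite subr_ge0 ler_pdivrMr.
Qed.

Lemma frob2M m n k (A : 'M[R]_(m, n)) (B : 'M[R]_(n, k)) :
  frob2 (A *m B) <= frob2 A * frob2 B.
Proof.
rewrite -(frob2_tr B) /frob2 mulr_suml; apply: ler_sum => i _.
rewrite mulr_sumr; apply: ler_sum => j _; rewrite mxE.
by under [X in _ <= _ * X]eq_bigr do rewrite mxE; exact: cauchy_schwarz.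
Qed.

End frobenius.

Section ridge.
Context {R : realType} {n p : nat} (eps : R) (Y : 'M[R]_(n, p)).
Hypothesis eps0 : 0 < eps.

Definition ridge_inv : 'M[R]_n := invmx (Y *m Y^T + eps%:M).

Local Notation N := ridge_inv.

Lemma ridge_unit : Y *m Y^T + eps%:M \in unitmx.
Proof.
rewrite -row_free_unit -kermx_eq0; apply/eqP/row_matrixP => i.
rewrite row0; set u := row i _.
have u0 : u *m (Y *m Y^T + eps%:M) = 0 by rewrite /u -row_mul mulmx_ker row0.
have : \tr (u *m (Y *m Y^T + eps%:M) *m u^T) = 0 by rewrite u0 mul0mx mxtrace0.
rewrite mulmxDr mulmxDl mxtraceD -mulmxA mul_mx_scalar -scalemxAl mxtraceZ.
rewrite !mulmxA -[_ *m Y^T *m _]mulmxA -trmx_mul.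
have eT k (B : 'M[R]_(1, k)) : \tr (B *m B^T) = frob2 B.
  by rewrite -{1}[B]trmxK -frob2E frob2_tr.
rewrite !eT => h; apply: frob2_eq0; apply/eqP; rewrite eq_le frob2_ge0 andbT.
by rewrite -(ler_pM2l eps0) mulr0; have := frob2_ge0 (u *m Y); lra.
Qed.

Lemma ridge_sym : N^T = N.
Proof. by rewrite trmx_inv linearD/= trmx_mul trmxK tr_scalar_mx. Qed.

Lemma ridge_invl : N *m (Y *m Y^T) = 1%:M - eps *: N.
Proof.
apply/eqP; rewrite eq_sym subr_eq -mul_mx_scalar -mulmxDr; apply/eqP.
by rewrite mulVmx// ridge_unit.
Qed.

(** [N = N (Y Y' + eps) N]: the ridge inverse as a sum of two Gram matrices,
whence the positivity and the norm bounds below. *)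
Lemma ridge_inv_gram : N = (Y^T *m N)^T *m (Y^T *m N) + eps *: (N^T *m N).
Proof.
rewrite trmx_mul trmxK ridge_sym mulmxA -[N *m Y *m Y^T]mulmxA ridge_invl.
by rewrite mulmxBl mul1mx -scalemxAl subrK.
Qed.

Lemma tr_ridge : \tr N = frob2 (Y^T *m N) + eps * frob2 N.
Proof. by rewrite {1}ridge_inv_gram mxtraceD mxtraceZ -!frob2E. Qed.

Lemma tr_ridge_ge0 : 0 <= \tr N.
Proof. by rewrite tr_ridge addr_ge0 ?mulr_ge0 ?frob2_ge0// ltW. Qed.

Lemma tr_ridge_hat : \tr (Y^T *m N *m Y) = n%:R - eps * \tr N.
Proof.
by rewrite -mulmxA mxtrace_mulC -mulmxA ridge_invl linearB/= mxtrace1 mxtraceZ.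
Qed.

(** With [H = Y' N Y] the ridge projection, [H - H^2 = eps (N Y)' (N Y)]. *)
Lemma frob2_ridge_hat :
  \tr (Y^T *m N *m Y) = frob2 (Y^T *m N *m Y) + eps * frob2 (N *m Y).
Proof.
rewrite !frob2E !trmx_mul trmxK ridge_sym -mxtraceZ -mxtraceD; congr (\tr _).
have -> : Y^T *m (N *m Y) *m (Y^T *m N *m Y) =
    Y^T *m (N *m (Y *m Y^T)) *m (N *m Y) by rewrite !mulmxA.
rewrite ridge_invl mulmxBr mulmx1 mulmxBl -scalemxAr -scalemxAl.
by rewrite -[Y^T *m N *m Y]mulmxA -[Y^T *m N *m (N *m Y)]mulmxA subrK.
Qed.

(** [n - eps tr N] is the trace of the ridge projection, which is nonnegative. *)
Lemma tr_ridge_le : eps * \tr N <= n%:R.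
Proof.
rewrite -subr_ge0 -tr_ridge_hat frob2_ridge_hat.
by rewrite addr_ge0 ?mulr_ge0 ?frob2_ge0// ltW.
Qed.

Lemma frob2_hat_le : frob2 (Y^T *m N *m Y) <= n%:R.
Proof.
have := frob2_ridge_hat; rewrite tr_ridge_hat.
have h1 : 0 <= eps * frob2 (N *m Y) by rewrite mulr_ge0 ?frob2_ge0// ltW.
have h2 : 0 <= eps * \tr N by rewrite mulr_ge0 ?tr_ridge_ge0// ltW.
lra.
Qed.

Lemma frob2_YN_le : frob2 (Y^T *m N) <= n%:R / eps.
Proof.
rewrite ler_pdivlMr//; have := tr_ridge_le; rewrite tr_ridge.
have : 0 <= eps * (eps * frob2 N) by rewrite !mulr_ge0 ?frob2_ge0// ltW.
by rewrite mulrDr; lra.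
Qed.

Lemma frob2_NY_le : frob2 (N *m Y) <= n%:R / eps.
Proof. by rewrite -frob2_tr trmx_mul ridge_sym frob2_YN_le. Qed.

Lemma frob2_N_le : frob2 N <= n%:R / eps ^+ 2.
Proof.
rewrite ler_pdivlMr ?exprn_gt0//; have := tr_ridge_le; rewrite tr_ridge.
have : 0 <= eps * frob2 (Y^T *m N) by rewrite mulr_ge0 ?frob2_ge0// ltW.
by rewrite mulrDr expr2; lra.
Qed.

(** The error terms containing the quadratic form of [N] are thus controlled by
[tr N]. *)
Lemma ridge_form_bounds (w : 'cV[R]_n) :
  0 <= (w^T *m N *m w) 0 0 <= \tr N * frob2 w.
Proof.
have -> : (w^T *m N *m w) 0 0 = frob2 (Y^T *m N *m w) + eps * frob2 (N *m w).
  rewrite {1}ridge_inv_gram !frob2_col mulmxDr mulmxDl -scalemxAr -scalemxAl.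
  by rewrite mxE [X in _ + X]mxE !trmx_mul !trmxK !mulmxA.
apply/andP; split; first by rewrite addr_ge0 ?mulr_ge0 ?frob2_ge0// ltW.
by rewrite tr_ridge mulrDl -mulrA; apply: lerD; rewrite ?ler_pM2l// frob2M.
Qed.

End ridge.

(** * Differentiation of matrices along a line *)

Section derive_mx.
Context {R : realType}.

Definition is_derive_mx m n (A : R -> 'M[R]_(m, n)) (s : R) (dA : 'M[R]_(m, n)) :=
  forall i j, is_derive s 1 (fun u => A u i j) (dA i j).

Lemma is_derive_mx_cst m n (A : 'M[R]_(m, n)) s : is_derive_mx (fun=> A) s 0.
Proof. by move=> i j; rewrite mxE; exact: is_derive_cst. Qed.

Lemma is_derive_mx_line m n (A D : 'M[R]_(m, n)) s :
  is_derive_mx (fun u => A + u *: D) s D.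
Proof.
move=> i j; rewrite [X in is_derive _ _ X](_ : _ = fun u : R => A i j + u * D i j).
  by apply: is_derive_eq; rewrite /GRing.scale/=; ring.
by apply/funext => u; rewrite !mxE.
Qed.

Lemma is_derive_mxD m n (A B : R -> 'M[R]_(m, n)) s dA dB :
  is_derive_mx A s dA -> is_derive_mx B s dB ->
  is_derive_mx (fun u => A u + B u) s (dA + dB).
Proof.
move=> AE BE i j.
rewrite mxE [X in is_derive _ _ X](_ : _ = (fun u => A u i j) + (fun u => B u i j)).
  exact: is_deriveD.
by apply/funext => u; rewrite mxE.
Qed.

Lemma is_derive_mx_tr m n (A : R -> 'M[R]_(m, n)) s dA :
  is_derive_mx A s dA -> is_derive_mx (fun u => (A u)^T) s dA^T.
Proof.
move=> AE i j; rewrite mxE [X in is_derive _ _ X](_ : _ = (fun u => A u j i))//.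
by apply/funext => u; rewrite mxE.
Qed.

Lemma is_derive_mxM m n k (A : R -> 'M[R]_(m, n)) (B : R -> 'M[R]_(n, k)) s dA dB :
  is_derive_mx A s dA -> is_derive_mx B s dB ->
  is_derive_mx (fun u => A u *m B u) s (dA *m B s + A s *m dB).
Proof.
move=> AE BE i j.
rewrite [X in is_derive _ _ X](_ : _ =
  \sum_(l < n) ((fun u => A u i l) * (fun u => B u l j))); last first.
  by apply/funext => u; rewrite mxE fct_sumE.
apply: (@is_derive_eq _ _ _ _ _ _ _ _ (is_derive_sum (fun l => is_deriveM (AE i l) (BE l j)))).
rewrite !mxE -big_split/=; apply: eq_bigr => l _.
by rewrite /GRing.scale/= addrC mulrC [X in _ + X]mulrC.
Qed.

Lemma derivable_prod (I : Type) (r : seq I) (h : I -> R -> R) (s : R) :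
  (forall i, derivable (h i) s 1) -> derivable (fun u => \prod_(i <- r) h i u) s 1.
Proof.
move=> hd; elim: r => [|i r ih].
  by under eq_fun do rewrite big_nil; exact: derivable_cst.
by under eq_fun do rewrite big_cons; exact: derivableM.
Qed.

Lemma derivable_sum_seq (I : Type) (r : seq I) (h : I -> R -> R) (s : R) :
  (forall i, derivable (h i) s 1) -> derivable (fun u => \sum_(i <- r) h i u) s 1.
Proof.
move=> hd; elim: r => [|i r ih].
  by under eq_fun do rewrite big_nil; exact: derivable_cst.
by under eq_fun do rewrite big_cons; exact: derivableD.
Qed.

Lemma derivable_det n (A : R -> 'M[R]_n) (s : R) :
  (forall i j, derivable (fun u => A u i j) s 1) ->
  derivable (fun u => \det (A u)) s 1.
Proof.
move=> Ad; rewrite /determinant; apply: derivable_sum_seq => pi.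
apply: derivableM; first exact: derivable_cst.
exact: derivable_prod.
Qed.

(** The determinant formula shows that the entries of the inverse are
derivable; the value comes from differentiating [A A^-1 = 1]. *)
Lemma is_derive_mx_inv n (A : R -> 'M[R]_n) (s : R) dA :
  (forall u, A u \in unitmx) -> is_derive_mx A s dA ->
  is_derive_mx (fun u => invmx (A u)) s (- (invmx (A s) *m dA *m invmx (A s))).
Proof.
move=> Au AE.
have Ad i j : derivable (fun u => A u i j) s 1 by have [] := AE i j.
have Vd i j : derivable (fun u => invmx (A u) i j) s 1.
  rewrite [X in derivable X](_ : _ = (fun u => (\det (A u))^-1) *
      (cst ((-1) ^+ (j + i)) * (fun u => \det (row' j (col' i (A u)))))).
    apply: derivableM.
      apply: derivableV; first by rewrite -unitfE -unitmxE.
      exact: derivable_det.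
    apply: derivableM; first exact: derivable_cst.
    apply: derivable_det => k l; rewrite [X in derivable X](_ : _ =
      (fun u => A u (lift j k) (lift i l)))//.
    by apply/funext => u; rewrite !mxE.
  by apply/funext => u; rewrite /invmx Au !mxE.
pose V : 'M[R]_n := \matrix_(i, j) 'D_1 (fun u => invmx (A u) i j) s.
have VE : is_derive_mx (fun u => invmx (A u)) s V.
  by move=> i j; rewrite mxE; split.
suff -> : - (invmx (A s) *m dA *m invmx (A s)) = V by [].
have := is_derive_mxM AE VE.
have -> : (fun u => A u *m invmx (A u)) = (fun=> 1%:M).
  by apply/funext => u; rewrite mulmxV.
move=> h; have : dA *m invmx (A s) + A s *m V = 0.
  apply/matrixP => i j; rewrite [RHS]mxE; have [_ <-] := h i j.
  exact: derive_cst.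
move=> /eqP; rewrite addrC addr_eq0 => /eqP h2.
by rewrite -mulmxA -mulmxN -h2 mulKmx.
Qed.

End derive_mx.

(** * Bounded families of matrices; ridge coefficients and fits *)

Section bounded_families.
Context {R : realType} {I : Type}.

(** Boundedness by some constant, closed under matrix operations, is the
form in which the hypotheses of Stein's identity are checked for the fields. *)
Definition bounded_mx m n (A : I -> 'M[R]_(m, n)) :=
  exists C : R, forall t i j, `|A t i j| <= C.

Definition bounded_sc (f : I -> R) := exists C : R, forall t, `|f t| <= C.

Lemma bounded_entry m n (A : I -> 'M[R]_(m, n)) i j :
  bounded_mx A -> bounded_sc (fun t => A t i j).
Proof. by move=> [C AC]; exists C. Qed.

Lemma bounded_frob2 m n (A : I -> 'M[R]_(m, n)) C :
  (forall t, frob2 (A t) <= C) -> bounded_mx A.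
Proof.
move=> AC; exists (1 + C) => t i j.
by rewrite (le_trans (frob2_entry_norm _ _ _))// lerD2l.
Qed.

Lemma bounded_mx_cst m n (A : 'M[R]_(m, n)) : bounded_mx (fun=> A).
Proof. exact: (@bounded_frob2 _ _ _ (frob2 A)). Qed.

Lemma bounded_mxD m n (A B : I -> 'M[R]_(m, n)) :
  bounded_mx A -> bounded_mx B -> bounded_mx (fun t => A t + B t).
Proof.
move=> [C AC] [D BD]; exists (C + D) => t i j.
by rewrite mxE (le_trans (ler_normD _ _))// lerD.
Qed.

Lemma bounded_mxN m n (A : I -> 'M[R]_(m, n)) :
  bounded_mx A -> bounded_mx (fun t => - A t).
Proof. by move=> [C AC]; exists C => t i j; rewrite mxE normrN. Qed.

Lemma bounded_mx_tr m n (A : I -> 'M[R]_(m, n)) :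
  bounded_mx A -> bounded_mx (fun t => (A t)^T).
Proof. by move=> [C AC]; exists C => t i j; rewrite mxE. Qed.

Lemma bounded_mxM m n k (A : I -> 'M[R]_(m, n)) (B : I -> 'M[R]_(n, k)) :
  bounded_mx A -> bounded_mx B -> bounded_mx (fun t => A t *m B t).
Proof.
move=> [C AC] [D BD]; exists (\sum_(l < n) C * D) => t i j.
rewrite mxE (le_trans (ler_norm_sum _ _ _))//; apply: ler_sum => l _.
by rewrite normrM ler_pM.
Qed.

Lemma bounded_scM (f g : I -> R) :
  bounded_sc f -> bounded_sc g -> bounded_sc (fun t => f t * g t).
Proof.
by move=> [C fC] [D gD]; exists (C * D) => t; rewrite normrM ler_pM.
Qed.

Lemma bounded_scD (f g : I -> R) :
  bounded_sc f -> bounded_sc g -> bounded_sc (fun t => f t + g t).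
Proof.
move=> [C fC] [D gD]; exists (C + D) => t.
by rewrite (le_trans (ler_normD _ _))// lerD.
Qed.

Lemma bounded_sc_cst (c : R) : bounded_sc (fun=> c).
Proof. by exists `|c|. Qed.

End bounded_families.

(** A divergence in the whitened coordinates [z = A^-1 x] is the trace of the
Jacobian [T], whatever the square root [A] of the covariance. *)
Lemma sum_delta_trace {R : realType} p (A B T : 'M[R]_p) : A *m B = 1%:M ->
  \sum_l (B *m (T *m (A *m (delta_mx l 0 : 'cV[R]_p)))) l 0 = \tr T.
Proof.
move=> AB; rewrite -[in RHS](mulmx1 T) -AB mulmxA mxtrace_mulC /mxtrace.
by apply: eq_bigr => l _; rewrite !mulmxA -colE mxE.
Qed.

Section ridge_field.
Context {R : realType} {n p : nat} (eps : R).
Hypothesis eps0 : 0 < eps.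

(** For [eps = 0] and a matrix of full row rank, the coefficients of the
orthogonal projection of [x] on the row space of [Y]. *)
Definition ridge_coef (Y : 'M[R]_(n, p)) (x : 'cV[R]_p) : 'cV[R]_n :=
  ridge_inv eps Y *m Y *m x.

Definition ridge_fit (Y : 'M[R]_(n, p)) (x : 'cV[R]_p) : 'cV[R]_p :=
  Y^T *m ridge_coef Y x.

Lemma ridge_fit_hat Y x : ridge_fit Y x = Y^T *m ridge_inv eps Y *m Y *m x.
Proof. by rewrite /ridge_fit /ridge_coef !mulmxA. Qed.

(** For [eps = 0] the fit is a projection and has the same coefficients as
[x]; the last term is the error due to the penalty. *)
Lemma ridge_mul_fit Y x : ridge_inv eps Y *m (Y *m ridge_fit Y x) =
  ridge_coef Y x - eps *: (ridge_inv eps Y *m ridge_coef Y x).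
Proof.
rewrite /ridge_fit [Y *m _]mulmxA mulmxA ridge_invl// mulmxBl mul1mx.
by rewrite -scalemxAl.
Qed.

(** The normal equations of ridge regression. *)
Lemma ridge_residual Y x : Y *m (x - ridge_fit Y x) = eps *: ridge_coef Y x.
Proof.
have e : (Y *m Y^T + eps%:M) *m ridge_coef Y x = Y *m x.
  by rewrite /ridge_coef -mulmxA mulKVmx// ridge_unit.
rewrite mulmxBr -e mulmxDl mul_scalar_mx /ridge_fit [Y *m (Y^T *m _)]mulmxA.
by rewrite addrAC subrr add0r.
Qed.

Lemma bounded_ridge_inv : bounded_mx (ridge_inv eps : 'M[R]_(n, p) -> _).
Proof. by apply: bounded_frob2 => Y; exact: frob2_N_le. Qed.

Lemma bounded_ridge_invY : bounded_mx (fun Y : 'M[R]_(n, p) => ridge_inv eps Y *m Y).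
Proof. by apply: bounded_frob2 => Y; exact: frob2_NY_le. Qed.

Lemma bounded_tr_ridge_inv :
  bounded_mx (fun Y : 'M[R]_(n, p) => Y^T *m ridge_inv eps Y).
Proof. by apply: bounded_frob2 => Y; exact: frob2_YN_le. Qed.

Lemma bounded_ridge_hat :
  bounded_mx (fun Y : 'M[R]_(n, p) => Y^T *m ridge_inv eps Y *m Y).
Proof. by apply: bounded_frob2 => Y; exact: frob2_hat_le. Qed.

(** The derivative at [Y] in the direction [D]; see [is_derive_ridge_coef]. *)
Definition dcoef Y x (D : 'M[R]_(n, p)) : 'cV[R]_n :=
  ridge_inv eps Y *m (D *m (x - ridge_fit Y x)) -
  ridge_inv eps Y *m Y *m (D^T *m ridge_coef Y x).

Definition dfit Y x (D : 'M[R]_(n, p)) : 'cV[R]_p :=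
  D^T *m ridge_coef Y x + Y^T *m dcoef Y x D.

Lemma is_derive_ridge_coef Y x D :
  is_derive_mx (fun s => ridge_coef (Y + s *: D) x) 0 (dcoef Y x D).
Proof.
have YE := is_derive_mx_line Y D 0.
have := is_derive_mxD (is_derive_mxM YE (is_derive_mx_tr YE))
  (is_derive_mx_cst (eps%:M) 0).
move=> /(is_derive_mx_inv (fun u => ridge_unit (Y + u *: D) eps0)).
move=> /is_derive_mxM/(_ YE)/is_derive_mxM/(_ (is_derive_mx_cst x 0)).
rewrite !scale0r !addr0 -/(ridge_inv eps Y) mulmx0 addr0.
congr (is_derive_mx _ _ _).
rewrite /dcoef mulmxBr mulmxBr /ridge_fit /ridge_coef.
rewrite !(mulmxDl, mulmxDr, mulNmx, mulmxN) !mulmxA.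
by rewrite addrC opprD addrA.
Qed.

Lemma is_derive_ridge_fit Y x D :
  is_derive_mx (fun s => ridge_fit (Y + s *: D) x) 0 (dfit Y x D).
Proof.
have YE := is_derive_mx_line Y D 0.
have := is_derive_mxM (is_derive_mx_tr YE) (is_derive_ridge_coef Y x D).
by rewrite scale0r addr0.
Qed.

Lemma is_derive_frob2 (w : R -> 'cV[R]_n) s dw : is_derive_mx w s dw ->
  is_derive s 1 (fun u => frob2 (w u)) (2 * ((w s)^T *m dw) 0 0).
Proof.
move=> wE; have := is_derive_mxM (is_derive_mx_tr wE) wE => /(_ 0 0).
rewrite [X in is_derive _ _ X](_ : _ = fun u => frob2 (w u)); last first.
  by apply/funext => u; rewrite frob2_col.
congr is_derive; rewrite mxE -[dw^T *m w s]trmxK trmx_mul trmxK [X in X + _]mxE.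
by rewrite mulr_natl mulr2n.
Qed.

End ridge_field.

(** * Vector fields of the ridge estimator and their divergences *)

Section ridge_vector_fields.
Context {R : realType} {n p : nat} (eps : R).
Hypothesis eps0 : 0 < eps.
Variables (kappa dkappa : R -> R).
Hypothesis kappaE : forall s : R, 0 <= s -> is_derive s 1 kappa (dkappa s).

Local Notation N := (ridge_inv eps).
Local Notation coef := (ridge_coef eps).
Local Notation fit := (ridge_fit eps).

Definition shrink (Y : 'M[R]_(n, p)) x := kappa (frob2 (coef Y x)).
Definition dshrink (Y : 'M[R]_(n, p)) x := dkappa (frob2 (coef Y x)).

Lemma is_derive_comp1 (f : R -> R) (s df : R) : is_derive s 1 f df -> 0 <= f s ->
  is_derive s 1 (fun u => kappa (f u)) (dkappa (f s) * df).
Proof.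
move=> fE fs0; have [fd <-] := fE; have [kd kE] := kappaE fs0.
split.
  apply/derivable1_diffP; apply: differentiable_comp; exact/derivable1_diffP.
by rewrite -!derive1E derive1_comp// -kE !derive1E.
Qed.

(** The coordinates of [kappa Y' w] after whitening by [B = A^-1], as a function
of [x]: the integrand of the cross term is [sum_l Z_l X_field]. *)
Definition X_field (B : 'M[R]_p) l (Y : 'M[R]_(n, p)) (x : 'cV[R]_p) : R :=
  shrink Y x * (B *m fit Y x) l 0.

Definition X_dfield (B : 'M[R]_p) l (Y : 'M[R]_(n, p)) (x a : 'cV[R]_p) : R :=
  dshrink Y x * (2 * ((coef Y x)^T *m coef Y a) 0 0) * (B *m fit Y x) l 0 +
  shrink Y x * (B *m fit Y a) l 0.

Lemma is_derive_X_field B l Y x a :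
  is_derive (0 : R) 1 (fun s : R => X_field B l Y (x + s *: a)) (X_dfield B l Y x a).
Proof.
have wE : is_derive_mx (fun s : R => coef Y (x + s *: a)) 0 (coef Y a).
  have := is_derive_mxM (is_derive_mx_cst (N Y *m Y) 0) (is_derive_mx_line x a 0).
  by rewrite mul0mx add0r.
have BvE : is_derive_mx (fun s : R => B *m fit Y (x + s *: a)) 0 (B *m fit Y a).
  have := is_derive_mxM (is_derive_mx_cst B 0) (is_derive_mxM (is_derive_mx_cst Y^T 0) wE).
  by rewrite !mul0mx !add0r.
have kE := is_derive_comp1 (is_derive_frob2 wE) (frob2_ge0 _).
have := is_deriveM kE (BvE l 0); rewrite scale0r addr0.
move=> /is_derive_eq; apply; rewrite /X_dfield /shrink /dshrink /GRing.scale/=.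
ring.
Qed.

(** The coordinates of [kappa^2 w_i Y' w] after whitening, as a function of
[Y]: the quadratic term of the loss is linear in the rows of [Y] with these
coefficients. *)
Definition row_field i (B : 'M[R]_p) l x (Y : 'M[R]_(n, p)) : R :=
  shrink Y x ^+ 2 * coef Y x i 0 * (B *m fit Y x) l 0.

Definition row_dfield i (B : 'M[R]_p) l x (Y D : 'M[R]_(n, p)) : R :=
  2 * shrink Y x * dshrink Y x * (2 * ((coef Y x)^T *m dcoef eps Y x D) 0 0) *
    coef Y x i 0 * (B *m fit Y x) l 0 +
  shrink Y x ^+ 2 * dcoef eps Y x D i 0 * (B *m fit Y x) l 0 +
  shrink Y x ^+ 2 * coef Y x i 0 * (B *m dfit eps Y x D) l 0.

Lemma is_derive_row_field i B l x Y D :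
  is_derive (0 : R) 1 (fun s : R => row_field i B l x (Y + s *: D)) (row_dfield i B l x Y D).
Proof.
have wE := is_derive_ridge_coef eps0 Y x D.
have BvE := is_derive_mxM (is_derive_mx_cst B 0) (is_derive_ridge_fit eps0 Y x D).
have kE := is_derive_comp1 (is_derive_frob2 wE) (frob2_ge0 _).
have := is_deriveM (is_deriveM (is_deriveM kE kE) (wE i 0)) (BvE l 0).
rewrite mul0mx add0r scale0r addr0.
rewrite [X in is_derive _ _ X](_ : _ =
  (fun s : R => row_field i B l x (Y + s *: D))); last first.
  by apply/funext => s; rewrite /row_field expr2.
move=> /is_derive_eq; apply;
rewrite !fctE scale0r addr0 /row_dfield /shrink /dshrink /GRing.scale/=.
ring.
Qed.

Definition ridge_form (Y : 'M[R]_(n, p)) x : R :=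
  ((coef Y x)^T *m N Y *m coef Y x) 0 0.

Lemma mulmx_scalar1 k (v : 'cV[R]_k) (u : 'M[R]_1) : v *m u = u 0 0 *: v.
Proof. by rewrite [u]mx11_scalar mul_mx_scalar mxE eqxx mulr1n. Qed.

Lemma coef_mul_fit Y x : (coef Y x)^T *m (N Y *m Y *m fit Y x) =
  (frob2 (coef Y x) - eps * ridge_form Y x)%:M.
Proof.
rewrite -[N Y *m Y *m _]mulmxA ridge_mul_fit// mulmxBr -scalemxAr.
rewrite [_ *m (N Y *m coef Y x)]mulmxA.
rewrite [_ - _]mx11_scalar; congr (_%:M).
by rewrite mxE [X in _ + X]mxE [X in - X]mxE -frob2_col.
Qed.

(** The Jacobian of [x |-> kappa(|w|^2) Y' w] is a rank one term, coming from
[kappa], plus [kappa] times the ridge projection, of trace [n - eps tr N]. *)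
Lemma X_divergence (A B : 'M[R]_p) Y x : A *m B = 1%:M ->
  \sum_l X_dfield B l Y x (A *m (delta_mx l 0 : 'cV[R]_p)) =
  2 * dshrink Y x * (frob2 (coef Y x) - eps * ridge_form Y x) +
  shrink Y x * (n%:R - eps * \tr (N Y)).
Proof.
move=> AB.
(* The Jacobian of [x |-> shrink Y x *: fit Y x]. *)
pose T : 'M[R]_p := (2 * dshrink Y x) *: (fit Y x *m ((coef Y x)^T *m (N Y *m Y))) +
  shrink Y x *: (Y^T *m N Y *m Y).
transitivity (\tr T); last first.
  rewrite /T mxtraceD !mxtraceZ mxtrace_mulC -[_ *m fit Y x]mulmxA coef_mul_fit.
  by rewrite mxtrace_scalar mulr1n tr_ridge_hat.
rewrite -(sum_delta_trace T AB); apply: eq_bigr => l _.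
set a := A *m _; rewrite /T /X_dfield mulmxDl mulmxDr [RHS]mxE.
rewrite -!scalemxAl -!scalemxAr [X in _ = X + _]mxE [X in _ = _ + X]mxE.
congr (_ + _); last by rewrite (ridge_fit_hat _ Y a).
rewrite -[fit Y x *m _ *m a]mulmxA mulmx_scalar1 -scalemxAr [X in _ = _ * X]mxE.
have -> : ((coef Y x)^T *m (N Y *m Y) *m a) 0 0 = ((coef Y x)^T *m coef Y a) 0 0.
  by rewrite -[LHS]/(((coef Y x)^T *m (N Y *m Y) *m a) 0 0) -[_ *m a]mulmxA.
ring.
Qed.

(** The derivative of the ridge coefficient when row [i] moves along [a] is
[row_jac x Y i *m a]; see [dcoef_row]. *)
Definition row_jac (x : 'cV[R]_p) (Y : 'M[R]_(n, p)) (i : 'I_n) : 'M[R]_(n, p) :=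
  N Y *m (delta_mx i 0 *m (x - fit Y x)^T) - coef Y x i 0 *: (N Y *m Y).

Lemma tr_delta_mul (w : 'cV[R]_n) i (a : 'cV[R]_p) :
  (delta_mx i 0 *m a^T : 'M[R]_(n, p))^T *m w = w i 0 *: a.
Proof.
by rewrite trmx_mul trmxK -mulmxA trmx_delta -rowE mulmx_scalar1 mxE.
Qed.

Lemma trmx11 (M : 'M[R]_1) : M^T = M.
Proof. by rewrite [M]mx11_scalar tr_scalar_mx. Qed.

Lemma dcoef_row i x Y (a : 'cV[R]_p) :
  dcoef eps Y x (delta_mx i 0 *m a^T) = row_jac x Y i *m a.
Proof.
rewrite /dcoef /row_jac tr_delta_mul mulmxBl -scalemxAl -scalemxAr.
congr (_ - _); rewrite -!mulmxA; congr (_ *m (_ *m _)).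
by rewrite -[LHS]trmx11 trmx_mul trmxK.
Qed.

Lemma row_jac_fit i x Y : row_jac x Y i *m fit Y x =
  (eps * frob2 (coef Y x)) *: col i (N Y) -
  coef Y x i 0 *: (coef Y x - eps *: (N Y *m coef Y x)).
Proof.
rewrite /row_jac mulmxBl -scalemxAl -[N Y *m Y *m _]mulmxA ridge_mul_fit//.
congr (_ - _); rewrite -!mulmxA colE.
have -> : (x - fit Y x)^T *m fit Y x = (eps * frob2 (coef Y x))%:M.
  rewrite {2}/ridge_fit mulmxA -trmx_mul ridge_residual// linearZ/= -scalemxAl.
  by rewrite [_ *m _]mx11_scalar scale_scalar_mx -frob2_col.
by rewrite mul_mx_scalar -scalemxAr.
Qed.

Lemma coef_col_ridge (w : 'cV[R]_n) i (Y : 'M[R]_(n, p)) :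
  (w^T *m col i (N Y)) 0 0 = (N Y *m w) i 0.
Proof.
rewrite !mxE; apply: eq_bigr => j _; rewrite !mxE mulrC.
by have /matrixP/(_ i j) := ridge_sym eps Y; rewrite mxE => ->.
Qed.

Lemma tr_row_jac i x Y : \tr (Y^T *m row_jac x Y i) =
  eps * (N Y *m coef Y x) i 0 - coef Y x i 0 * (n%:R - eps * \tr (N Y)).
Proof.
rewrite /row_jac mulmxBr -scalemxAr linearB/= mxtraceZ [Y^T *m (N Y *m Y)]mulmxA.
rewrite tr_ridge_hat//; congr (_ - _).
rewrite mxtrace_mulC -!mulmxA -trmx_mul ridge_residual// linearZ/= -!scalemxAr mxtraceZ.
by rewrite mulmxA mxtrace_mulC -colE -coef_col_ridge /mxtrace big_ord1.
Qed.

(** The three terms of the product rule for [kappa^2 w_i Y' w] in row [i]: two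
rank one terms, and [kappa^2 w_i] times the derivative of [Y' w], where [Y]
itself contributes [w_i] times the identity. *)
Lemma row_trace i A B x Y : A *m B = 1%:M ->
  \sum_l row_dfield i B l x Y (delta_mx i 0 *m (A *m (delta_mx l 0 : 'cV[R]_p))^T) =
  4 * shrink Y x * dshrink Y x * coef Y x i 0 *
     ((coef Y x)^T *m (row_jac x Y i *m fit Y x)) 0 0 +
  shrink Y x ^+ 2 * (row_jac x Y i *m fit Y x) i 0 +
  shrink Y x ^+ 2 * coef Y x i 0 * (coef Y x i 0 * p%:R + \tr (Y^T *m row_jac x Y i)).
Proof.
move=> AB.
pose T : 'M[R]_p :=
  (4 * shrink Y x * dshrink Y x * coef Y x i 0) *:
    (fit Y x *m ((coef Y x)^T *m row_jac x Y i)) +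
  shrink Y x ^+ 2 *: (fit Y x *m row i (row_jac x Y i)) +
  (shrink Y x ^+ 2 * coef Y x i 0) *: ((coef Y x i 0)%:M + Y^T *m row_jac x Y i).
transitivity (\tr T); last first.
  rewrite /T !mxtraceD !mxtraceZ mxtraceD mxtrace_scalar -[_ *+ p]mulr_natr.
  rewrite mxtrace_mulC -[_ *m _ *m fit Y x]mulmxA.
  rewrite [\tr (fit Y x *m row _ _)]mxtrace_mulC -row_mul.
  by rewrite /mxtrace !big_ord1 [row i _ _ _]mxE.
rewrite -(sum_delta_trace T AB); apply: eq_bigr => l _.
set a := A *m _; rewrite /T /row_dfield /dfit dcoef_row tr_delta_mul; clear T.
move: (row_jac x Y i) (fit Y x) (coef Y x) => J v w.
rewrite !mulmxDl -!scalemxAl mulmxDl mul_scalar_mx !mulmxDr -!scalemxAr !mulmxDr.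
rewrite [X in _ = X]mxE [X in _ = X + _]mxE.
rewrite [X in _ = X + _ + _]mxE [X in _ = _ + X + _]mxE [X in _ = _ + X]mxE.
congr (_ + _ + _); last by rewrite -scalemxAr !mulmxA.
- rewrite -[v *m _ *m a]mulmxA mulmx_scalar1 -scalemxAr [X in _ = _ * X]mxE.
  by rewrite -[w^T *m J *m a]mulmxA; ring.
- rewrite -[v *m _ *m a]mulmxA mulmx_scalar1 -scalemxAr [X in _ = _ * X]mxE.
  by rewrite -row_mul [X in _ = _ * (X * _)]mxE mulrA.
Qed.

Lemma sub_scale_entry m k (u w z : 'M[R]_(m, k)) (a b c : R) i j :
  (a *: u - b *: (w - c *: z)) i j = a * u i j - b * (w i j - c * z i j).
Proof. by rewrite !mxE. Qed.

(** Summing over the rows collapses [sum_i w_i^2] to [F], [sum_i w_i (N w)_i] to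
[w' N w] and [sum_i N_ii] to [tr N]. For [eps = 0] there remains
[- 4 kappa kappa' F^2 + (p - n - 1) kappa^2 F]. *)
Lemma row_divergence (A B : 'I_n -> 'M[R]_p) Y x : (forall i, A i *m B i = 1%:M) ->
  \sum_i \sum_l row_dfield i (B i) l x Y
     (delta_mx i 0 *m (A i *m (delta_mx l 0 : 'cV[R]_p))^T) =
  4 * shrink Y x * dshrink Y x * (2 * eps * frob2 (coef Y x) * ridge_form Y x
    - frob2 (coef Y x) ^+ 2) +
  shrink Y x ^+ 2 * (2 * eps * frob2 (coef Y x) * \tr (N Y) - frob2 (coef Y x)
    + 2 * eps * ridge_form Y x + (p%:R - n%:R) * frob2 (coef Y x)).
Proof.
move=> AB; set w := coef Y x; set F := frob2 w; set al := ridge_form Y x.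
set k := shrink Y x; set dk := dshrink Y x; set t := \tr (N Y).
pose Nw i := (N Y *m w) i 0.
have wN i : (w^T *m col i (N Y)) 0 0 = Nw i.
  exact: coef_col_ridge.
pose c1 := 4 * k * dk * eps * F + 2 * k ^+ 2 * eps.
pose c2 := - (4 * k * dk * (F - eps * al)) - k ^+ 2 +
  k ^+ 2 * (p%:R - (n%:R - eps * t)).
pose c3 := k ^+ 2 * eps * F.
have e i : \sum_l row_dfield i (B i) l x Y
     (delta_mx i 0 *m (A i *m (delta_mx l 0 : 'cV[R]_p))^T) =
  c1 * (w i 0 * Nw i) + c2 * w i 0 ^+ 2 + c3 * N Y i i.
  rewrite row_trace// row_jac_fit tr_row_jac -/w -/F -/k -/dk -/t -/(Nw i).
  have -> : (w^T *m ((eps * F) *: col i (N Y) - w i 0 *: (w - eps *: (N Y *m w)))) 0 0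
     = eps * F * Nw i - w i 0 * (F - eps * al).
    rewrite mulmxBr -!scalemxAr mulmxBr -scalemxAr mxE [X in X + _]mxE wN.
    rewrite [X in _ + X]mxE [X in - X]mxE [X in - (_ * X)]mxE -frob2_col.
    by rewrite [X in _ - (_ * (_ + X))]mxE [X in _ - (_ * (_ - X))]mxE mulmxA.
  have -> : ((eps * F) *: col i (N Y) - w i 0 *: (w - eps *: (N Y *m w))) i 0 =
     eps * F * N Y i i - w i 0 * (w i 0 - eps * Nw i).
    by rewrite sub_scale_entry [col _ _ _ _]mxE.
  rewrite /c1 /c2 /c3; ring.
under eq_bigr do rewrite e.
rewrite !big_split/= -!mulr_sumr.
have -> : \sum_i w i 0 * Nw i = al.
  rewrite /al /ridge_form -/w -[w^T *m _ *m w]mulmxA [RHS]mxE.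
  by apply: eq_bigr => i _; rewrite [w^T _ _]mxE.
have -> : \sum_i w i 0 ^+ 2 = F.
  by rewrite /F /frob2; apply: eq_bigr => i _; rewrite big_ord1.
rewrite -/(\tr (N Y)) -/t /c1 /c2 /c3; ring.
Qed.

End ridge_vector_fields.

(** * Boundedness and measurability of the ridge fields *)

Section ridge_fields_bounds.
Context {R : realType} {n p : nat} (eps : R).
Hypothesis eps0 : 0 < eps.
Variables (kappa dkappa : R -> R) (c : R).
Hypothesis kappa_le : forall s : R, 0 <= s -> `|kappa s| * (1 + s) <= c.
Hypothesis dkappa_le : forall s : R, 0 <= s -> `|dkappa s| * (1 + s) <= c.

Local Notation N := (ridge_inv eps).
Local Notation coef := (ridge_coef eps).
Local Notation fit := (ridge_fit eps).
Local Notation shrink := (shrink eps kappa).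
Local Notation dshrink := (dshrink eps dkappa).

(** [1 + s] bounds both [s] and [1], so one hypothesis on [k] gives the bound on
[k] itself and its decay. *)
Lemma weight_le (k : R -> R) (s : R) : 0 <= s -> `|k s| * (1 + s) <= c -> `|k s| <= c.
Proof.
by move=> s0; apply: le_trans; rewrite ler_peMr// lerDl.
Qed.

Lemma bounded_shrink (I : Type) (Y : I -> 'M[R]_(n, p)) x :
  bounded_sc (fun t => shrink (Y t) (x t)).
Proof.
by exists c => t; apply: weight_le (kappa_le _); exact: frob2_ge0.
Qed.

Lemma bounded_dshrink (I : Type) (Y : I -> 'M[R]_(n, p)) x :
  bounded_sc (fun t => dshrink (Y t) (x t)).
Proof.
by exists c => t; apply: weight_le (dkappa_le _); exact: frob2_ge0.
Qed.

Lemma bounded_coef x : bounded_mx (fun Y : 'M[R]_(n, p) => coef Y x).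
Proof. by apply: bounded_mxM (bounded_mx_cst _); exact: bounded_ridge_invY. Qed.

Lemma bounded_fit x : bounded_mx (fun Y : 'M[R]_(n, p) => fit Y x).
Proof.
under [X in bounded_mx X]eq_fun do rewrite ridge_fit_hat.
by apply: bounded_mxM (bounded_mx_cst _); exact: bounded_ridge_hat.
Qed.

Lemma bounded_dcoef x D : bounded_mx (fun Y : 'M[R]_(n, p) => dcoef eps Y x D).
Proof.
apply: bounded_mxD.
  apply: bounded_mxM; first exact: bounded_ridge_inv.
  apply: bounded_mxM; first exact: bounded_mx_cst.
  apply: bounded_mxD; first exact: bounded_mx_cst.
  by apply: bounded_mxN; exact: bounded_fit.
apply: bounded_mxN; apply: bounded_mxM; first exact: bounded_ridge_invY.
by apply: bounded_mxM; [exact: bounded_mx_cst|exact: bounded_coef].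
Qed.

(** [Y] times the derivative of the coefficient has to be bounded although [Y] is
not: [Y'] is absorbed in the bounded matrices [Y' N] and [Y' N Y]. *)
Lemma bounded_dfit x D : bounded_mx (fun Y : 'M[R]_(n, p) => dfit eps Y x D).
Proof.
apply: bounded_mxD.
  by apply: bounded_mxM; [exact: bounded_mx_cst|exact: bounded_coef].
rewrite [X in bounded_mx X](_ : _ = fun Y : 'M[R]_(n, p) =>
  Y^T *m N Y *m (D *m (x - fit Y x)) - Y^T *m N Y *m Y *m (D^T *m coef Y x)).
  apply: bounded_mxD.
    apply: bounded_mxM; first exact: bounded_tr_ridge_inv.
    apply: bounded_mxM; first exact: bounded_mx_cst.
    apply: bounded_mxD; first exact: bounded_mx_cst.
    by apply: bounded_mxN; exact: bounded_fit.
  apply: bounded_mxN; apply: bounded_mxM; first exact: bounded_ridge_hat.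
  by apply: bounded_mxM; [exact: bounded_mx_cst|exact: bounded_coef].
by apply/funext => Y; rewrite /dcoef mulmxBr !mulmxA.
Qed.

Lemma bounded_row_field i B l x :
  bounded_sc (fun Y : 'M[R]_(n, p) => row_field eps kappa i B l x Y).
Proof.
apply: bounded_scM; [apply: bounded_scM|].
- under [X in bounded_sc X]eq_fun do rewrite expr2.
  by apply: bounded_scM; exact: bounded_shrink.
- by apply: bounded_entry; exact: bounded_coef.
- apply: bounded_entry; apply: bounded_mxM; first exact: bounded_mx_cst.
  exact: bounded_fit.
Qed.

Lemma bounded_row_dfield i B l x D :
  bounded_sc (fun Y : 'M[R]_(n, p) => row_dfield eps kappa dkappa i B l x Y D).
Proof.
have bk2 : bounded_sc (fun Y : 'M[R]_(n, p) => shrink Y x ^+ 2).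
  under [X in bounded_sc X]eq_fun do rewrite expr2.
  by apply: bounded_scM; exact: bounded_shrink.
have bw : bounded_sc (fun Y : 'M[R]_(n, p) => coef Y x i 0).
  by apply: bounded_entry; exact: bounded_coef.
have bv : bounded_sc (fun Y : 'M[R]_(n, p) => (B *m fit Y x) l 0).
  apply: bounded_entry; apply: bounded_mxM; first exact: bounded_mx_cst.
  exact: bounded_fit.
apply: bounded_scD; [apply: bounded_scD|].
- do 2![apply: bounded_scM => //]; apply: bounded_scM.
    apply: bounded_scM; last exact: bounded_dshrink.
    by apply: bounded_scM; [exact: bounded_sc_cst|exact: bounded_shrink].
  apply: bounded_scM; first exact: bounded_sc_cst.
  apply: bounded_entry; apply: bounded_mxM; last exact: bounded_dcoef.
  by apply: bounded_mx_tr; exact: bounded_coef.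
- apply: bounded_scM => //; apply: bounded_scM => //.
  by apply: bounded_entry; exact: bounded_dcoef.
- apply: bounded_scM; first exact: bounded_scM.
  apply: bounded_entry; apply: bounded_mxM; first exact: bounded_mx_cst.
  exact: bounded_dfit.
Qed.

(** In [x] the coefficient is unbounded, and its growth is compensated by the
decay of [kappa]. *)
Lemma bounded_shrunk_coef (Y : 'M[R]_(n, p)) :
  bounded_mx (fun x => shrink Y x *: coef Y x).
Proof.
exists c => x i j; rewrite mxE normrM (le_trans _ (kappa_le (frob2_ge0 (coef Y x))))//.
by rewrite ler_wpM2l// frob2_entry_norm.
Qed.

Lemma bounded_dshrunk_coef (Y : 'M[R]_(n, p)) :
  bounded_mx (fun x => dshrink Y x *: (coef Y x *m (coef Y x)^T)).
Proof.
exists c => x i j; rewrite mxE normrM (le_trans _ (dkappa_le (frob2_ge0 (coef Y x))))//.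
rewrite ler_wpM2l// mxE big_ord1 [X in _ * X]mxE normrM.
have := frob2_entry (coef Y x) i 0; have := frob2_entry (coef Y x) j 0.
rewrite -(real_normK (num_real (coef Y x i 0))) -(real_normK (num_real (coef Y x j 0))).
have := sqr_ge0 (`|coef Y x i 0| - `|coef Y x j 0|); nra.
Qed.

Lemma bounded_X_field B l (Y : 'M[R]_(n, p)) : bounded_sc (X_field eps kappa B l Y).
Proof.
rewrite [X in bounded_sc X](_ : _ =
    fun x => (B *m (Y^T *m (shrink Y x *: coef Y x))) l 0).
  apply: bounded_entry; do 2![apply: bounded_mxM; first exact: bounded_mx_cst].
  exact: bounded_shrunk_coef.
by apply/funext => x; rewrite /X_field -!scalemxAr [RHS]mxE.
Qed.

Lemma bounded_X_dfield B l (Y : 'M[R]_(n, p)) a :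
  bounded_sc (fun x => X_dfield eps kappa dkappa B l Y x a).
Proof.
rewrite [X in bounded_sc X](_ : _ = fun x => 2 * (B *m (Y^T *m
    ((dshrink Y x *: (coef Y x *m (coef Y x)^T)) *m coef Y a))) l 0 +
    shrink Y x * (B *m fit Y a) l 0).
  apply: bounded_scD.
    apply: bounded_scM; first exact: bounded_sc_cst.
    apply: bounded_entry; do 2![apply: bounded_mxM; first exact: bounded_mx_cst].
    by apply: bounded_mxM (bounded_mx_cst _); exact: bounded_dshrunk_coef.
  by apply: bounded_scM (bounded_sc_cst _); exact: (bounded_shrink (fun=> Y) id).
apply/funext => x; rewrite /X_dfield; congr (_ + _).
rewrite -scalemxAl -!scalemxAr [X in _ = _ * X]mxE -[_ *m _ *m coef Y a]mulmxA.
rewrite mulmx_scalar1 -!scalemxAr [X in _ = _ * (_ * X)]mxE -/(fit Y x).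
by move: (_ l 0) (_ 0 0) => u v; ring.
Qed.

End ridge_fields_bounds.

Section ridge_measurable.
Context {R : realType} {n p : nat} (eps : R).
Context {d : measure_display} {T : measurableType d}.
Variables (Y : T -> 'M[R]_(n, p)) (x : T -> 'cV[R]_p).
Hypotheses (mY : measurable_fun setT Y) (mx : measurable_fun setT x).

Lemma measurable_ridge_inv : measurable_fun setT (fun t => ridge_inv eps (Y t)).
Proof.
apply: measurable_invmx; apply: measurable_addmx => //.
by apply: measurable_mulmx => //; exact: measurable_trmx.
Qed.

Lemma measurable_ridge_coef : measurable_fun setT (fun t => ridge_coef eps (Y t) (x t)).
Proof.
apply: measurable_mulmx => //; apply: measurable_mulmx => //.
exact: measurable_ridge_inv.
Qed.

Lemma measurable_ridge_fit : measurable_fun setT (fun t => ridge_fit eps (Y t) (x t)).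
Proof.
apply: measurable_mulmx; first exact: measurable_trmx.
exact: measurable_ridge_coef.
Qed.

Lemma measurable_frob2 m k (A : T -> 'M[R]_(m, k)) : measurable_fun setT A ->
  measurable_fun setT (fun t => frob2 (A t)).
Proof.
move=> mA; apply: measurable_sum => i; apply: measurable_sum => j.
by apply: measurable_funX; exact: measurable_fun_entry.
Qed.

Variable kappa : R -> R.
Hypothesis mkappa : measurable_fun setT kappa.

Lemma measurable_shrink : measurable_fun setT (fun t => shrink eps kappa (Y t) (x t)).
Proof.
apply: measurableT_comp => //; apply: measurable_frob2.
exact: measurable_ridge_coef.
Qed.

Lemma measurable_X_field B l :
  measurable_fun setT (fun t => X_field eps kappa B l (Y t) (x t)).
Proof.
apply: measurable_funM; first exact: measurable_shrink.
apply: measurable_fun_entry; apply: measurable_mulmx => //.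
exact: measurable_ridge_fit.
Qed.

Lemma measurable_row_field i B l :
  measurable_fun setT (fun t => row_field eps kappa i B l (x t) (Y t)).
Proof.
apply: measurable_funM.
  apply: measurable_funM; first by apply: measurable_funX; exact: measurable_shrink.
  by apply: measurable_fun_entry; exact: measurable_ridge_coef.
apply: measurable_fun_entry; apply: measurable_mulmx => //.
exact: measurable_ridge_fit.
Qed.

End ridge_measurable.

(** * Stein's identity for the ridge fields *)

Section same_mean.
Context {R : realType} {d : measure_display} {T : measurableType d}
  (P : probability T R).

(** Equality of integrals is recorded with integrability on both sides, so that
it passes to finite sums. *)
Definition same_mean (f g : T -> R) :=
  [/\ P.-integrable setT (fun w => (f w)%:E), P.-integrable setT (fun w => (g w)%:E) &
      (\int[P]_w (f w)%:E = \int[P]_w (g w)%:E)%E].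

Lemma same_mean_sum (I : finType) (f g : I -> T -> R) :
  (forall k, same_mean (f k) (g k)) ->
  same_mean (fun w => \sum_k f k w) (fun w => \sum_k g k w).
Proof.
move=> fg.
have fi k : P.-integrable setT (fun w => (f k w)%:E) by have [] := fg k.
have gi k : P.-integrable setT (fun w => (g k w)%:E) by have [] := fg k.
have fE : (fun w => (\sum_k f k w)%:E) = (fun w => \sum_k (f k w)%:E)%E.
  by apply/funext => w; rewrite sumEFin.
have gE : (fun w => (\sum_k g k w)%:E) = (fun w => \sum_k (g k w)%:E)%E.
  by apply/funext => w; rewrite sumEFin.
rewrite /same_mean fE gE; split; try exact: integrable_sum.
by rewrite !integral_sum//; apply: eq_bigr => k _; have [] := fg k.
Qed.

Lemma integrable_bounded (f : T -> R) (C : R) : measurable_fun setT f ->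
  (forall w, `|f w| <= C) -> P.-integrable setT (fun w => (f w)%:E).
Proof.
move=> mf fC; have iC : P.-integrable setT (cst C%:E).
  by apply: finite_measure_integrable_cst.
apply: (le_integrable measurableT _ _ iC); first exact/measurable_EFinP.
by move=> w _; rewrite /= lee_fin (le_trans (fC _))// ler_norm.
Qed.

End same_mean.

Section stein_fields.
Context {R : realType} {n p : nat} (eps : R).
Hypothesis eps0 : 0 < eps.
Variables (kappa dkappa : R -> R) (c : R).
Hypothesis kappaE : forall s : R, 0 <= s -> is_derive s 1 kappa (dkappa s).
Hypothesis kappa_le : forall s : R, 0 <= s -> `|kappa s| * (1 + s) <= c.
Hypothesis dkappa_le : forall s : R, 0 <= s -> `|dkappa s| * (1 + s) <= c.
Hypothesis mkappa : measurable_fun setT kappa.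

Local Notation N := (ridge_inv eps).
Local Notation coef := (ridge_coef eps).
Local Notation form := (ridge_form eps).
Local Notation shrink := (shrink eps kappa).
Local Notation dshrink := (dshrink eps dkappa).

Lemma X_stein {d : measure_display} {T : measurableType d} (P : probability T R)
    (Z : 'I_p -> {RV P >-> R}) (A : 'M[R]_p) (theta : 'cV[R]_p) (Y : 'M[R]_(n, p)) :
  std_normal_sample Z -> A \in unitmx ->
  let X w := theta + A *m \col_l Z l w in
  same_mean P (fun w => \sum_l Z l w * X_field eps kappa (invmx A) l Y (X w))
    (fun w => 2 * dshrink Y (X w) * (frob2 (coef Y (X w)) - eps * form Y (X w)) +
      shrink Y (X w) * (n%:R - eps * \tr (N Y))).
Proof.
move=> stdZ Au X; have AV : A *m invmx A = 1%:M by rewrite mulmxV.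
rewrite [X in same_mean _ _ X](_ : _ = fun w =>
    \sum_l X_dfield eps kappa dkappa (invmx A) l Y (X w) (A *m (delta_mx l 0 : 'cV[R]_p))).
  2: by apply/funext => w; rewrite X_divergence.
apply: same_mean_sum => l.
pose f (z : 'cV[R]_p) := X_field eps kappa (invmx A) l Y (theta + A *m z).
pose df (z : 'cV[R]_p) := X_dfield eps kappa dkappa (invmx A) l Y (theta + A *m z)
  (A *m (delta_mx l 0 : 'cV[R]_p)).
have mf : measurable_fun setT f.
  apply: measurable_X_field => //; apply: measurable_addmx => //.
  exact: measurable_mulmx.
have fE z : is_derive (0 : R) 1 (fun s : R => f (z + s *: delta_mx l 0)) (df z).
  have := is_derive_X_field eps kappaE (invmx A) l Y (theta + A *m z)
    (A *m (delta_mx l 0 : 'cV[R]_p)).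
  congr is_derive; apply/funext => s.
  by rewrite /f mulmxDr -scalemxAr addrA.
have [C fC] := bounded_X_field eps kappa_le (invmx A) l Y.
have [K dfK] := bounded_X_dfield eps kappa_le dkappa_le (invmx A) l Y
  (A *m (delta_mx l 0 : 'cV[R]_p)).
have mz := measurable_sample_col Z.
have mdf := measurable_is_derive_mx mf fE.
split.
- have CZ := integrableZl measurableT C (integrable_std_normal stdZ l).
  apply: (le_integrable measurableT _ _ CZ).
    by apply/measurable_EFinP; apply: measurable_funM => //; exact: (measurableT_comp mf mz).
  move=> w _; rewrite /= lee_fin [leLHS]normrM [leRHS]normrM mulrC ler_wpM2r ?normr_ge0//.
  by rewrite (le_trans (fC _))// ler_norm.
- apply: (@integrable_bounded _ _ _ _ _ K); first exact: (measurableT_comp mdf mz).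
  by move=> w; exact: dfK.
- exact: (stein_sample stdZ mf fE (fun z => fC _) (fun z => dfK _)).
Qed.

Lemma row_stein {d : measure_display} {T : measurableType d} (Q : probability T R)
    (Y : 'I_n -> {RV Q >-> 'cV[R]_p}) (A : 'I_n -> 'M[R]_p)
    (Z : 'I_n -> 'I_p -> {RV Q >-> R}) (x : 'cV[R]_p) :
  mutual_indep_RV Y -> (forall i, A i \in unitmx) ->
  (forall i, std_normal_sample (Z i)) ->
  (forall i w, Y i w = A i *m \col_l Z i l w) ->
  let M w := rows_mx Y w in
  same_mean Q (fun w => \sum_i \sum_l Z i l w *
      row_field eps kappa i (invmx (A i)) l x (M w))
    (fun w => 4 * shrink (M w) x * dshrink (M w) x *
        (2 * eps * frob2 (coef (M w) x) * form (M w) x - frob2 (coef (M w) x) ^+ 2) +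
      shrink (M w) x ^+ 2 * (2 * eps * frob2 (coef (M w) x) * \tr (N (M w))
        - frob2 (coef (M w) x) + 2 * eps * form (M w) x
        + (p%:R - n%:R) * frob2 (coef (M w) x))).
Proof.
move=> indepY Au stdZ YE M.
rewrite [X in same_mean _ _ X](_ : _ = fun w => \sum_i \sum_l
   row_dfield eps kappa dkappa i (invmx (A i)) l x (M w)
     (delta_mx i 0 *m (A i *m (delta_mx l 0 : 'cV[R]_p))^T)).
  2: by apply/funext => w; rewrite row_divergence// => i; rewrite mulmxV.
apply: same_mean_sum => i; apply: same_mean_sum => l.
have [C fC] := bounded_row_field eps0 kappa_le i (invmx (A i)) l x.
have [K dfK] := bounded_row_dfield eps0 kappa_le dkappa_le i (invmx (A i)) l x
  (delta_mx i 0 *m (A i *m (delta_mx l 0 : 'cV[R]_p))^T).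
have mf : measurable_fun setT (row_field eps kappa i (invmx (A i)) l x : 'M[R]_(n, p) -> R).
  exact: (@measurable_row_field _ _ _ _ _ _ id (fun=> x)).
exact: (stein_row indepY (Au i) (stdZ i) (YE i) mf
  (fun M => is_derive_row_field eps0 kappaE _ _ _ _ _ _) fC dfK).
Qed.

End stein_fields.

(** * Risk of the ridge estimator *)

Section risk_arithmetic.
Context {R : realType} (c nn d F k dk u al : R).
Hypotheses (nn0 : 0 <= nn) (F0 : 0 <= F) (u0n : 0 <= u <= nn) (al0u : 0 <= al <= u * F).
Hypotheses (kc : `|k| * (1 + F) <= c) (dkc : `|dk| * (1 + F) <= c).

Let kc1 : `|k| <= c.
Proof. by apply: le_trans kc; rewrite ler_peMr// lerDl. Qed.

Let kF : `|k| * F <= c.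
Proof. by apply: le_trans kc; rewrite ler_wpM2l// lerDr. Qed.

Let dkF : `|dk| * F <= c.
Proof. by apply: le_trans dkc; rewrite ler_wpM2l// lerDr. Qed.

Let c0 : 0 <= c. Proof. exact: le_trans kc1. Qed.

Let weight (x t m : R) : `|x| * F <= c -> 0 <= m -> `|t| <= m * F -> `|x * t| <= m * c.
Proof.
move=> xF m0 tm; rewrite normrM (le_trans (ler_wpM2l (normr_ge0 x) tm))//.
by rewrite mulrCA ler_wpM2l.
Qed.

Let al_nF : al <= nn * F.
Proof.
have /andP[_ alu] := al0u; apply: (le_trans alu).
by rewrite ler_wpM2r//; have /andP[] := u0n.
Qed.

(** From here to [divergence_difference], [nn] and [d] stand for [n] and [p - n];
[F], [u], [al] for [|w|^2], [eps tr N] and [eps w' N w]; [k] and [dk] for the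
values of [kappa] and [kappa'] at [F].
Boundedness of the divergences gives their integrability. *)
Lemma X_divergence_bound :
  `|2 * dk * (F - al) + k * (nn - u)| <= 2 * ((1 + nn) * c) + c * nn.
Proof.
have hF := F0; have hn := nn0; have hc := c0.
rewrite (le_trans (ler_normD _ _))// lerD//.
  rewrite -mulrA normrM ger0_norm// ler_wpM2l//; apply: weight => //.
    by rewrite addr_ge0.
  have /andP[al0 _] := al0u; have := al_nF.
  have := mulr_ge0 nn0 F0; rewrite ler_norml => ? ?; apply/andP; split; lra.
have /andP[u0 un] := u0n; rewrite normrM ler_pM//.
by rewrite ger0_norm ?subr_ge0// lerBlDr lerDl.
Qed.

Lemma row_divergence_bound :
  `|4 * k * dk * (2 * F * al - F ^+ 2) +
    k ^+ 2 * (2 * F * u - F + 2 * al + d * F)| <=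
  4 * (c * ((1 + 2 * nn) * c)) + c * ((1 + 4 * nn + `|d|) * c).
Proof.
have hF := F0; have hn := nn0; have hc := c0.
have /andP[al0 alu] := al0u; have /andP[u0 un] := u0n; have aln := al_nF.
rewrite (le_trans (ler_normD _ _))// lerD//.
  rewrite (_ : _ * _ = 4 * ((k * F) * (dk * (2 * al - F)))); last by ring.
  rewrite normrM ger0_norm// ler_wpM2l// normrM ler_pM//.
    by rewrite normrM (ger0_norm F0).
  apply: weight => //; first by rewrite addr_ge0// mulr_ge0.
  have := mulr_ge0 nn0 F0; rewrite ler_norml => ?; apply/andP; split; nra.
rewrite expr2 -mulrA normrM ler_pM//; apply: weight => //.
  by rewrite !addr_ge0// mulr_ge0.
have uF : u * F <= nn * F by rewrite ler_wpM2r.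
have uF0 : 0 <= u * F by rewrite mulr_ge0.
have dF : `|d * F| <= `|d| * F by rewrite normrM (ger0_norm F0).
by move: dF; rewrite !ler_norml => /andP[? ?]; apply/andP; split; nra.
Qed.

(** The terms without [u] and [al] are those of the premise; each of
the remaining ones is at most [u] times a constant, since [al <= u F] and [F] is
absorbed by the decay of [k] and [dk]. *)
Lemma divergence_difference :
  - (2 * nn * k) - 4 * dk * F + (d - 1) * k ^+ 2 * F - 4 * k * dk * F ^+ 2 <= 0 ->
  (4 * k * dk * (2 * F * al - F ^+ 2) +
    k ^+ 2 * (2 * F * u - F + 2 * al + d * F))
  - 2 * (2 * dk * (F - al) + k * (nn - u)) <= (6 * c + 12 * c ^+ 2) * u.
Proof.
have hF := F0; have hn := nn0; have hc := c0.
have /andP[al0 alu] := al0u; have /andP[u0 un] := u0n.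
move=> main.
have b1 : k * u <= c * u by rewrite ler_wpM2r// (le_trans (ler_norm _)).
have b2 : dk * al <= c * u.
  rewrite (le_trans (ler_norm _))// normrM (ger0_norm al0).
  rewrite (le_trans (ler_wpM2l (normr_ge0 dk) alu))// mulrCA mulrC ler_wpM2r//.
have b3 : k * F * (dk * al) <= c * (c * u).
  rewrite (le_trans (ler_norm _))// normrM ler_pM//.
    by rewrite normrM (ger0_norm F0).
  rewrite normrM (ger0_norm al0) (le_trans (ler_wpM2l (normr_ge0 dk) alu))//.
  by rewrite mulrCA mulrC ler_wpM2r.
have b4 : k * (k * F) * u <= c * c * u.
  rewrite ler_wpM2r// (le_trans (ler_norm _))// normrM ler_pM//.
  by rewrite normrM (ger0_norm F0).
have b5 : k * (k * al) <= c * (c * u).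
  rewrite (le_trans (ler_norm _))// normrM ler_pM// normrM (ger0_norm al0).
  rewrite (le_trans (ler_wpM2l (normr_ge0 k) alu))//.
  by rewrite mulrCA mulrC ler_wpM2r.
nra.
Qed.

End risk_arithmetic.

Section whitening.
Context {R : realType} {p : nat} (A Sigma : 'M[R]_p).
Hypotheses (Au : A \in unitmx) (AS : A *m A^T = Sigma).

Lemma invmx_gram : invmx Sigma = (invmx A)^T *m invmx A.
Proof.
have ATu : A^T \in unitmx by rewrite unitmx_tr.
have Su : Sigma \in unitmx by rewrite -AS unitmx_mul Au.
rewrite -[RHS](mulKmx Su).
suff -> : Sigma *m ((invmx A)^T *m invmx A) = 1%:M by rewrite mulmx1.
by rewrite -AS trmx_inv !mulmxA mulmxK// mulmxV.
Qed.

(** Pairing a vector [A z] with [v] under [Sigma^-1] only involves [z]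
and the whitened [v], so that both Stein identities can be used in standard
normal coordinates. *)
Lemma whitened_dot (z v : 'cV[R]_p) :
  (A *m z)^T *m invmx Sigma *m v = z^T *m (invmx A *m v).
Proof.
rewrite invmx_gram trmx_mul !mulmxA -[_ *m A^T *m (invmx A)^T]mulmxA.
by rewrite -trmx_mul mulVmx// trmx1 mulmx1.
Qed.

Lemma whitened_norm (v : 'cV[R]_p) :
  (v^T *m invmx Sigma *m v) 0 0 = frob2 (invmx A *m v).
Proof. by rewrite invmx_gram frob2_col trmx_mul !mulmxA. Qed.

Lemma loss_whitened theta z (w : 'cV[R]_p) :
  loss Sigma theta (theta + A *m z - w) = frob2 (z - invmx A *m w).
Proof.
rewrite /loss whitened_norm; congr frob2.
by rewrite addrAC [theta + _]addrC addrK mulmxBr mulKmx.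
Qed.

End whitening.

Lemma dot_sum {R : realType} p (z u : 'cV[R]_p) :
  (z^T *m u) 0 0 = \sum_l z l 0 * u l 0.
Proof. by rewrite mxE; apply: eq_bigr => l _; rewrite mxE. Qed.

Lemma frob2D_dot {R : realType} p (z u : 'cV[R]_p) :
  frob2 (z + u) = frob2 z + 2 * (\sum_l z l 0 * u l 0) + frob2 u.
Proof.
rewrite /frob2 mulr_sumr -!big_split/=; apply: eq_bigr => l _.
rewrite !big_ord1 !mxE; ring.
Qed.

Lemma frob2B {R : realType} p (z u : 'cV[R]_p) :
  frob2 (z - u) = frob2 z - 2 * (\sum_l z l 0 * u l 0) + frob2 u.
Proof.
rewrite frob2D_dot -scaleN1r frob2Z sqrrN expr1n mul1r -mulrN -sumrN.
by congr (_ + 2 * _ + _); apply: eq_bigr => l _; rewrite mxE mulN1r mulrN.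
Qed.

Section ridge_risk.
Context {R : realType} {n p : nat}.
Variables (eps : R) (kappa dkappa : R -> R) (c : R).
Hypothesis eps0 : 0 < eps.
Hypothesis kappaE : forall s : R, 0 <= s -> is_derive s 1 kappa (dkappa s).
Hypothesis kappa_le : forall s : R, 0 <= s -> `|kappa s| * (1 + s) <= c.
Hypothesis dkappa_le : forall s : R, 0 <= s -> `|dkappa s| * (1 + s) <= c.
Hypothesis mkappa : measurable_fun setT kappa.
Hypothesis mdkappa : measurable_fun setT dkappa.
Hypothesis main_le0 : forall s : R, 0 <= s ->
  - (2 * n%:R * kappa s) - 4 * dkappa s * s +
  (p%:R - n%:R - 1) * kappa s ^+ 2 * s - 4 * kappa s * dkappa s * s ^+ 2 <= 0.

Context {d : measure_display} {T : measurableType d} (P : probability T R)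
  (Z : 'I_p -> {RV P >-> R}) (A : 'M[R]_p) (theta : 'cV[R]_p) (Sigma : 'M[R]_p).
Hypotheses (stdZ : std_normal_sample Z) (Au : A \in unitmx) (AS : A *m A^T = Sigma).
Context {d' : measure_display} {T' : measurableType d'} (Q : probability T' R)
  (Y : 'I_n -> {RV Q >-> 'cV[R]_p}) (B : 'I_n -> 'M[R]_p)
  (W : 'I_n -> 'I_p -> {RV Q >-> R}).
Hypotheses (indepY : mutual_indep_RV Y) (Bu : forall i, B i \in unitmx)
  (stdW : forall i, std_normal_sample (W i)) (BS : forall i, B i *m (B i)^T = Sigma)
  (YE : forall i w, Y i w = B i *m \col_l W i l w).

Local Notation N := (ridge_inv eps).
Local Notation coef := (ridge_coef eps).
Local Notation fit := (ridge_fit eps).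
Local Notation form := (ridge_form eps).
Local Notation shrink := (shrink eps kappa).
Local Notation dshrink := (dshrink eps dkappa).

Let z w : 'cV[R]_p := \col_l Z l w.
Let X w := theta + A *m z w.
Let M w := rows_mx Y w.

Let crossX (q : T * T') :=
  \sum_l Z l q.1 * X_field eps kappa (invmx A) l (M q.2) (X q.1).
Let square (q : T * T') := \sum_i \sum_l W i l q.2 *
  row_field eps kappa i (invmx (B i)) l (X q.1) (M q.2).
Let F q := frob2 (coef (M q.2) (X q.1)).
Let u (q : T * T') := eps * \tr (N (M q.2)).
Let al q := eps * form (M q.2) (X q.1).
Let k q := shrink (M q.2) (X q.1).
Let dk q := dshrink (M q.2) (X q.1).
Let divX q := 2 * dk q * (F q - al q) + k q * (n%:R - u q).
Let divY q := 4 * k q * dk q * (2 * F q * al q - F q ^+ 2) +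
  k q ^+ 2 * (2 * F q * u q - F q + 2 * al q + (p%:R - n%:R) * F q).

Let mX : measurable_fun setT X.
Proof.
apply: measurable_addmx => //; apply: measurable_mulmx => //.
exact: measurable_sample_col.
Qed.

Let mM : measurable_fun setT M. Proof. exact: measurable_rows_mx. Qed.

Let mX1 : measurable_fun setT (fun q : T * T' => X q.1).
Proof. exact: (measurableT_comp mX). Qed.

Let mM2 : measurable_fun setT (fun q : T * T' => M q.2).
Proof. exact: (measurableT_comp mM). Qed.

Let squareE q : square q = k q ^+ 2 * frob2 (invmx A *m fit (M q.2) (X q.1)).
Proof.
rewrite -(whitened_norm Au AS) {1}/ridge_fit trmx_mul trmxK -!mulmxA.
set v := fit _ _; set S := invmx Sigma.
rewrite [X in _ * X]mxE mulr_sumr; apply: eq_bigr => i _.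
rewrite [_^T 0 i]mxE.
have -> : (M q.2 *m (S *m v)) i 0 = \sum_l W i l q.2 * (invmx (B i) *m v) l 0.
  have -> : (M q.2 *m (S *m v)) i 0 = (row i (M q.2) *m (S *m v)) 0 0.
    by rewrite -row_mul [RHS]mxE.
  have -> : row i (M q.2) = (Y i q.2)^T by apply/rowP => j; rewrite !mxE.
  rewrite YE mulmxA (whitened_dot (Bu i) (BS i)) dot_sum.
  by apply: eq_bigr => l _; rewrite mxE.
rewrite !mulr_sumr; apply: eq_bigr => l _.
by rewrite /row_field -/v -/(k q); ring.
Qed.

Let lossE q : loss Sigma theta (X q.1 - k q *: fit (M q.2) (X q.1)) =
  loss Sigma theta (X q.1) - 2 * crossX q + square q.
Proof.
rewrite squareE -[X in loss _ _ X - _ + _]subr0 !(loss_whitened Au AS) mulmx0 subr0.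
rewrite frob2B -scalemxAr frob2Z; congr (_ - 2 * _ + _).
apply: eq_bigr => l _; rewrite [_ l 0]mxE; congr (_ * _).
by rewrite mxE.
Qed.

Let loss0E w : loss Sigma theta (X w) = frob2 (z w).
Proof. by rewrite -[X w]subr0 (loss_whitened Au AS) mulmx0 subr0. Qed.

Let mloss0 : measurable_fun setT (fun w => loss Sigma theta (X w)).
Proof.
under eq_fun do rewrite loss0E; apply: measurable_frob2.
exact: measurable_sample_col.
Qed.

Let mcrossX : measurable_fun setT crossX.
Proof.
apply: measurable_sum => l; apply: measurable_funM.
  exact: measurableT_comp.
exact: measurable_X_field.
Qed.

Let msquare : measurable_fun setT square.
Proof.
apply: measurable_sum => i; apply: measurable_sum => l; apply: measurable_funM.
  exact: measurableT_comp.
exact: measurable_row_field.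
Qed.

Let mF : measurable_fun setT F.
Proof. by apply: measurable_frob2; exact: measurable_ridge_coef. Qed.

Let mu_ : measurable_fun setT u.
Proof.
apply: measurable_funM => //; apply: measurable_mxtrace.
exact: measurable_ridge_inv.
Qed.

Let mal : measurable_fun setT al.
Proof.
apply: measurable_funM => //; apply: measurable_fun_entry.
apply: measurable_mulmx; last exact: measurable_ridge_coef.
apply: measurable_mulmx; last exact: measurable_ridge_inv.
by apply: measurable_trmx; exact: measurable_ridge_coef.
Qed.

Let mk : measurable_fun setT k.
Proof. exact: measurable_shrink. Qed.

Let mdk : measurable_fun setT dk.
Proof. exact: measurableT_comp. Qed.

Let mdivX : measurable_fun setT divX.
Proof.
apply: measurable_funD; apply: measurable_funM => //.
- exact: measurable_funM.
- exact: measurable_funB.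
- exact: measurable_funB.
Qed.

Let mdivY : measurable_fun setT divY.
Proof.
apply: measurable_funD; apply: measurable_funM => //.
- by apply: measurable_funM => //; exact: measurable_funM.
- apply: measurable_funB; last exact: measurable_funX.
  by apply: measurable_funM => //; exact: measurable_funM.
- exact: measurable_funX.
- apply: measurable_funD; last exact: measurable_funM.
  apply: measurable_funD; last exact: measurable_funM.
  apply: measurable_funB => //; apply: measurable_funM => //.
  exact: measurable_funM.
Qed.

Let u_bounds q : 0 <= u q <= n%:R.
Proof.
by rewrite mulr_ge0 ?tr_ridge_ge0 ?(ltW eps0)//= tr_ridge_le.
Qed.

Let al_bounds q : 0 <= al q <= u q * F q.
Proof.
have /andP[h1 h2] := ridge_form_bounds (M q.2) eps0 (coef (M q.2) (X q.1)).
by rewrite mulr_ge0 ?(ltW eps0)//= /u -mulrA ler_pM2l.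
Qed.

Let F_ge0 q : 0 <= F q. Proof. exact: frob2_ge0. Qed.

Let square_ge0 q : 0 <= square q.
Proof. by rewrite squareE mulr_ge0 ?sqr_ge0 ?frob2_ge0. Qed.

Let cross_le q : `|2 * crossX q| <= loss Sigma theta (X q.1) + square q.
Proof.
have h1 : 0 <= loss Sigma theta (X q.1) - 2 * crossX q + square q.
  by rewrite -lossE (loss_whitened Au AS) frob2_ge0.
have h2 : 0 <= loss Sigma theta (X q.1) + 2 * crossX q + square q.
  have := frob2_ge0 (z q.1 + invmx A *m (k q *: fit (M q.2) (X q.1))).
  rewrite frob2D_dot -scalemxAr frob2Z -squareE -loss0E.
  congr (_ <= _ + 2 * _ + _); apply: eq_bigr => l _.
  by rewrite [z _ _ _]mxE [X in _ * X]mxE.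
by rewrite ler_norml; apply/andP; split; lra.
Qed.

Let square_le q :
  square q <= c ^+ 2 * (frob2 (invmx A) *
    (n%:R * (2 * (frob2 theta + frob2 A * loss Sigma theta (X q.1))))).
Proof.
rewrite squareE loss0E ridge_fit_hat.
have kc : k q ^+ 2 <= c ^+ 2.
  have := weight_le (F_ge0 q) (kappa_le (F_ge0 q)); rewrite -/(k q) => kc.
  rewrite -(real_normK (num_real (k q))) ler_pXn2r// nnegrE//.
  exact: le_trans kc.
rewrite ler_pM ?sqr_ge0 ?frob2_ge0//.
apply: (le_trans (frob2M _ _)); rewrite ler_wpM2l ?frob2_ge0//.
apply: (le_trans (frob2M _ _)); rewrite ler_pM ?frob2_ge0 ?frob2_hat_le//.
apply: (le_trans (frob2D _ _)); rewrite ler_wpM2l// lerD2l.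
exact: frob2M.
Qed.

Hypothesis loss0_fin : (\int[P]_w (loss Sigma theta (X w))%:E < +oo)%E.

Let PQ := (P \x Q)%E.

Let intQ_cst (r : \bar R) : (\int[Q]_y r = r)%E.
Proof.
by rewrite (_ : (fun=> r) = cst r)// integral_cst//= probability_setT mule1.
Qed.

Let PQ_bounded (f : T * T' -> R) (C : R) : measurable_fun setT f ->
  (forall q, `|f q| <= C) -> PQ.-integrable setT (fun q => (f q)%:E).
Proof. exact: (@integrable_bounded _ _ _ (P \x Q)%E). Qed.

Let iloss : PQ.-integrable setT (fun q => (loss Sigma theta (X q.1))%:E).
Proof.
have l0 w : 0 <= loss Sigma theta (X w) by rewrite loss0E frob2_ge0.
have ml : measurable_fun setT (fun q : T * T' => (loss Sigma theta (X q.1))%:E).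
  by apply/measurable_EFinP; exact: (measurableT_comp mloss0).
apply/integrableP; split => //.
under eq_integral => q _ do rewrite /= ger0_norm//.
rewrite /PQ fubini_tonelli1//; last by move=> q; rewrite lee_fin.
rewrite /fubini_F.
under eq_integral => w _ do rewrite /= intQ_cst.
exact: loss0_fin.
Qed.

Let isquare : PQ.-integrable setT (fun q => (square q)%:E).
Proof.
pose b (q : T * T') : R := c ^+ 2 * (frob2 (invmx A) *
    (n%:R * (2 * (frob2 theta + frob2 A * loss Sigma theta (X q.1))))).
have ib : PQ.-integrable setT (fun q => (b q)%:E).
  pose c1 := c ^+ 2 * (frob2 (invmx A) * (n%:R * 2)).
  rewrite (_ : (fun q => _) = fun q => ((c1 * frob2 theta)%:E +
      (c1 * frob2 A)%:E * (loss Sigma theta (X q.1))%:E)%E); last first.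
    by apply/funext => q; rewrite -EFinM -EFinD /b /c1; congr EFin; ring.
  apply: integrableD => //; last exact: integrableZl.
  exact: (PQ_bounded (C := `|c1 * frob2 theta|)).
apply: (le_integrable measurableT _ _ ib); first exact/measurable_EFinP.
move=> q _; rewrite /= lee_fin (ger0_norm (square_ge0 q)).
by rewrite (le_trans (square_le q))// ler_norm.
Qed.

Let icross : PQ.-integrable setT (fun q => (2 * crossX q)%:E).
Proof.
have ib : PQ.-integrable setT
    (fun q => (loss Sigma theta (X q.1))%:E + (square q)%:E)%E.
  exact: integrableD.
apply: (le_integrable measurableT _ _ ib).
  by apply/measurable_EFinP; exact: measurable_funM.
by move=> q _; rewrite -EFinD /= lee_fin (le_trans (cross_le q))// ler_norm.
Qed.

Let icrossX : PQ.-integrable setT (fun q => (crossX q)%:E).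
Proof.
apply: (le_integrable measurableT _ _ icross); first exact/measurable_EFinP.
by move=> q _; rewrite /= lee_fin normrM normr_nat ler_peMl// ler1n.
Qed.

Let kappa_q q : `|k q| * (1 + F q) <= c. Proof. exact: (kappa_le (F_ge0 q)). Qed.
Let dkappa_q q : `|dk q| * (1 + F q) <= c. Proof. exact: (dkappa_le (F_ge0 q)). Qed.

Let idivX : PQ.-integrable setT (fun q => (divX q)%:E).
Proof.
apply: PQ_bounded => // q.
exact: (X_divergence_bound (ler0n _ n) (F_ge0 q) (u_bounds q) (al_bounds q)
  (kappa_q q) (dkappa_q q)).
Qed.

Let idivY : PQ.-integrable setT (fun q => (divY q)%:E).
Proof.
apply: PQ_bounded => // q.
exact: (row_divergence_bound (p%:R - n%:R) (ler0n _ n) (F_ge0 q) (u_bounds q)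
  (al_bounds q) (kappa_q q) (dkappa_q q)).
Qed.

Let int_cross : (\int[PQ]_q (crossX q)%:E = \int[PQ]_q (divX q)%:E)%E.
Proof.
rewrite /PQ -(integral21_prod_meas1 icrossX) -(integral21_prod_meas1 idivX).
apply: eq_integral => w' _; rewrite /fubini_G.
have [_ _] := X_stein eps0 kappaE kappa_le dkappa_le mkappa theta (M w') stdZ Au.
by [].
Qed.

Let int_square : (\int[PQ]_q (square q)%:E = \int[PQ]_q (divY q)%:E)%E.
Proof.
rewrite /PQ -(integral12_prod_meas1 isquare) -(integral12_prod_meas1 idivY).
apply: eq_integral => w _; rewrite /fubini_F.
have [_ _ ->] := row_stein eps0 kappaE kappa_le dkappa_le mkappa (X w)
  indepY Bu stdW YE.
apply: eq_integral => w' _; congr EFin.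
rewrite /divY /F /u /al /k /dk /=; ring.
Qed.

(** The cross term is integrated by parts in [X] for fixed rows and the square in
the rows for fixed [X]; [divergence_difference] then compares the two
divergences pointwise. *)
Lemma ridge_risk_le :
  (\int[PQ]_q (loss Sigma theta (X q.1 - k q *: fit (M q.2) (X q.1)))%:E <=
   \int[P]_w (loss Sigma theta (X w))%:E +
   \int[PQ]_q ((6 * c + 12 * c ^+ 2) * u q)%:E)%E.
Proof.
have iu : PQ.-integrable setT (fun q => ((6 * c + 12 * c ^+ 2) * u q)%:E).
  apply: (PQ_bounded (C := `|6 * c + 12 * c ^+ 2| * n%:R)).
    exact: measurable_funM.
  move=> q; rewrite normrM ler_wpM2l//; have /andP[u0 un] := u_bounds q.
  by rewrite ger0_norm.
have idivX2 : PQ.-integrable setT (fun q => (2 * divX q)%:E).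
  rewrite (_ : (fun q => _) = fun q => (2%:E * (divX q)%:E)%E)//.
  exact: integrableZl.
under eq_integral do rewrite lossE.
have -> : (\int[PQ]_q (loss Sigma theta (X q.1) - 2 * crossX q + square q)%:E =
  \int[PQ]_q (loss Sigma theta (X q.1))%:E +
  \int[PQ]_q (divY q - 2 * divX q)%:E)%E.
  under eq_integral do rewrite EFinD EFinB.
  rewrite integralD//; last exact: integrableB.
  rewrite integralB// int_square.
  have -> : (\int[PQ]_q (2 * crossX q)%:E = \int[PQ]_q (2 * divX q)%:E)%E.
    under eq_integral do rewrite EFinM.
    under [RHS]eq_integral do rewrite EFinM.
    by rewrite !integralZl// int_cross.
  under [X in _ = (_ + X)%E]eq_integral do rewrite EFinB.
  rewrite [X in _ = (_ + X)%E]integralB//.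
  by rewrite -addeA (addeC (- _)%E).
have -> : (\int[PQ]_q (loss Sigma theta (X q.1))%:E =
    \int[P]_w (loss Sigma theta (X w))%:E)%E.
  rewrite /PQ -(integral12_prod_meas1 iloss) /fubini_F.
  by under eq_integral => w _ do rewrite /= intQ_cst.
rewrite leeD2l//; apply: le_integral => //.
  rewrite (_ : (fun q => _) = fun q => ((divY q)%:E - (2 * divX q)%:E)%E)//.
  exact: integrableB.
move=> q _; rewrite lee_fin /divX /divY.
exact: (divergence_difference (ler0n _ n) (F_ge0 q) (u_bounds q) (al_bounds q)
  (kappa_q q) (dkappa_q q) (main_le0 (F_ge0 q))).
Qed.

End ridge_risk.

(** * Almost sure full rank of the Gaussian rows *)

Section null_events.
Context {R : realType} {d d' : measure_display} {T : measurableType d}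
  {T' : measurableType d'} (P : probability T R) (n : nat)
  (Z : 'I_n -> {RV P >-> T'}).
Hypothesis indepZ : mutual_indep_RV Z.

(** An event is negligible if, for almost every value of the other members,
redrawing member [i] almost surely avoids it. *)
Lemma resample_null (i : 'I_n) (B : set (n.-tuple T')) : measurable B ->
  {ae P, forall w, P [set v | B (resample Z i (w, v))] = 0%E} ->
  P [set w | B (sample_tuple Z w)] = 0%E.
Proof.
move=> mB hB.
have mI : measurable_fun setT (fun t => (\1_B t)%:E : \bar R).
  by apply/measurable_EFinP; exact: measurable_indic.
have mS : measurable [set w | B (sample_tuple Z w)].
  rewrite -[X in measurable X]setTI.
  exact: (measurable_sample_tuple Z measurableT mB).
have mBv w : measurable [set v | B (resample Z i (w, v))].
  have h : measurable_fun setT (fun v => resample Z i (w, v)).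
    exact: measurableT_comp (measurable_resample Z i) (pair1_measurable w).
  by rewrite -[X in measurable X]setTI; exact: (h measurableT _ mB).
have eI (g : T -> n.-tuple T') : measurable [set w | B (g w)] ->
    (\int[P]_w (\1_B (g w))%:E = P [set w | B (g w)])%E.
  by move=> mg; rewrite -[X in P X]setIT -integral_indic.
have I0 t : (0 <= (\1_B t)%:E :> \bar R)%E by rewrite lee_fin.
rewrite -eI// (ge0_integral_resample indepZ i mI I0).
rewrite (ae_eq_integral (cst 0%E))//; first by rewrite integral0.
  exact: (@measurable_fun_fubini_tonelli_F _ _ T T R P
    (fun q => (\1_B (resample Z i q))%:E) (measurableT_comp mI
    (measurable_resample Z i)) (fun q => I0 _)).
move: hB; apply: filterS => w Bw _ /=.
by rewrite (eI (fun v => resample Z i (w, v))).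
Qed.

End null_events.

Section gaussian_null.
Context {R : realType} {d : measure_display} {T : measurableType d}
  (P : probability T R) (p : nat) (Z : 'I_p -> {RV P >-> R}).
Hypothesis stdZ : std_normal_sample Z.

Lemma std_normal_point l (x : R) : P [set v | Z l v = x] = 0%E.
Proof.
have [_ Zn] := stdZ; have mx : measurable [set x] by exact: measurable_set1.
have := Zn l [set x] mx; rewrite /distribution /pushforward => e.
change (P (Z l @^-1` [set x]) = 0%E); rewrite e.
have /null_content_dominatesP := normal_prob_dominates (0 : R) 1.
by apply=> //; exact: lebesgue_measure_set1.
Qed.

(** Conditionally on the other coordinates, a coordinate of nonzero weight would
have to take one prescribed value. *)
Lemma linear_form_null (b : 'cV[R]_p) : b != 0 ->
  P [set w | (b^T *m \col_l Z l w) 0 0 = 0] = 0%E.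
Proof.
move=> b0; have [indepZ _] := stdZ.
have [l bl0] : exists l, b l 0 != 0.
  apply/existsP; apply: contraR b0; rewrite negb_exists => /forallP h.
  by apply/eqP/colP => l; rewrite [RHS]mxE; apply/eqP; have := h l; rewrite negbK.
have -> : [set w | (b^T *m \col_l Z l w) 0 0 = 0] =
    [set w | [set t | (b^T *m col_of_tuple t) 0 0 = 0] (sample_tuple Z w)].
  by apply/seteqP; split=> w /=; rewrite col_of_sample_tuple.
apply: (resample_null indepZ (i := l)).
  have mL : measurable_fun setT (fun t : p.-tuple R => (b^T *m col_of_tuple t) 0 0).
    apply: measurable_fun_entry; apply: measurable_mulmx => //.
    exact: measurable_col_of_tuple.
  rewrite -[X in measurable X]setTI.
  exact: (mL measurableT [set 0] (measurable_set1 0)).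
apply: aeW => w.
pose r := (b^T *m \col_l Z l w) 0 0.
rewrite (_ : [set v | _] = [set v | Z l v = Z l w - r / b l 0]).
  exact: std_normal_point.
have e v : (b^T *m col_of_tuple (resample Z l (w, v))) 0 0 =
    r + (Z l v - Z l w) * b l 0.
  rewrite col_of_resample mulmxDr -scalemxAr -colE.
  by rewrite mxE [X in _ + X]mxE [col _ _ _ _]mxE [b^T _ _]mxE.
apply/seteqP; split=> v /=; rewrite e => h.
  apply: (mulIf bl0); rewrite mulrBl divfK//; lra.
by rewrite h; field.
Qed.

End gaussian_null.

Section almost_sure_full_rank.
Context {R : realType} {d : measure_display} {T : measurableType d}
  (Q : probability T R) (n p : nat) (Y : 'I_n -> {RV Q >-> 'cV[R]_p})
  (B : 'I_n -> 'M[R]_p) (W : 'I_n -> 'I_p -> {RV Q >-> R}).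
Hypotheses (np : (n <= p)%N) (indepY : mutual_indep_RV Y).
Hypotheses (Bu : forall i, B i \in unitmx)
  (stdW : forall i, std_normal_sample (W i))
  (YE : forall i w, Y i w = B i *m \col_l W i l w).

(** Gaussian rows replace the rows of the identity one at a time. Only
[n] columns are used; their invertibility implies full row rank. *)
Definition hybrid (k : nat) (M : 'M[R]_(n, p)) : 'M[R]_n :=
  \matrix_(i, j) if (i < k)%N then M i (widen_ord np j) else (i == j)%:R.

Lemma measurable_hybrid k : measurable_fun setT (hybrid k).
Proof.
apply/measurable_fun_mxP => i j; under eq_fun do rewrite mxE.
case: (i < k)%N; last exact: measurable_cst.
apply: (@measurable_fun_entry _ _ _ _ _ (fun M : 'M[R]_(n, p) => M)).
exact: measurable_id.
Qed.

(** The cofactors of row [i] of the hybrid as a linear form on [R^p], so that the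
determinant is this form at the new row. *)
Definition cofactor_form (i : 'I_n) (M : 'M[R]_(n, p)) : 'cV[R]_p :=
  \sum_j cofactor (hybrid i M) i j *: delta_mx (widen_ord np j) 0.

Lemma cofactor_formE i M (y : 'cV[R]_p) : ((cofactor_form i M)^T *m y) 0 0 =
  \sum_j y (widen_ord np j) 0 * cofactor (hybrid i M) i j.
Proof.
rewrite /cofactor_form linear_sum/= mulmx_suml summxE; apply: eq_bigr => j _.
by rewrite linearZ/= -scalemxAl mxE trmx_delta -rowE mxE mulrC.
Qed.

Lemma det_hybrid_set_row (i : 'I_n) (M : 'M[R]_(n, p)) (y : 'cV[R]_p) :
  \det (hybrid i.+1 (set_row i M y)) = ((cofactor_form i M)^T *m y) 0 0.
Proof.
rewrite cofactor_formE (expand_det_row _ i); apply: eq_bigr => j _.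
rewrite !mxE ltnSn eqxx; congr (_ * _); rewrite /cofactor; congr (_ * \det _).
apply/matrixP => a b; rewrite !mxE eq_sym (negbTE (neq_lift i a)).
by rewrite ltnS leq_eqVlt -val_eqE/= [(bump _ _ == _)%N]eq_sym (negbTE (neq_bump i a)).
Qed.

(** The cofactors of row [i] do not depend on that row. As long as row [i] is a
row of the identity, expanding the determinant along it picks one of them. *)
Lemma cofactor_form_neq0 (i : 'I_n) (M : 'M[R]_(n, p)) :
  \det (hybrid i M) != 0 -> cofactor_form i M != 0.
Proof.
apply: contra => /eqP a0.
rewrite (expand_det_row _ i) (bigD1 i)//= big1 ?addr0; last first.
  by move=> j ji; rewrite mxE ltnn eq_sym (negbTE ji) mul0r.
rewrite mxE ltnn eqxx mul1r.
have := cofactor_formE i M (delta_mx (widen_ord np i) 0).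
rewrite a0 trmx0 mul0mx mxE (bigD1 i)//= big1 ?addr0; last first.
  move=> j ji; rewrite mxE; case: eqVneq => [/(congr1 val)/= /val_inj ji'|_].
    by rewrite ji' eqxx in ji.
  by rewrite mul0r.
by rewrite mxE !eqxx mul1r => <-.
Qed.

(** When the rows other than row [k] are held fixed, the determinant of
[hybrid k.+1] is a linear form in the Gaussian row [k], which is nonzero where
[hybrid k] is invertible. *)
Lemma hybrid_det_null k : (k <= n)%N ->
  Q [set w | \det (hybrid k (rows_mx Y w)) = 0] = 0%E.
Proof.
elim: k => [_|k ih kn].
  rewrite (_ : [set _ | _] = set0) ?measure0//; apply/seteqP; split=> // w /= /eqP.
  rewrite (_ : hybrid _ _ = 1%:M) ?det1 ?oner_eq0//.
  by apply/matrixP => i j; rewrite !mxE.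
(* The induction step redraws row [k] of the Gaussian matrix. *)
pose i := Ordinal kn.
pose C (t : n.-tuple 'cV[R]_p) := \det (hybrid k.+1 (rows_of_tuple t)).
have mC : measurable_fun setT C.
  apply: measurable_det; apply: measurableT_comp; first exact: measurable_hybrid.
  exact: measurable_rows_of_tuple.
have -> : [set w | \det (hybrid k.+1 (rows_mx Y w)) = 0] =
    [set w | [set t | C t = 0] (sample_tuple Y w)].
  by apply/seteqP; split=> w /=; rewrite /C rows_of_sample_tuple.
apply: (resample_null indepY (i := i)).
  rewrite -[X in measurable X]setTI.
  exact: (mC measurableT [set 0] (measurable_set1 0)).
exists [set w | \det (hybrid k (rows_mx Y w)) = 0]; split.
- rewrite -[X in measurable X]setTI.
  have mD : measurable_fun setT (fun w => \det (hybrid k (rows_mx Y w))).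
    apply: measurable_det; apply: measurableT_comp; first exact: measurable_hybrid.
    exact: measurable_rows_mx.
  exact: (mD measurableT [set 0] (measurable_set1 0)).
- exact: ih (ltnW kn).
move=> w /=; apply: contra_notP => /eqP dk0.
have b0 : (B i)^T *m cofactor_form i (rows_mx Y w) != 0.
  apply/eqP => h; have /eqP := @cofactor_form_neq0 i _ dk0; apply.
  by rewrite -[LHS](@mulKmx _ _ _ (B i)^T) ?unitmx_tr// h mulmx0.
rewrite -(linear_form_null (stdW i) b0); congr (Q _); apply/seteqP; split=> v /=;
  rewrite /C rows_of_resample (det_hybrid_set_row i) YE mulmxA;
  by rewrite trmx_mul trmxK.
Qed.

Lemma rows_mx_full_rank :
  {ae Q, forall w, rows_mx Y w *m (rows_mx Y w)^T \in unitmx}.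
Proof.
exists [set w | \det (hybrid n (rows_mx Y w)) = 0]; split.
- rewrite -[X in measurable X]setTI.
  have mD : measurable_fun setT (fun w => \det (hybrid n (rows_mx Y w))).
    apply: measurable_det; apply: measurableT_comp; first exact: measurable_hybrid.
    exact: measurable_rows_mx.
  exact: (mD measurableT [set 0] (measurable_set1 0)).
- exact: hybrid_det_null.
move=> w /=; apply: contra_notP => /eqP; rewrite -unitfE -unitmxE => Hu.
apply: row_free_mul_tr; rewrite -kermx_eq0; apply/eqP/row_matrixP => i.
rewrite row0; set u := row i _.
have u0 : u *m rows_mx Y w = 0 by rewrite /u -row_mul mulmx_ker row0.
(* The full hybrid consists of the first [n] columns. *)
have -> : u = u *m hybrid n (rows_mx Y w) *m invmx (hybrid n (rows_mx Y w)).
  by rewrite mulmxK.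
suff -> : u *m hybrid n (rows_mx Y w) = 0 by rewrite mul0mx.
apply/rowP => j; rewrite [RHS]mxE.
transitivity ((u *m rows_mx Y w) 0 (widen_ord np j)); last by rewrite u0 mxE.
rewrite [LHS]mxE [RHS]mxE; apply: eq_bigr => a _.
by rewrite [hybrid _ _ _ _]mxE ltn_ord.
Qed.

End almost_sure_full_rank.

(** * Vanishing ridge penalty *)

Section cvg_matrix.
Context {R : realType}.

Lemma cvg_real_sum (I : finType) (u : I -> nat -> R) (l : I -> R) :
  (forall i, u i @ \oo --> l i) -> (fun k => \sum_i u i k) @ \oo --> \sum_i l i.
Proof.
move=> ul; elim: (index_enum I) => [|i r ih].
  by rewrite big_nil; under eq_fun do rewrite big_nil; exact: cvg_cst.
by rewrite big_cons; under eq_fun do rewrite big_cons; exact: cvgD.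
Qed.

Definition cvg_mx m n (A_ : nat -> 'M[R]_(m, n)) (A : 'M[R]_(m, n)) :=
  forall i j, (fun k => A_ k i j) @ \oo --> A i j.

Lemma cvg_mx_cst m n (A : 'M[R]_(m, n)) : cvg_mx (fun=> A) A.
Proof. by move=> i j; exact: cvg_cst. Qed.

Lemma cvg_mxB m n (A_ B_ : nat -> 'M[R]_(m, n)) A B :
  cvg_mx A_ A -> cvg_mx B_ B -> cvg_mx (fun k => A_ k - B_ k) (A - B).
Proof.
move=> AA BB i j; rewrite !mxE; under eq_fun do rewrite !mxE.
by apply: cvgB; [exact: AA|exact: BB].
Qed.

Lemma cvg_mxM m n l (A_ : nat -> 'M[R]_(m, n)) (B_ : nat -> 'M[R]_(n, l)) A B :
  cvg_mx A_ A -> cvg_mx B_ B -> cvg_mx (fun k => A_ k *m B_ k) (A *m B).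
Proof.
move=> AA BB i j; rewrite mxE.
under [X in X @ _ --> _]eq_fun do rewrite mxE.
apply: (@cvg_real_sum 'I_n (fun a k => A_ k i a * B_ k a j)) => a.
by apply: cvgM; [exact: AA|exact: BB].
Qed.

Lemma cvg_frob2 m n (A_ : nat -> 'M[R]_(m, n)) A : cvg_mx A_ A ->
  (fun k => frob2 (A_ k)) @ \oo --> frob2 A.
Proof.
move=> AA; apply: (@cvg_real_sum 'I_m (fun i k => \sum_j A_ k i j ^+ 2)) => i.
apply: (@cvg_real_sum 'I_n (fun j k => A_ k i j ^+ 2)) => j.
rewrite expr2; under [X in X @ _ --> _]eq_fun do rewrite expr2.
by apply: cvgM; exact: AA.
Qed.

End cvg_matrix.
Arguments cvg_mx_cst {R m n} A.
Arguments cvg_mxM {R m n l A_ B_ A B}.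

Section ridge_limit.
Context {R : realType} {n p : nat} (Y : 'M[R]_(n, p)).

Definition eps_seq (k : nat) : R := k.+1%:R^-1.

Lemma eps_seq_gt0 k : 0 < eps_seq k. Proof. by rewrite invr_gt0. Qed.
Hint Resolve eps_seq_gt0 : core.

Local Notation N k := (ridge_inv (eps_seq k) Y).

(** [eps N Y Y' = eps (1 - eps N)], where [eps N] is bounded. Only the
product is considered, so that singular [Y Y'] are covered, as [cvg_mp_inverse]
requires. *)
Lemma cvg_eps_ridge_inv m (B : 'M[R]_(n, m)) :
  cvg_mx (fun k => (eps_seq k *: N k) *m (Y *m Y^T *m B)) 0.
Proof.
have e k : (eps_seq k *: N k) *m (Y *m Y^T *m B) =
    eps_seq k *: (B - (eps_seq k *: N k) *m B).
  rewrite -scalemxAl mulmxA ridge_invl// mulmxBl mul1mx.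
  by rewrite -scalemxAl.
move=> i j; rewrite mxE; under eq_fun do rewrite e mxE.
have [C BC] : bounded_mx (fun k => B - (eps_seq k *: N k) *m B).
  apply: bounded_mxD; first exact: bounded_mx_cst.
  apply: bounded_mxN; apply: bounded_mxM (bounded_mx_cst _).
  apply: (@bounded_frob2 _ _ _ _ _ n%:R) => k.
  rewrite frob2Z; have := frob2_N_le Y (eps_seq_gt0 k).
  by rewrite ler_pdivlMr ?exprn_gt0// mulrC.
apply/norm_cvg0P; apply: (@squeeze_cvgr _ _ _ _ (cst 0) (fun k => C * eps_seq k)).
- apply: nearW => k; rewrite normr_ge0/= normrM gtr0_norm// mulrC.
  by rewrite ler_wpM2r// ltW.
- exact: cvg_cst.
- rewrite -[X in _ --> X](mulr0 C); apply: cvgM; first exact: cvg_cst.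
  exact: cvg_harmonic.
Qed.

Hypothesis Yu : Y *m Y^T \in unitmx.

Lemma cvg_eps_ridge_inv0 : cvg_mx (fun k => eps_seq k *: N k) 0.
Proof.
have := cvg_eps_ridge_inv (invmx (Y *m Y^T)); rewrite mulmxV//.
by under eq_fun do rewrite mulmx1.
Qed.

Lemma cvg_ridge_inv : cvg_mx (fun k => N k) (invmx (Y *m Y^T)).
Proof.
have e k : N k = invmx (Y *m Y^T) - (eps_seq k *: N k) *m invmx (Y *m Y^T).
  have := ridge_invl Y (eps_seq_gt0 k) => /(congr1 (mulmx^~ (invmx (Y *m Y^T)))).
  by rewrite mulmxK// mulmxBl mul1mx.
rewrite (_ : (fun k => N k) = fun k =>
  invmx (Y *m Y^T) - (eps_seq k *: N k) *m invmx (Y *m Y^T)); last exact/funext.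
rewrite -[X in cvg_mx _ X]subr0; apply: cvg_mxB; first exact: cvg_mx_cst.
have := cvg_mxM cvg_eps_ridge_inv0 (cvg_mx_cst (invmx (Y *m Y^T))).
by rewrite mul0mx.
Qed.

(** Ordinary least squares: the ridge coefficient without penalty. *)
Definition ols_coef (x : 'cV[R]_p) : 'cV[R]_n := invmx (Y *m Y^T) *m Y *m x.

Lemma cvg_ridge_coef x : cvg_mx (fun k => ridge_coef (eps_seq k) Y x) (ols_coef x).
Proof.
apply: cvg_mxM (cvg_mx_cst _); apply: cvg_mxM (cvg_mx_cst _).
exact: cvg_ridge_inv.
Qed.

Lemma cvg_ridge_fit x :
  cvg_mx (fun k => ridge_fit (eps_seq k) Y x) (Y^T *m ols_coef x).
Proof. by apply: cvg_mxM; [exact: cvg_mx_cst|exact: cvg_ridge_coef]. Qed.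

Lemma cvg_eps_trace : (fun k => eps_seq k * \tr (N k)) @ \oo --> (0 : R).
Proof.
have e : (fun k => eps_seq k * \tr (N k)) = fun k => \sum_i (eps_seq k *: N k) i i.
  by apply/funext => k; rewrite -/(\tr (eps_seq k *: N k)) mxtraceZ.
rewrite e -[X in _ --> X](_ : \sum_(i < n) (0 : 'M[R]_n) i i = 0).
  apply: (@cvg_real_sum R 'I_n (fun i k => (eps_seq k *: N k) i i)) => i.
  exact: cvg_eps_ridge_inv0.
by rewrite big1// => i _; rewrite mxE.
Qed.

End ridge_limit.

(** The Tikhonov approximation [(S' S + eps)^-1 S'] converges to [S^+] even when
[S] is rank deficient, because [S^+] factors through [S' S]. *)
Lemma cvg_mp_inverse {R : realType} m n (S : 'M[R]_(m, n)) :
  cvg_mx (fun k => ridge_inv (eps_seq k) S^T *m S^T) (mp_inverse S).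
Proof.
have [SGS GSG SGt GSt] := mp_inverseP S; set G := mp_inverse S in SGS GSG SGt GSt *.
have e1 : S^T = S^T *m S *m G.
  by rewrite -mulmxA -SGt -trmx_mul SGS.
(* [S^+ = S' (S^+)' S^+] and [S' = S' S S^+]. *)
have e2 : G = S^T *m S *m (G *m G^T *m G).
  by rewrite -{1}GSG -GSt trmx_mul {1}e1 !mulmxA.
have e k : ridge_inv (eps_seq k) S^T *m S^T =
    G - (eps_seq k *: ridge_inv (eps_seq k) S^T) *m (S^T *m S^T^T *m (G *m G^T *m G)).
  have := ridge_invl S^T (eps_seq_gt0 k); rewrite trmxK => h.
  rewrite -e2; transitivity (ridge_inv (eps_seq k) S^T *m (S^T *m S) *m G).
    by rewrite -mulmxA -e1.
  by rewrite h mulmxBl mul1mx.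
rewrite (_ : (fun k => _) = fun k => G - (eps_seq k *: ridge_inv (eps_seq k) S^T) *m
   (S^T *m S^T^T *m (G *m G^T *m G))); last exact/funext.
rewrite -[X in cvg_mx _ X]subr0; apply: cvg_mxB; first exact: cvg_mx_cst.
exact: cvg_eps_ridge_inv.
Qed.

(** The pseudo-inverse is discontinuous where the rank drops, but it is a
pointwise limit of measurable functions. *)
Lemma measurable_mp_inverse {R : realType} m n (d : measure_display)
    (T : measurableType d) (S : T -> 'M[R]_(m, n)) :
  measurable_fun setT S -> measurable_fun setT (fun t => mp_inverse (S t)).
Proof.
move=> mS; apply/measurable_fun_mxP => i j.
apply: (@measurable_fun_cvg _ _ R setT
  (fun k t => (ridge_inv (eps_seq k) (S t)^T *m (S t)^T) i j)).
  move=> k; apply: measurable_fun_entry; apply: measurable_mulmx.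
    apply: measurable_invmx; apply: measurable_addmx => //; apply: measurable_mulmx.
      exact: measurable_trmx.
    by do 2!apply: measurable_trmx.
  exact: measurable_trmx.
by move=> t _; exact: cvg_mp_inverse.
Qed.

(** * Risk of smooth shrinkage estimators *)

(** Fatou's lemma in the form used for risks: an upper bound for the limit
requires no domination of the losses [f_ k]. *)
Lemma fatou_cvg {R : realType} d (T : measurableType d)
    (mu : {measure set T -> \bar R}) (f_ : nat -> T -> R) (f : T -> R)
    (b_ : nat -> \bar R) (b : \bar R) :
  (forall k, measurable_fun setT (f_ k)) -> measurable_fun setT f ->
  (forall k x, 0 <= f_ k x) -> {ae mu, forall x, (fun k => f_ k x) @ \oo --> f x} ->
  (forall k, \int[mu]_x (f_ k x)%:E <= b_ k)%E -> b_ @ \oo --> b ->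
  (\int[mu]_x (f x)%:E <= b)%E.
Proof.
move=> mf_ mf f0 ff fb bb.
have mE k : measurable_fun setT (fun x => (f_ k x)%:E) by exact/measurable_EFinP.
have -> : (\int[mu]_x (f x)%:E =
    \int[mu]_x limn_einf (fun k => (f_ k x)%:E))%E.
  apply: ae_eq_integral => //.
  - exact/measurable_EFinP.
  - apply: (@emeasurable_fun_cvg _ _ _ _ (fun k x => einfs (fun k => (f_ k x)%:E) k)).
      exact: (measurable_fun_einfs mE).
    by move=> x _; rewrite limn_einf_lim; exact: is_cvg_einfs.
  - move: ff; apply: filterS => x fx _.
    by apply/esym; have [] := cvg_limn_einf_sup (cvg_real_ereal fx).
apply: (le_trans (fatou _ measurableT mE (fun k x _ => _))).
  by move=> k x _; rewrite lee_fin.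
rewrite limn_einf_lim; apply: lime_le; first exact: is_cvg_einfs.
apply: nearW => k; rewrite -(cvg_lim _ bb)//; apply: lime_ge.
  by apply/cvg_ex; exists b.
near=> j; apply: le_trans (fb j); apply: ereal_inf_lbound; exists j => //=.
by near: j; exact: nbhs_infty_ge.
Unshelve. all: by end_near.
Qed.

Lemma cvg_loss {R : realType} p (Sigma : 'M[R]_p) theta (a_ : nat -> 'cV[R]_p) a :
  cvg_mx a_ a -> (fun k => loss Sigma theta (a_ k)) @ \oo --> loss Sigma theta a.
Proof.
move=> aa; have ba : cvg_mx (fun k => a_ k - theta) (a - theta).
  by apply: cvg_mxB => //; exact: cvg_mx_cst.
apply: (@cvg_mxM _ _ _ _ (fun k => (a_ k - theta)^T *m invmx Sigma)) => //.
apply: cvg_mxM (cvg_mx_cst _) => i j.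
by rewrite mxE; under eq_fun do rewrite mxE; exact: ba.
Qed.

Section smooth_risk.
Context {R : realType} {n p : nat}.
Variables (kappa dkappa : R -> R) (c : R).
Hypothesis kappaE : forall s : R, 0 <= s -> is_derive s 1 kappa (dkappa s).
Hypothesis kappa_le : forall s : R, 0 <= s -> `|kappa s| * (1 + s) <= c.
Hypothesis dkappa_le : forall s : R, 0 <= s -> `|dkappa s| * (1 + s) <= c.
Hypothesis mkappa : measurable_fun setT kappa.
Hypothesis mdkappa : measurable_fun setT dkappa.
Hypothesis main_le0 : forall s : R, 0 <= s ->
  - (2 * n%:R * kappa s) - 4 * dkappa s * s +
  (p%:R - n%:R - 1) * kappa s ^+ 2 * s - 4 * kappa s * dkappa s * s ^+ 2 <= 0.

Context {d : measure_display} {T : measurableType d} (P : probability T R)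
  (Z : 'I_p -> {RV P >-> R}) (A : 'M[R]_p) (theta : 'cV[R]_p) (Sigma : 'M[R]_p).
Hypotheses (stdZ : std_normal_sample Z) (Au : A \in unitmx) (AS : A *m A^T = Sigma).
Context {d' : measure_display} {T' : measurableType d'} (Q : probability T' R)
  (Y : 'I_n -> {RV Q >-> 'cV[R]_p}) (B : 'I_n -> 'M[R]_p)
  (W : 'I_n -> 'I_p -> {RV Q >-> R}).
Hypotheses (np : (n <= p)%N) (indepY : mutual_indep_RV Y) (Bu : forall i, B i \in unitmx)
  (stdW : forall i, std_normal_sample (W i)) (BS : forall i, B i *m (B i)^T = Sigma)
  (YE : forall i w, Y i w = B i *m \col_l W i l w).

Let X w := theta + A *m \col_l Z l w.
Let M w := rows_mx Y w.
Let PQ : probability (T * T')%type R := (P \x Q)%E.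
Hint Resolve eps_seq_gt0 : core.

(** At full row rank this is [x - kappa(x' S^+ x) S S^+ x] for [S = M' M]; see
[delta_r_full_rank]. *)
Definition shrunk_estimate (kap : R -> R) (M : 'M[R]_(n, p)) (x : 'cV[R]_p) : 'cV[R]_p :=
  x - kap (frob2 (ols_coef M x)) *: (M^T *m ols_coef M x).

Lemma loss_ge0 a : 0 <= loss Sigma theta a.
Proof. by rewrite /loss (whitened_norm Au AS) frob2_ge0. Qed.

Lemma ae_full_rank : {ae PQ, forall q, M q.2 *m (M q.2)^T \in unitmx}.
Proof.
have [N [mN N0 sub]] := rows_mx_full_rank np indepY Bu stdW YE.
exists (setT `*` N); split.
- exact: measurableX.
- change ((P \x Q)%E (setT `*` N) = 0%E).
  rewrite product_measure1E//; change (P setT * Q N = 0)%E.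
  by rewrite N0 mule0.
- by move=> [w w'] /= h; split => //; apply: sub.
Qed.

Let mX1 : measurable_fun setT (fun q : T * T' => X q.1).
Proof.
apply: measurable_addmx => //; apply: measurable_mulmx => //.
by apply: (measurableT_comp (measurable_sample_col Z)).
Qed.

Let mM2 : measurable_fun setT (fun q : T * T' => M q.2).
Proof. exact: (measurableT_comp (measurable_rows_mx Y)). Qed.

Lemma measurable_loss d0 (T0 : measurableType d0) (a : T0 -> 'cV[R]_p) :
  measurable_fun setT a -> measurable_fun setT (fun t => loss Sigma theta (a t)).
Proof.
move=> ma; have mb : measurable_fun setT (fun t => a t - theta).
  exact: measurable_addmx.
apply: measurable_fun_entry; apply: measurable_mulmx => //.
by apply: measurable_mulmx => //; exact: measurable_trmx.
Qed.

Lemma measurable_ols_coef d0 (T0 : measurableType d0) (Mt : T0 -> 'M[R]_(n, p))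
    (x : T0 -> 'cV[R]_p) : measurable_fun setT Mt -> measurable_fun setT x ->
  measurable_fun setT (fun t => ols_coef (Mt t) (x t)).
Proof.
move=> mMt mx; apply: measurable_mulmx => //; apply: measurable_mulmx => //.
by apply: measurable_invmx; apply: measurable_mulmx => //; exact: measurable_trmx.
Qed.

Lemma measurable_shrunk_estimate kap d0 (T0 : measurableType d0)
    (Mt : T0 -> 'M[R]_(n, p)) (x : T0 -> 'cV[R]_p) :
  measurable_fun setT kap -> measurable_fun setT Mt -> measurable_fun setT x ->
  measurable_fun setT (fun t => shrunk_estimate kap (Mt t) (x t)).
Proof.
move=> mkap mMt mx; have mo := measurable_ols_coef mMt mx.
apply: measurable_addmx => //; apply: measurable_oppmx.
apply: measurable_scalemx.
  by apply: measurableT_comp => //; exact: measurable_frob2.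
by apply: measurable_mulmx => //; exact: measurable_trmx.
Qed.

Hypothesis loss0_fin : (\int[P]_w (loss Sigma theta (X w))%:E < +oo)%E.

(** The error terms of [ridge_risk_le] vanish in the limit by dominated
convergence. *)
Lemma smooth_risk_le :
  (\int[PQ]_q (loss Sigma theta (shrunk_estimate kappa (M q.2) (X q.1)))%:E <=
   \int[P]_w (loss Sigma theta (X w))%:E)%E.
Proof.
pose f_ k (q : T * T') := loss Sigma theta (X q.1 -
  shrink (eps_seq k) kappa (M q.2) (X q.1) *: ridge_fit (eps_seq k) (M q.2) (X q.1)).
pose u_ k (q : T * T') := (6 * c + 12 * c ^+ 2) *
  (eps_seq k * \tr (ridge_inv (eps_seq k) (M q.2))).
apply: (@fatou_cvg _ _ _ PQ f_ _ (fun k => \int[P]_w (loss Sigma theta (X w))%:E +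
    \int[PQ]_q (u_ k q)%:E)%E).
- move=> k; apply: measurable_loss; apply: measurable_addmx => //.
  apply: measurable_oppmx; apply: measurable_scalemx; first exact: measurable_shrink.
  exact: measurable_ridge_fit.
- by apply: measurable_loss; exact: measurable_shrunk_estimate.
- by move=> k q; exact: loss_ge0.
- move: ae_full_rank; apply: filterS => q Mu.
  have cF := cvg_frob2 (@cvg_ridge_coef _ _ _ _ Mu (X q.1)).
  have ck : (fun k => shrink (eps_seq k) kappa (M q.2) (X q.1)) @ \oo -->
      kappa (frob2 (ols_coef (M q.2) (X q.1))).
    have kc : {for frob2 (ols_coef (M q.2) (X q.1)), continuous kappa}.
      apply: differentiable_continuous; apply/derivable1_diffP.
      by have [] := kappaE (frob2_ge0 (ols_coef (M q.2) (X q.1))).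
    exact: (cvg_comp _ _ cF kc).
  have cv := @cvg_ridge_fit _ _ _ _ Mu (X q.1).
  apply: cvg_loss; apply: cvg_mxB; first exact: cvg_mx_cst.
  move=> i j; rewrite mxE; under [X in X @ _ --> _]eq_fun do rewrite mxE.
  by apply: cvgM => //; exact: cv.
- move=> k; exact: (ridge_risk_le (eps_seq_gt0 k) kappaE kappa_le dkappa_le mkappa
    mdkappa main_le0 stdZ Au AS indepY Bu stdW BS YE loss0_fin).
rewrite -[X in _ --> X]adde0; apply: cvgeD => //.
- by rewrite fin_num_adde_defl.
- exact: cvg_cst.
rewrite -(integral0 PQ setT).
have [] // := @dominated_convergence _ _ R PQ setT measurableT
  (fun k q => (u_ k q)%:E) (cst 0%E) (cst (`|6 * c + 12 * c ^+ 2| * n%:R)%:E).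
- move=> k; apply/measurable_EFinP; apply: measurable_funM => //.
  apply: measurable_funM => //; apply: measurable_mxtrace.
  exact: measurable_ridge_inv.
- move: ae_full_rank; apply: filterS => q Mu _; apply: cvg_real_ereal.
  rewrite -[X in _ --> X](mulr0 (6 * c + 12 * c ^+ 2)).
  by apply: cvgM; [exact: cvg_cst|exact: cvg_eps_trace].
- exact: finite_measure_integrable_cst.
- apply: aeW => q k _; rewrite /= lee_fin normrM ler_wpM2l//.
  rewrite ger0_norm; first exact: tr_ridge_le.
  by apply: mulr_ge0; [exact: (ltW (eps_seq_gt0 k))|exact: (tr_ridge_ge0 _ (eps_seq_gt0 k))].
Qed.

End smooth_risk.

(** * Smooth approximation of the shrinkage profile *)

(** A primitive is needed on the positive half line and slightly to the left
of [0] only, so the integral starts at [-1]. Monotonicity gives measurability on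
the whole line. *)
Lemma exists_primitive {R : realType} (r : R -> R) :
  (forall x : R, derivable r x 1) -> (forall x, 0 <= r x) ->
  exists G : R -> R, {homo G : x y / x <= y} /\
    forall s : R, -1 < s -> is_derive s 1 G (r s).
Proof.
move=> dr r0.
have cr : continuous r.
  by move=> x; apply: differentiable_continuous; apply/derivable1_diffP.
have ir (b : R) : (@lebesgue_measure R).-integrable `[-1, b] (EFin \o r).
  apply: continuous_compact_integrable; first exact: segment_compact.
  exact: continuous_subspaceT.
exists (fun x => (\int[@lebesgue_measure R]_(t in `[-1, x]) r t)); split.
  move=> x y xy; rewrite /Rintegral fine_le//.
  - exact: (integrable_fin_num _ (ir x)).
  - exact: (integrable_fin_num _ (ir y)).
  - apply: ge0_subset_integral => //.
    + by have /integrableP[] := ir y.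
    + by move=> t _; rewrite lee_fin.
    + by move=> t/=; rewrite !in_itv/= => /andP[-> /le_trans]; apply.
move=> s s1.
have ss : s < s + 1 by rewrite ltrDl.
have [dG <-] := continuous_FTC1_closed ss (ir _) s1 (cr s).
by split => //; rewrite derive1E.
Qed.

Section smooth_profile.
Context {R : realType} (r G : R -> R) (C : R).
Hypotheses (r_homo : {homo r : x y / x <= y})
  (r_ge0 : forall x, 0 <= r x) (r_le : forall x, r x <= C)
  (G_homo : {homo G : x y / x <= y})
  (dG : forall s : R, -1 < s -> is_derive s 1 G (r s)).

Variable delta : R.
Hypotheses (d0 : 0 < delta) (d1 : delta <= 1).

(** The mean of [r] over [[s, s + delta]] when [G] is a primitive of [r]: it
inherits monotonicity and bounds from [r], and its derivative is bounded. *)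
Definition mean_value (s : R) := (G (s + delta) - G s) / delta.
Definition dmean_value (s : R) := (r (s + delta) - r s) / delta.
(** A bounded substitute for [r s / s]. *)
Definition profile (s : R) := mean_value s / (s + delta).
Definition dprofile (s : R) :=
  dmean_value s / (s + delta) - mean_value s / (s + delta) ^+ 2.

Lemma mean_value_bounds (s : R) : 0 <= s -> r s <= mean_value s <= r (s + delta).
Proof.
move=> s0; have h := d0.
have sd : s < s + delta by rewrite ltrDl.
have dG' x : x \in `]s, (s + delta)[ -> is_derive x 1 G (r x).
  by rewrite in_itv/= => /andP[sx _]; apply: dG; lra.
have [|c] := MVT sd dG'.
  apply: derivable_within_continuous => x; rewrite in_itv/= => /andP[sx _].
  have x1 : -1 < x by lra.
  by have [] := dG x1.
rewrite in_itv/= => /andP[/ltW sc /ltW cs] e.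
rewrite /mean_value e (addrC s) addrK mulfK ?gt_eqF//.
by rewrite !r_homo// addrC.
Qed.

Lemma mean_value_ge0 (s : R) : 0 <= s -> 0 <= mean_value s.
Proof. by move=> /mean_value_bounds/andP[h _]; exact: le_trans (r_ge0 s) h. Qed.

Lemma mean_value_le (s : R) : 0 <= s -> mean_value s <= C.
Proof. by move=> /mean_value_bounds/andP[_ h]; exact: le_trans h (r_le _). Qed.

Lemma dmean_value_ge0 (s : R) : 0 <= dmean_value s.
Proof.
apply: divr_ge0; last exact: ltW.
by rewrite subr_ge0; apply: r_homo; rewrite lerDl; exact: ltW.
Qed.

Lemma dmean_value_le (s : R) : dmean_value s <= C / delta.
Proof.
rewrite ler_pM2r ?invr_gt0//; have := r_le (s + delta); have := r_ge0 s; lra.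
Qed.

Lemma is_derive_mean_value (s : R) : 0 <= s -> is_derive s 1 mean_value (dmean_value s).
Proof.
move=> s0; have h := d0.
have s1 : -1 < s by lra.
have sd1 : -1 < s + delta by lra.
have D1 := dG s1; have D2 := dG sd1.
have D3 : is_derive s 1 (G \o shift delta) (r (s + delta)).
  by apply: is_derive_eq; rewrite addr0 mulr1.
rewrite (_ : mean_value =
    (delta^-1 : R) \*: ((G \o shift delta) - G)).
  by apply: is_derive_eq; rewrite /dmean_value mulrC.
by apply/funext => x; rewrite !fctE [RHS]mulrC.
Qed.

Lemma is_derive_profile (s : R) : 0 <= s -> is_derive s 1 profile (dprofile s).
Proof.
move=> s0; have sd : 0 < s + delta by rewrite ltr_wpDl.
have D1 := is_derive_mean_value s0.
have D2 : is_derive s 1 (fun x : R => (x + delta)^-1) (- (s + delta) ^- 2).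
  have D : is_derive s 1 (shift delta : R -> R) 1 by exact: is_derive_shift.
  have := @is_deriveV R (shift delta) s 1 1 (lt0r_neq0 sd) D.
  by move=> /is_derive_eq; apply; rewrite scaler1.
have := is_deriveM D1 D2; move=> /is_derive_eq; apply.
by rewrite /dprofile /GRing.scale/=; ring.
Qed.

(** The assumption [delta <= 1] gives [s <= s / delta]. *)
Lemma inv_shift_bound (s : R) : 0 <= s -> (s + delta)^-1 * (1 + s) <= delta^-1.
Proof.
move=> s0; have h0 := d0; have h1 := d1.
have sd : 0 < s + delta by rewrite ltr_wpDl.
by rewrite mulrC ler_pdivrMr// mulrC ler_pdivlMr//; nra.
Qed.

Lemma profile_bound (s : R) : 0 <= s -> `|profile s| * (1 + s) <= C / delta.
Proof.
move=> s0; have sd : 0 < s + delta by rewrite ltr_wpDl.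
have v0 : 0 <= (s + delta)^-1 by rewrite invr_ge0 ltW.
rewrite /profile ger0_norm; last by apply: mulr_ge0 => //; exact: mean_value_ge0.
rewrite -mulrA; apply: ler_pM.
- exact: mean_value_ge0.
- by apply: mulr_ge0 => //; rewrite addr_ge0.
- exact: mean_value_le.
- exact: inv_shift_bound.
Qed.

Lemma dprofile_bound (s : R) : 0 <= s -> `|dprofile s| * (1 + s) <= 2 * C / delta ^+ 2.
Proof.
move=> s0; have sd : 0 < s + delta by rewrite ltr_wpDl.
have C0 : 0 <= C := le_trans (r_ge0 0) (r_le 0).
have h0 := d0; have h1 := d1.
have v1 : (s + delta)^-1 <= delta^-1 by rewrite lef_pV2// lerDr.
have v2 := inv_shift_bound s0.
have q0 := mean_value_ge0 s0; have qC := mean_value_le s0.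
have t0 := dmean_value_ge0 s; have tC := dmean_value_le s.
rewrite /dprofile -exprVn; set v := (s + delta)^-1 in v1 v2 *.
have v0 : 0 <= v by rewrite invr_ge0 ltW.
set q := mean_value s in q0 qC *; set t := dmean_value s in t0 tC *.
have i0 : 0 < delta^-1 by rewrite invr_gt0.
apply: (@le_trans _ _ ((t * v + q * v ^+ 2) * (1 + s))).
  rewrite ler_wpM2r ?addr_ge0//; apply: le_trans (ler_normB _ _) _.
  have q1 : 0 <= q * v ^+ 2 by apply: mulr_ge0 => //; exact: sqr_ge0.
  have t1 : 0 <= t * v by exact: mulr_ge0.
  by rewrite !ger0_norm.
have -> : (t * v + q * v ^+ 2) * (1 + s) = t * (v * (1 + s)) + q * (v * (v * (1 + s))).
  by ring.
have -> : 2 * C / delta ^+ 2 = C / delta * delta^-1 + C * (delta^-1 * delta^-1).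
  by field; rewrite gt_eqF.
have w0 : 0 <= v * (1 + s) by rewrite mulr_ge0 ?addr_ge0.
apply: lerD; first exact: ler_pM.
by apply: ler_pM => //; [exact: mulr_ge0|exact: ler_pM].
Qed.

(** With [rho = s * profile s] the left-hand side is
[profile * (- 2 (n - 2) + (p - n + 3) rho) - 4 rho' (1 + rho)]. The shift by
[delta] in the denominator keeps [rho <= C], and keeps [rho] nondecreasing
because [s / (s + delta)] and the mean of [r] both increase. *)
Lemma profile_main_le0 (n p : nat) (s : R) : (n < p)%N -> 0 <= s ->
  C = 2 * (n%:R - 2) / (p%:R - n%:R + 3) ->
  - (2 * n%:R * profile s) - 4 * dprofile s * s +
  (p%:R - n%:R - 1) * profile s ^+ 2 * s - 4 * profile s * dprofile s * s ^+ 2 <= 0.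
Proof.
move=> np s0 CE; have sd : 0 < s + delta by rewrite ltr_wpDl.
have q0 := mean_value_ge0 s0; have qC := mean_value_le s0.
have t0 := dmean_value_ge0 s.
rewrite /dprofile /profile -exprVn.
have := mulVf (lt0r_neq0 sd); set v := (s + delta)^-1 => vE.
have v0 : 0 <= v by rewrite invr_ge0 ltW.
set q := mean_value s in q0 qC *; set t := dmean_value s in t0 *.
pose rho := q * (v * s).
pose rho' := t * (v * s) + q * (v * v * delta).
have h0 := d0.
have vs1 : v * s <= 1 by nra.
have vs0 : 0 <= v * s by rewrite mulr_ge0.
have rho0 : 0 <= rho by rewrite mulr_ge0.
have rho'0 : 0 <= rho'.
  have d2 := ltW h0.
  by apply: addr_ge0; apply: mulr_ge0 => //; apply: mulr_ge0 => //; apply: mulr_ge0.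
have rhoC : rho <= C by apply: le_trans qC; rewrite /rho; nra.
have D0 : 0 < p%:R - n%:R + 3 :> R.
  have : n%:R <= p%:R :> R by rewrite ler_nat ltnW.
  by lra.
(* The value of [C] is the one that makes this factor nonpositive. *)
have mainC : - (2 * (n%:R - 2)) + (p%:R - n%:R + 3) * rho <= 0.
  by move: rhoC; rewrite CE ler_pdivlMr//; lra.
have k0 : 0 <= q * v by rewrite mulr_ge0.
have := mulr_ge0_le0 k0 mainC; have : 0 <= rho' * (1 + rho).
  by rewrite mulr_ge0// addr_ge0.
suff -> : - (2 * n%:R * (q * v)) - 4 * (t * v - q * v ^+ 2) * s +
  (p%:R - n%:R - 1) * (q * v) ^+ 2 * s - 4 * (q * v) * (t * v - q * v ^+ 2) * s ^+ 2 =
  q * v * (- (2 * (n%:R - 2)) + (p%:R - n%:R + 3) * rho) - 4 * (rho' * (1 + rho)).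
  by move=> *; lra.
(* [rho'] is the derivative of [rho], in a form whose terms are nonnegative;
   this is the form given by the product rule. *)
have rho'E : rho' = q * v + (t * v - q * v ^+ 2) * s.
  rewrite /rho'; have -> : v * v * delta = v * (1 - v * s).
    by rewrite -vE; ring.
  by ring.
by rewrite rho'E /rho; ring.
Qed.

Lemma measurable_mean_value : measurable_fun setT mean_value.
Proof.
have mG : measurable_fun setT G by exact: nondecreasing_measurable.
apply: measurable_funM => //; apply: measurable_funB => //.
by apply: (measurableT_comp mG); exact: measurable_funD.
Qed.

Lemma measurable_inv_shift : measurable_fun setT (fun s : R => (s + delta)^-1).
Proof. by apply: measurable_funV; exact: measurable_funD. Qed.

Lemma measurable_profile : measurable_fun setT profile.
Proof.
exact: measurable_funM measurable_mean_value measurable_inv_shift.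
Qed.

Lemma measurable_dprofile : measurable_fun setT dprofile.
Proof.
have mr : measurable_fun setT r by exact: nondecreasing_measurable.
apply: measurable_funB.
  apply: measurable_funM measurable_inv_shift.
  apply: measurable_funM => //; apply: measurable_funB => //.
  by apply: (measurableT_comp mr); exact: measurable_funD.
apply: measurable_funM measurable_mean_value _.
have -> : (fun s : R => ((s + delta) ^+ 2)^-1) = fun s => (s + delta)^-1 ^+ 2.
  by apply/funext => s; rewrite exprVn.
exact: measurable_funX measurable_inv_shift.
Qed.

End smooth_profile.

(** The mean of [r] lies between [r s] and [r (s + delta)]. *)
Lemma cvg_profile {R : realType} (r G : R -> R) (s : R) :
  {homo r : x y / x <= y} -> {for s, continuous r} ->
  (forall s : R, -1 < s -> is_derive s 1 G (r s)) -> 0 < s ->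
  (fun k => profile G (eps_seq k) s) @ \oo --> r s / s.
Proof.
move=> r_homo cr dG s0.
have cs : (fun k => s + eps_seq k) @ \oo --> s.
  rewrite -[X in _ --> X]addr0; apply: cvgD; first exact: cvg_cst.
  exact: cvg_harmonic.
apply: cvgM; last by apply: cvgV => //; rewrite gt_eqF.
apply: (@squeeze_cvgr _ _ _ _ (cst (r s)) (fun k => r (s + eps_seq k))).
- apply: nearW => k; apply: mean_value_bounds => //; last exact: ltW.
  exact: eps_seq_gt0.
- exact: cvg_cst.
- exact: (cvg_comp _ _ cs cr).
Qed.

(** * Reduction to a product space and conclusion *)

Section independent_transfer.
Context {R : realType} {d : measure_display} {T : measurableType d} (P : probability T R).
Context {d' : measure_display} {T' : measurableType d'} (Q : probability T' R).
Context {d1 d2 : measure_display} {T1 : measurableType d1} {T2 : measurableType d2}.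
Variables (X : {RV P >-> T1}) (S : {RV P >-> T2}) (g : T' -> T2).
Hypotheses (mg : measurable_fun setT g) (indepXS : indep_RV X S)
  (lawS : forall B, measurable B -> distribution P S B = Q (g @^-1` B)).

Let joint (w : T) := (X w, S w).
Let coupled (q : T * T') := (X q.1, g q.2).

Let mjoint : measurable_fun setT joint.
Proof. exact: measurable_fun_pair. Qed.

Let mcoupled : measurable_fun setT coupled.
Proof.
by apply: measurable_fun_pair; apply: measurableT_comp.
Qed.

HB.instance Definition _ := isMeasurableFun.Build _ _ _ _ joint mjoint.
HB.instance Definition _ := isMeasurableFun.Build _ _ _ _ coupled mcoupled.

(** Both laws give to a rectangle the product of the laws of [X] and of [S], the
latter being the law of [g]. *)
Lemma independent_pair_law (B : set (T1 * T2)) : measurable B ->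
  pushforward P joint B = pushforward (P \x Q)%E coupled B.
Proof.
move=> mB.
apply: (measure_unique _ (fun=> setT) (measurable_prod_measurableType T1 T2)) => //.
- move=> _ _ [A1 mA1 [B1 mB1 <-]] [A2 mA2 [B2 mB2 <-]].
  exists (A1 `&` A2); first exact: measurableI.
  by exists (B1 `&` B2); [exact: measurableI|rewrite setXI].
- by move=> _; exists setT => //; exists setT => //; rewrite setXTT.
- by apply/seteqP; split=> // t _; exists 0%N.
- move=> _ [A1 mA1 [B1 mB1 <-]].
  change (P (X @^-1` A1 `&` S @^-1` B1) =
    (P \x Q)%E ((X @^-1` A1) `*` (g @^-1` B1))).
  have mX : measurable (X @^-1` A1).
    by rewrite -[X in measurable X]setTI; exact: measurable_funP.
  have mgB : measurable (g @^-1` B1) by rewrite -[X in measurable X]setTI; exact: mg.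
  rewrite (product_measure1E _ Q mX mgB).
  change (P (X @^-1` A1 `&` S @^-1` B1) = P (X @^-1` A1) * Q (g @^-1` B1))%E.
  by rewrite -lawS// -indepXS.
- move=> _; change (P (joint @^-1` setT) < +oo)%E.
  by rewrite preimage_setT probability_setT ltry.
Qed.

Lemma ge0_integral_independent (f : T1 * T2 -> \bar R) :
  measurable_fun setT f -> (forall t, 0 <= f t)%E ->
  (\int[P]_w f (X w, S w) = \int[(P \x Q)%E]_q f (X q.1, g q.2))%E.
Proof.
move=> mf f0.
transitivity (\int[pushforward P joint]_t f t)%E.
  by rewrite ge0_integral_pushforward.
transitivity (\int[pushforward (P \x Q)%E coupled]_t f t)%E.
  by apply: eq_measure_integral => B mB _; exact: independent_pair_law.
by rewrite ge0_integral_pushforward.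
Qed.

End independent_transfer.

Section gram_pseudo_inverse.
Context {R : realType} {n p : nat} (M : 'M[R]_(n, p)).
Hypothesis Mu : M *m M^T \in unitmx.

(** [M' M] is its own rank factorization when [M] has full row rank. *)
Lemma mp_inverse_gram :
  mp_inverse (M^T *m M) = M^T *m invmx (M *m M^T) *m invmx (M *m M^T) *m M.
Proof.
have Mf : row_free M.
  by apply/row_freeP; exists (M^T *m invmx (M *m M^T)); rewrite mulmxA mulmxV.
have h := @is_mp_inverse_mul R _ _ _ M^T M; rewrite trmxK in h.
exact: is_mp_inverse_uniq (mp_inverseP _) (h Mf Mf).
Qed.

Lemma quad_mp_inverse (x : 'cV[R]_p) :
  (x^T *m mp_inverse (M^T *m M) *m x) 0 0 = frob2 (ols_coef M x).
Proof.
have sI : (invmx (M *m M^T))^T = invmx (M *m M^T).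
  by rewrite trmx_inv trmx_mul trmxK.
rewrite mp_inverse_gram frob2_col /ols_coef !trmx_mul sI.
by congr (_ 0 0); rewrite !mulmxA.
Qed.

Lemma range_projection (x : 'cV[R]_p) :
  M^T *m M *m mp_inverse (M^T *m M) *m x = M^T *m ols_coef M x.
Proof.
rewrite mp_inverse_gram /ols_coef !mulmxA -[M^T *m M *m M^T]mulmxA.
by rewrite mulmxK.
Qed.

Lemma delta_r_full_rank (r : R -> R) (x : 'cV[R]_p) :
  delta_r r x (M^T *m M) = x -
    (r (frob2 (ols_coef M x)) / frob2 (ols_coef M x)) *: (M^T *m ols_coef M x).
Proof.
by rewrite /delta_r /= quad_mp_inverse mulmxBl mul1mx -scalemxAl range_projection.
Qed.

End gram_pseudo_inverse.

(** A vector in the kernel of [A] is isotropic for [Sigma]. *)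
Lemma posdef_factor_unit {R : realType} p (A Sigma : 'M[R]_p) :
  posdefmx Sigma -> A *m A^T = Sigma -> A \in unitmx.
Proof.
move=> [_ pd] AS; rewrite -row_free_unit -kermx_eq0; apply/eqP/row_matrixP => i.
rewrite row0; set u := row i _; apply/eqP/negPn/negP => u0.
have := pd u^T; rewrite trmx_eq0 => /(_ u0).
by rewrite trmxK -AS mulmxA -row_mul mulmx_ker row0 !mul0mx mxE ltxx.
Qed.

Lemma measurable_delta_r {R : realType} p (r : R -> R) d (T : measurableType d)
    (x : T -> 'cV[R]_p) (S : T -> 'M[R]_p) : measurable_fun setT r ->
  measurable_fun setT x -> measurable_fun setT S ->
  measurable_fun setT (fun t => delta_r r (x t) (S t)).
Proof.
move=> mr mx mS; have mG := measurable_mp_inverse mS.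
have mF : measurable_fun setT (fun t => ((x t)^T *m mp_inverse (S t) *m x t) 0 0).
  apply: measurable_fun_entry; apply: measurable_mulmx => //.
  by apply: measurable_mulmx => //; exact: measurable_trmx.
apply: measurable_mulmx => //; apply: measurable_addmx => //.
apply: measurable_oppmx; apply: measurable_scalemx; last exact: measurable_mulmx.
apply: measurable_funM; first exact: (measurableT_comp mr mF).
exact: measurable_funV.
Qed.

Section risk_comparison.
Context {R : realType} {n p : nat} (r : R -> R).
Hypotheses (np : (n < p)%N) (r_homo : {homo r : x y / x <= y})
  (dr : forall x : R, derivable r x 1)
  (r_bounds : forall x : R, 0 <= r x <= 2 * (n%:R - 2) / (p%:R - n%:R + 3)).
Context {d : measure_display} {T : measurableType d} (P : probability T R)
  (Z : 'I_p -> {RV P >-> R}) (A : 'M[R]_p) (theta : 'cV[R]_p) (Sigma : 'M[R]_p).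
Hypotheses (stdZ : std_normal_sample Z) (Au : A \in unitmx) (AS : A *m A^T = Sigma).
Context {d' : measure_display} {T' : measurableType d'} (Q : probability T' R)
  (Y : 'I_n -> {RV Q >-> 'cV[R]_p}) (B : 'I_n -> 'M[R]_p)
  (W : 'I_n -> 'I_p -> {RV Q >-> R}).
Hypotheses (indepY : mutual_indep_RV Y) (Bu : forall i, B i \in unitmx)
  (stdW : forall i, std_normal_sample (W i)) (BS : forall i, B i *m (B i)^T = Sigma)
  (YE : forall i w, Y i w = B i *m \col_l W i l w).

Let X w := theta + A *m \col_l Z l w.
Let M w := rows_mx Y w.

(** Where [F = 0] the coefficient vanishes, so that the limit of the profiles,
which may not exist there, is immaterial. *)
Lemma canonical_risk_le :
  (\int[(P \x Q)%E]_q (loss Sigma theta (delta_r r (X q.1) ((M q.2)^T *m M q.2)))%:E <=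
   \int[P]_w (loss Sigma theta (X w))%:E)%E.
Proof.
(* If [X] has infinite risk there is nothing to prove; otherwise the finiteness
   provides the integrability of the loss. *)
have [inf|fin] := leP +oo%E (\int[P]_w (loss Sigma theta (X w))%:E)%E.
  by apply: le_trans inf; exact: leey.
have mr : measurable_fun setT r by exact: nondecreasing_measurable.
have r0 x : 0 <= r x by have /andP[] := r_bounds x.
have rC x : r x <= 2 * (n%:R - 2) / (p%:R - n%:R + 3) by have /andP[] := r_bounds x.
have [G [G_homo dG]] := exists_primitive dr r0.
set C := 2 * (n%:R - 2) / (p%:R - n%:R + 3) in rC.
have C0 : 0 <= C := le_trans (r0 0) (rC 0).
have mX1 : measurable_fun setT (fun q : T * T' => X q.1).
  apply: measurable_addmx => //; apply: measurable_mulmx => //.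
  by apply: (measurableT_comp (measurable_sample_col Z)).
have mM2 : measurable_fun setT (fun q : T * T' => M q.2).
  exact: (measurableT_comp (measurable_rows_mx Y)).
have e0 k := @eps_seq_gt0 R k.
have e1 k : eps_seq k <= 1 :> R by rewrite invf_le1// ler1n.
apply: (@fatou_cvg _ _ _ (P \x Q)%E (fun k q => loss Sigma theta
  (shrunk_estimate (profile G (eps_seq k)) (M q.2) (X q.1))) _
  (fun=> \int[P]_w (loss Sigma theta (X w))%:E)%E).
- move=> k; apply: measurable_loss; apply: measurable_shrunk_estimate => //.
  exact: measurable_profile.
- apply: measurable_loss; apply: measurable_delta_r => //.
  by apply: measurable_mulmx => //; exact: measurable_trmx.
- by move=> k q; exact: loss_ge0 Au AS _.
- move: (ae_full_rank P (ltnW np) indepY Bu stdW YE); apply: filterS => q Mu.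
  apply: cvg_loss; rewrite delta_r_full_rank//; apply: cvg_mxB; first exact: cvg_mx_cst.
  have [F0|F0] := eqVneq (frob2 (ols_coef (M q.2) (X q.1))) 0.
    move/frob2_eq0 : F0 => ->; rewrite mulmx0 scaler0.
    by under eq_fun do rewrite scaler0; exact: cvg_mx_cst.
  move=> i j; rewrite mxE; under [X in X @ _ --> _]eq_fun do rewrite mxE.
  apply: cvgM; last exact: cvg_cst.
  apply: cvg_profile => //.
    by apply: differentiable_continuous; apply/derivable1_diffP.
  by rewrite lt_def F0 frob2_ge0.
- move=> k.
  have c1 : C / eps_seq k <= 2 * C / eps_seq k ^+ 2.
    have i1 : 1 <= (eps_seq k)^-1 :> R by rewrite invf_ge1.
    rewrite -exprVn -mulrA mulrCA ler_wpM2l//; nra.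
  apply: (@smooth_risk_le R n p (profile G (eps_seq k)) (dprofile r G (eps_seq k))
    (2 * C / eps_seq k ^+ 2) _ _ _ _ _ _ _ _ P Z A theta Sigma stdZ Au AS _ _ Q Y B W
    (ltnW np) indepY Bu stdW BS YE fin).
  + by move=> s; exact: is_derive_profile.
  + by move=> s s0; apply: le_trans c1; exact: profile_bound.
  + by move=> s; exact: dprofile_bound.
  + exact: measurable_profile.
  + exact: measurable_dprofile.
  + by move=> s s0; apply: (@profile_main_le0 _ r G C).
- exact: cvg_cst.
Qed.

End risk_comparison.

(** Only the law of [S] is known, so the risk of [delta_r] is first computed on the
product of the spaces of [X] and of the Gaussian matrix. *)
Theorem corollary1 (R : realType) (n p : nat) (r : R -> R) :
  (3 <= n)%N -> (n < p)%N ->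
  {homo r : x y / x <= y} ->
  (forall x : R, derivable r x 1) ->
  (forall x : R, 0 <= r x <= 2 * (n%:R - 2) / (p%:R - n%:R + 3)) ->
  dominates n (@delta_r R p r) (@delta0 R p).
Proof.
move=> _ np r_homo dr r_bounds theta Sigma pd d T P X S.
move=> [A [Z [AS stdZ XE]]] [d' [T' [Q [Y [indepY normY lawS]]]]] indepXS.
(* Each row comes with its own square root of [Sigma] and its own normal
   sample, so that the whitening differs from row to row. *)
have /choice[BW BWE] : forall i, exists BW : 'M[R]_p * ('I_p -> {RV Q >-> R}),
    [/\ BW.1 *m BW.1^T = Sigma, std_normal_sample BW.2 &
      forall w, Y i w = BW.1 *m \col_l BW.2 l w].
  move=> i; have [B [W [BS stdW YE]]] := normY i; exists (B, W); split => //= w.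
  by rewrite YE add0r.
have Au := posdef_factor_unit pd AS.
have Bu i : (BW i).1 \in unitmx by have [BS _ _] := BWE i; exact: posdef_factor_unit BS.
have mr : measurable_fun setT r by exact: nondecreasing_measurable.
pose M w := rows_mx Y w.
have mg : measurable_fun setT (fun w => (M w)^T *m M w).
  have mM := measurable_rows_mx Y.
  by apply: measurable_mulmx => //; exact: measurable_trmx.
pose f (t : 'cV[R]_p * 'M[R]_p) := (loss Sigma theta (delta_r r t.1 t.2))%:E.
have mf : measurable_fun setT f.
  by apply/measurable_EFinP; apply: measurable_loss; exact: measurable_delta_r.
have f0 t : (0 <= f t)%E by rewrite lee_fin; exact: loss_ge0 Au AS _.
rewrite /risk unlock (ge0_integral_independent mg indepXS lawS mf f0).
rewrite /f/=; under eq_integral do rewrite XE.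
under [leRHS]eq_integral do rewrite /delta0 XE.
apply: (@canonical_risk_le R n p r np r_homo dr r_bounds _ _ P Z A theta Sigma stdZ Au
  AS _ _ Q Y (fun i => (BW i).1) (fun i => (BW i).2)) => //.
- by move=> i; have [] := BWE i.
- by move=> i; have [] := BWE i.
- by move=> i w; have [] := BWE i.
Qed.
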